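(* Let $\beta>0$, let $V:\mathbb{R}^3\to[0,\infty)$ be smooth, even, not identically zero, with $\langle x\rangle V\in L^1$, $b_0=\int V$, and $W_N(x)=N^{3\beta}V(N^\beta x)-b_0\delta(x)$. For $q\ge1$ and each $N\gg1$, there exists a choice of $f$ on $\mathbb{R}^3$ with $\|f\|_{H^q}=1$ such that, with $\phi(t)=e^{it\Delta}f$, the function $$F(t)=\int_0^te^{i(t-t')\Delta}\big[(W_N*|\phi(t')|^2)\,\phi(t')\big]\,dt'$$ satisfies $$\|F(t)\|_{L^\infty_{t\in[0,1]}H^1_x}\gtrsim N^{-q\beta},$$ with implicit constant independent of $N$.
   Context: $\delta$ is the Dirac mass at the origin of $\mathbb{R}^3$, so $W_N*g=N^{3\beta}V(N^\beta\cdot)*g-b_0g$. *)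

(* Defs.v *)
From HB Require Import structures.
From mathcomp Require Import all_boot all_order all_algebra.
From mathcomp Require Import all_classical all_reals all_analysis.
From mathcomp Require Import measurable_realfun complex.

Set Implicit Arguments.
Unset Strict Implicit.
Unset Printing Implicit Defensive.

Import Order.TTheory GRing.Theory Num.Theory.
Import numFieldNormedType.Exports.

Local Open Scope classical_set_scope.
Local Open Scope ring_scope.
Local Open Scope complex_scope.

Notation R3 R := (R * R * R)%type.

Section Space.
Context {R : realType}.

(* The library's norm on a product is the sup norm, so the Euclidean inner
   product of R^3 is written out. *)
Definition dot (x y : R3 R) : R :=
  x.1.1 * y.1.1 + x.1.2 * y.1.2 + x.2 * y.2.

Definition japanese (x : R3 R) : R := Num.sqrt (1 + dot x x).

Definition leb3 :
    {measure set (measurableTypeR R * measurableTypeR R * measurableTypeR R)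
     -> \bar R} :=
  ((@lebesgue_measure R \x @lebesgue_measure R) \x @lebesgue_measure R)%E.

Fixpoint Ck (k : nat) (f : R3 R -> R) : Prop :=
  continuous f /\
  (if k is k'.+1 then
     forall v, (forall x, derivable f x v) /\ Ck k' ('D_v f)
   else True).

Definition smooth (f : R3 R -> R) : Prop := forall k, Ck k f.

End Space.

Section Lebesgue.
Context {R : realType}.
Local Notation C := R[i].

Definition cmeasurable (f : R3 R -> C) : Prop :=
  measurable_fun setT (fun x => complex.Re (f x)) /\
  measurable_fun setT (fun x => complex.Im (f x)).

Definition cintegral (f : R3 R -> C) : C :=
  (\int[leb3]_x complex.Re (f x)) +i* (\int[leb3]_x complex.Im (f x)).

(* Elements of L^1 and L^2 are represented by measurable functions; two
   functions that agree almost everywhere stand for the same element. *)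
Definition inL1 (f : R3 R -> C) : Prop :=
  leb3.-integrable setT (fun x => (complex.Re (f x))%:E) /\
  leb3.-integrable setT (fun x => (complex.Im (f x))%:E).

Definition L2norm (f : R3 R -> C) : \bar R :=
  Lnorm leb3 2%:E (fun x => (Normc.normc (f x))%:E).

Definition inL2 (f : R3 R -> C) : Prop :=
  cmeasurable f /\ (L2norm f < +oo)%E.

End Lebesgue.

Section Fourier.
Context {R : realType}.
Local Notation C := R[i].

Definition expi (t : R) : C := cos t +i* sin t.

Definition fourierL1 (f : R3 R -> C) (xi : R3 R) : C :=
  ((2 * pi) `^ (- (3 / 2)))%:C * cintegral (fun x => expi (- dot x xi) * f x).

(* [is_fourier f g]: g represents the Fourier transform of f in L^2, i.e. the
   value at f of the continuous extension to L^2 of the Fourier transform on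
   the dense subspace of functions both in L^1 and in L^2 (Plancherel). *)
Definition is_fourier (f g : R3 R -> C) : Prop :=
  [/\ inL2 f, inL2 g &
    exists fn : nat -> R3 R -> C,
      [/\ forall n, inL1 (fn n) /\ inL2 (fn n),
          (fun n => L2norm (fn n \- f)) @ \oo --> 0%E &
          (fun n => L2norm (fourierL1 (fn n) \- g)) @ \oo --> 0%E]].

(* The H^s norm, for s >= 0: || <xi>^s fhat ||_{L^2}, where all the fhat in the
   infimum agree almost everywhere.  It is +oo when f is not in L^2. *)
Definition Hnorm (s : R) (f : R3 R -> C) : \bar R :=
  ereal_inf [set L2norm (fun xi => (japanese xi `^ s)%:C * fh xi)
            | fh in [set fh | is_fourier f fh]].

(* [is_schrodinger t f u]: u = e^{it Delta} f, as a Fourier multiplier. *)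
Definition is_schrodinger (t : R) (f u : R3 R -> C) : Prop :=
  exists fh, is_fourier f fh /\
             is_fourier u (fun xi => expi (- (t * dot xi xi)) * fh xi).

End Fourier.

Section Bochner.
Context {R : realType}.
Local Notation C := R[i].

(* [is_bochner I h F]: the L^2-valued function h is Bochner integrable on I,
   with integral F.  The n-th simple function takes the value u n i on A n i,
   for i < m n (the sum of the values if these sets overlap). *)
Definition is_bochner (I : set R) (h : R -> R3 R -> C) (F : R3 R -> C) : Prop :=
  inL2 F /\
  exists (m : nat -> nat) (A : nat -> nat -> set R) (u : nat -> nat -> R3 R -> C),
    let step n t x := \sum_(i < m n) (\1_(A n i) t)%:C * u n i x in
    let int_step n x :=
      \sum_(i < m n) (fine (@lebesgue_measure R (A n i)))%:C * u n i x in
    [/\ forall n i, [/\ measurable (A n i), A n i `<=` I,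
                        (@lebesgue_measure R (A n i) < +oo)%E & inL2 (u n i)],
        forall n, measurable_fun I (fun t => L2norm (h t \- step n t)),
        (fun n => \int[@lebesgue_measure R]_(t in I)
                    L2norm (h t \- step n t)%R)%E @ \oo --> 0%E &
        (fun n => L2norm (F \- int_step n)) @ \oo --> 0%E].

End Bochner.

Section Model.
Context {R : realType}.
Local Notation C := R[i].

Definition b0 (V : R3 R -> R) : R := \int[leb3]_x V x.

(* W_N * g, for W_N = N^{3 beta} V(N^beta .) - b0 delta. *)
Definition WN_conv (beta : R) (V : R3 R -> R) (N : R) (g : R3 R -> R)
    (x : R3 R) : R :=
  (\int[leb3]_y (N `^ (3 * beta) * V (N `^ beta *: (x - y)) * g y))
  - b0 V * g x.

Definition nonlinearity (beta : R) (V : R3 R -> R) (N : R) (phi : R3 R -> C)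
    (x : R3 R) : C :=
  (WN_conv beta V N (fun y => Normc.normc (phi y) ^+ 2) x)%:C * phi x.

(* [is_duhamel G t F]: F is the integral over [0, t] of
   e^{i(t - t') Delta} G(t') dt'. *)
Definition is_duhamel (G : R -> R3 R -> C) (t : R) (F : R3 R -> C) : Prop :=
  exists h : R -> R3 R -> C,
    (forall t', t' \in `[0, t] -> is_schrodinger (t - t') (G t') (h t')) /\
    is_bochner `[0, t] h F.

(* The L^oo norm over [0, 1], as an essential supremum, of the H^s norm. *)
Definition LooHnorm (s : R) (F : R -> R3 R -> C) : \bar R :=
  Lnorm (@lebesgue_measure R) +oo%E ((fun t => Hnorm s (F t)) \_ `[0, 1]).

End Model.

(* Main.v *)
(** Everything happens on the Fourier side.  For Lipschitz, compactly supported
    k the function Finv k has L^2 Fourier transform k, and the nonlinearity maps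
    Finv k to Finv of a trilinear expression in k, in which W_N acts as the
    multiplier - symbol (xi / N^beta), with symbol xi = int V (1 - cos (y . xi)).
    The symbol is nonnegative, and positive at some omega.  Write M = N^beta and
    take for the transform of f a normalised sum of a bump at 0 and M^-q times
    the same bump at M omega.  Then all factors of the trilinear expression are
    nonnegative, and on its support the phase
    |xi|^2 - |z|^2 + |w|^2 - |xi - z - w|^2 = 2 (xi - z) . (z + w) is O(M), so no
    cancellation occurs for times up to a multiple of 1/M.  The interaction of
    the high bump with two copies of the low one then gives at frequency M omega
    an output of size M^-q * t with t ~ 1/M, and the weight <xi> ~ M of H^1
    restores the factor M.

    Of Plancherel's theorem only the contraction property is needed.  It follows
    from the multiplication formula after regularising with the weight
    exp (- e |xi|_1), whose transform is a product of Poisson kernels. *)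

Require Import Defs.
From HB Require Import structures.
From mathcomp Require Import all_boot all_order all_algebra.
From mathcomp Require Import all_classical all_reals all_analysis.
From mathcomp Require Import measurable_realfun complex ess_sup_inf.
From mathcomp Require Import ring lra.

Set Implicit Arguments.
Unset Strict Implicit.
Unset Printing Implicit Defensive.

Import Order.TTheory GRing.Theory Num.Theory.
Import numFieldNormedType.Exports.

Local Open Scope classical_set_scope.
Local Open Scope ring_scope.
Local Open Scope complex_scope.

Local Notation nc := Normc.normc.
Local Notation cRe := complex.Re.
Local Notation cIm := complex.Im.

(** * Complex-valued integrals *)

(** Both bumps have [H^q] norm of order 1, since [<xi>^q] is about [M^q] where the second one has
    height [M^-q]; hence the normalising factor is bounded below uniformly in [N]. In the useful
    interaction the high frequency sits inside [|phi|^2], so that the symbol is evaluated near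
    [omega]; at bounded frequencies its argument is [O(1/M)], where it is close to its zero at the
    origin.

    [Hnorm] is an infimum over all representatives of the transform, so bounding it below requires
    these to agree almost everywhere, which is what the contraction property gives. Conversely
    [is_fourier] asks for approximants in [L^1], while [Finv k] need not be integrable; the weight
    that regularises the contraction also damps [Finv k].

    All transforms stay in one class, [good]: bounded, Lipschitz, supported in a box. It is closed
    under the operations of the equation, and with Lipschitz dependence on time ([gfam]) Bochner
    integrals become limits of Riemann sums with error [O(1/n)]. The constants of these classes may
    depend on [N]; uniformity is needed only in the normalisation and in the final pairing with a
    bump at [M omega], where the real part has a sign. *)

Section Normc.
Context {R : realType}.
Local Notation C := R[i].
Implicit Types (z w : C) (t : R).

Lemma ReD z w : cRe (z + w) = cRe z + cRe w. Proof. by case: z w => [a b] [c d]. Qed.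
Lemma ImD z w : cIm (z + w) = cIm z + cIm w. Proof. by case: z w => [a b] [c d]. Qed.
Lemma ReN z : cRe (- z) = - cRe z. Proof. by case: z. Qed.
Lemma ImN z : cIm (- z) = - cIm z. Proof. by case: z. Qed.
Lemma ReM z w : cRe (z * w) = cRe z * cRe w - cIm z * cIm w.
Proof. by case: z w => [a b] [c d]. Qed.
Lemma ImM z w : cIm (z * w) = cRe z * cIm w + cIm z * cRe w.
Proof. by case: z w => [a b] [c d]. Qed.
Lemma ReJ z : cRe z^* = cRe z. Proof. by case: z. Qed.
Lemma ImJ z : cIm z^* = - cIm z. Proof. by case: z. Qed.
Definition cReE := (ReD, ReN, ReM, ReJ, ImD, ImN, ImM, ImJ).

Lemma complex_eq z w : cRe z = cRe w -> cIm z = cIm w -> z = w.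
Proof. by case: z w => [a b] [c d] /= -> ->. Qed.

Lemma RCM (a b : R) : (a * b)%:C = a%:C * b%:C :> C.
Proof. by apply: complex_eq; rewrite !cReE /=; ring. Qed.
Lemma RCD (a b : R) : (a + b)%:C = a%:C + b%:C :> C.
Proof. by apply: complex_eq; rewrite !cReE /= ?addr0. Qed.
Lemma RCN (a : R) : (- a)%:C = - a%:C :> C.
Proof. by apply: complex_eq; rewrite !cReE /= ?oppr0. Qed.

Lemma normcE z : nc z = Num.sqrt (cRe z ^+ 2 + cIm z ^+ 2).
Proof. by case: z. Qed.

Lemma normc_ge0 z : 0 <= nc z. Proof. by rewrite normcE sqrtr_ge0. Qed.

Lemma sqr_nc z : nc z ^+ 2 = cRe z ^+ 2 + cIm z ^+ 2.
Proof. by rewrite normcE sqr_sqrtr// addr_ge0// sqr_ge0. Qed.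

Lemma normc_real t : nc t%:C = `|t|.
Proof. by rewrite normcE /= expr0n addr0 sqrtr_sqr. Qed.

Lemma normcJ z : nc z^* = nc z.
Proof. by rewrite !normcE !cReE sqrrN. Qed.

Lemma normc_expi t : nc (expi t) = 1.
Proof. by rewrite normcE /= cos2Dsin2 sqrtr1. Qed.

Lemma Re_le_normc z : `|cRe z| <= nc z.
Proof. by rewrite normcE -sqrtr_sqr ler_wsqrtr// lerDl sqr_ge0. Qed.

Lemma Im_le_normc z : `|cIm z| <= nc z.
Proof. by rewrite normcE -sqrtr_sqr ler_wsqrtr// lerDr sqr_ge0. Qed.

Lemma normc_le_ReIm z : nc z <= `|cRe z| + `|cIm z|.
Proof.
rewrite -(ger0_norm (normc_ge0 z)) -ler_sqr ?nnegrE ?normr_ge0 ?addr_ge0//.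
rewrite real_normK ?num_real// sqr_nc sqrrD !real_normK ?num_real//.
by rewrite -addrA lerD2l addrC lerDl mulrn_wge0// mulr_ge0.
Qed.

Lemma normc_eq0 z : nc z = 0 -> z = 0.
Proof. exact: Normc.eq0_normc. Qed.

Lemma expiD t u : expi (t + u) = expi t * expi u :> C.
Proof. by apply: complex_eq; rewrite /= ?(cosD, sinD)//; ring. Qed.

Lemma expi0 : expi 0 = 1 :> C.
Proof. by rewrite /expi cos0 sin0. Qed.

Lemma expiN t : expi (- t) = (expi t)^* :> C.
Proof. by rewrite /expi cosN sinN. Qed.

Lemma expiNM t : expi (- t) * expi t = 1 :> C.
Proof. by rewrite -expiD addNr expi0. Qed.

Lemma mulJc_normc z : z * z^* = (nc z ^+ 2)%:C.
Proof. by apply: complex_eq; rewrite !cReE /= ?sqr_nc; ring. Qed.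

Lemma normcB z w : nc (z - w) = nc (w - z).
Proof. by rewrite -normcN opprB. Qed.

Lemma Rcos_lip t u : `|cos t - cos u| <= `|t - u|.
Proof.
wlog tu : t u / t < u.
  move=> H; have [tu|ut|->] := ltgtP t u; [exact: H| |by rewrite !subrr].
  by rewrite distrC (distrC t); exact: H.
rewrite distrC (distrC t).
have [c _ ->] := @MVT_segment R (@cos R) (fun x => - sin x) t u (ltW tu)
  (fun x _ => is_derive_cos x) (continuous_subspaceT (@continuous_cos R)).
by rewrite normrM normrN; apply: ler_piMl => //; exact: sin_max.
Qed.

End Normc.

Section ComplexIntegral.
Context d (T : measurableType d) {R : realType}.
Local Notation C := R[i].
Variable mu : {measure set T -> \bar R}.
Implicit Types (f g : T -> C).

(** Versions of [cmeasurable], [cintegral] and [inL1] over an arbitrary measure, because integrals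
    over time and over product spaces occur as well; for [leb3] they are convertible to the notions
    of the statement. *)
Definition cmeas f :=
  measurable_fun setT (fun x => cRe (f x)) /\
  measurable_fun setT (fun x => cIm (f x)).

Definition cint f : C := (\int[mu]_x cRe (f x)) +i* (\int[mu]_x cIm (f x)).

Definition cintble f : Prop :=
  mu.-integrable setT (fun x => (cRe (f x))%:E) /\
  mu.-integrable setT (fun x => (cIm (f x))%:E).

Lemma cmeasD f g : cmeas f -> cmeas g -> cmeas (fun x => f x + g x).
Proof.
move=> [? ?] [? ?]; split.
  by under eq_fun do rewrite ReD; exact: measurable_funD.
by under eq_fun do rewrite ImD; exact: measurable_funD.
Qed.

Lemma cmeasN f : cmeas f -> cmeas (fun x => - f x).
Proof.
move=> [? ?]; split.
  by under eq_fun do rewrite ReN; exact: measurable_funN.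
by under eq_fun do rewrite ImN; exact: measurable_funN.
Qed.

Lemma cmeasB f g : cmeas f -> cmeas g -> cmeas (fun x => f x - g x).
Proof. by move=> mf mg; apply: cmeasD => //; exact: cmeasN. Qed.

Lemma cmeasM f g : cmeas f -> cmeas g -> cmeas (fun x => f x * g x).
Proof.
move=> [? ?] [? ?]; split.
  under eq_fun do rewrite ReM.
  by apply: measurable_funB; exact: measurable_funM.
under eq_fun do rewrite ImM.
by apply: measurable_funD; exact: measurable_funM.
Qed.

Lemma cmeasJ f : cmeas f -> cmeas (fun x => (f x)^*).
Proof.
move=> [? ?]; split.
  by under eq_fun do rewrite ReJ.
by under eq_fun do rewrite ImJ; exact: measurable_funN.
Qed.

Lemma cmeas_cst (c : C) : cmeas (fun=> c).
Proof. by split; exact: measurable_cst. Qed.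

Lemma cmeas_real (f : T -> R) : measurable_fun setT f -> cmeas (fun x => (f x)%:C).
Proof. by move=> mf; split => //=; exact: measurable_cst. Qed.

Lemma cmeas_expi (f : T -> R) : measurable_fun setT f ->
  cmeas (fun x => expi (f x)).
Proof.
move=> mf; split => /=.
  by apply: measurableT_comp => //; exact: continuous_measurable_fun (@continuous_cos R).
by apply: measurableT_comp => //; exact: continuous_measurable_fun (@continuous_sin R).
Qed.

Lemma measurable_normc f : cmeas f -> measurable_fun setT (fun x => nc (f x)).
Proof.
move=> [mr mi]; under eq_fun do rewrite normcE.
have ms : measurable_fun setT (@Num.sqrt R).
  exact: continuous_measurable_fun (@sqrt_continuous R).
apply: (measurableT_comp ms).
by apply: measurable_funD; exact: measurable_funX.
Qed.

Lemma cintble_meas f : cintble f -> cmeas f.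
Proof.
by move=> [/measurable_int/measurable_EFinP ? /measurable_int/measurable_EFinP ?].
Qed.

Lemma le_cintble f (g : T -> R) : cmeas f ->
  mu.-integrable setT (fun x => (g x)%:E) -> (forall x, nc (f x) <= g x) ->
  cintble f.
Proof.
move=> [mr mi] ig fg; split; apply: le_integrable ig => //.
- exact/measurable_EFinP.
- move=> x _ /=; rewrite lee_fin (le_trans (Re_le_normc _))//.
  by rewrite (le_trans (fg x))// ler_norm.
- exact/measurable_EFinP.
- move=> x _ /=; rewrite lee_fin (le_trans (Im_le_normc _))//.
  by rewrite (le_trans (fg x))// ler_norm.
Qed.

Lemma cintble_normc f : cintble f ->
  mu.-integrable setT (fun x => (nc (f x))%:E).
Proof.
move=> itf; have [/integrable_abse ir /integrable_abse ii] := itf.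
have i2 : mu.-integrable setT
    (fun x => `|(cRe (f x))%:E| + `|(cIm (f x))%:E|)%E.
  exact: integrableD.
apply: le_integrable i2 => //.
  by apply/measurable_EFinP; apply: measurable_normc; exact: cintble_meas.
move=> x _ /=; rewrite lee_fin ger0_norm ?normc_ge0//.
by rewrite (le_trans (normc_le_ReIm _))// ler_norm.
Qed.

Lemma cintbleD f g : cintble f -> cintble g -> cintble (fun x => f x + g x).
Proof.
move=> [? ?] [? ?]; split.
  by under eq_fun do rewrite ReD EFinD; exact: integrableD.
by under eq_fun do rewrite ImD EFinD; exact: integrableD.
Qed.

Lemma cintbleZ (c : C) f : cintble f -> cintble (fun x => c * f x).
Proof.
move=> itf; apply: (@le_cintble _ (fun x => nc c * nc (f x))).
- by apply: cmeasM; [exact: cmeas_cst|exact: cintble_meas].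
- by under eq_fun do rewrite EFinM; apply: integrableZl => //; exact: cintble_normc.
- by move=> x; rewrite Normc.normcM.
Qed.

Lemma cintbleN f : cintble f -> cintble (fun x => - f x).
Proof.
by move=> itf; under eq_fun do rewrite -mulN1r; exact: cintbleZ.
Qed.

Lemma cintbleB f g : cintble f -> cintble g -> cintble (fun x => f x - g x).
Proof. by move=> mf mg; apply: cintbleD => //; exact: cintbleN. Qed.

Lemma cintbleJ f : cintble f -> cintble (fun x => (f x)^*).
Proof.
move=> itf; apply: (@le_cintble _ (fun x => nc (f x))).
- by apply: cmeasJ; exact: cintble_meas.
- exact: cintble_normc.
- by move=> x; rewrite normcJ.
Qed.

Lemma cintble_real (f : T -> R) : mu.-integrable setT (fun x => (f x)%:E) ->
  cintble (fun x => (f x)%:C).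
Proof. by move=> itf; split => //=; exact: integrable0. Qed.

Lemma cintD f g : cintble f -> cintble g ->
  cint (fun x => f x + g x) = cint f + cint g.
Proof.
move=> [fr fi] [gr gi]; apply: complex_eq; rewrite cReE /=.
  by under eq_Rintegral do rewrite ReD; rewrite RintegralD.
by under eq_Rintegral do rewrite ImD; rewrite RintegralD.
Qed.

Lemma cintZ (c : C) f : cintble f -> cint (fun x => c * f x) = c * cint f.
Proof.
move=> [fr fi]; have h (a : R) (h : T -> R) :
    mu.-integrable setT (fun x => (h x)%:E) ->
    mu.-integrable setT (fun x => (a * h x)%:E).
  by move=> ih; under eq_fun do rewrite EFinM; exact: integrableZl.
apply: complex_eq; rewrite cReE /=.
  under eq_Rintegral do rewrite ReM.
  by rewrite RintegralB ?RintegralZl//; exact: h.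
under eq_Rintegral do rewrite ImM.
by rewrite RintegralD ?RintegralZl//; exact: h.
Qed.

Lemma cintN f : cintble f -> cint (fun x => - f x) = - cint f.
Proof.
move=> itf; rewrite -mulN1r -cintZ//.
by congr cint; apply/funext => x; rewrite mulN1r.
Qed.

Lemma cintB f g : cintble f -> cintble g ->
  cint (fun x => f x - g x) = cint f - cint g.
Proof. by move=> itf itg; rewrite cintD ?cintN//; exact: cintbleN. Qed.

Lemma cintJ f : cintble f -> cint (fun x => (f x)^*) = (cint f)^*.
Proof.
move=> [fr fi]; apply: complex_eq; rewrite cReE /=.
  by under eq_Rintegral do rewrite ReJ.
under eq_Rintegral do rewrite ImJ -mulN1r.
by rewrite RintegralZl// mulN1r.
Qed.

Lemma eq_cint f g : f =1 g -> cint f = cint g.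
Proof. by move=> fg; congr cint; apply/funext. Qed.

Lemma cint_real (f : T -> R) : cint (fun x => (f x)%:C) = (\int[mu]_x f x)%:C.
Proof. by rewrite /cint /= Rintegral_cst// mul0r. Qed.

Lemma cint0 : cint (fun=> 0) = 0.
Proof. by apply: complex_eq; rewrite /= Rintegral_cst// mul0r. Qed.

(* Rotate the integral onto the positive half-line. *)
Lemma le_normc_cint f : cintble f -> nc (cint f) <= \int[mu]_x nc (f x).
Proof.
move=> itf; set I := cint f.
have [I0|I0] := eqVneq (nc I) 0.
  by rewrite I0 Rintegral_ge0// => x _; exact: normc_ge0.
pose u : C := ((nc I)^-1)%:C * I^*.
have nu : nc u = 1.
  by rewrite Normc.normcM normc_real normcJ ger0_norm ?invr_ge0 ?normc_ge0// mulVf.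
have -> : nc I = cRe (cint (fun x => u * f x)).
  rewrite cintZ// -/I /u -mulrA [I^* * I]mulrC mulJc_normc /= mul0r subr0.
  by rewrite expr2 mulrA mulVf// mul1r.
have itu := cintbleZ u itf.
apply: le_Rintegral => //=; first by case: itu.
  exact: cintble_normc.
by move=> x _; rewrite (le_trans (ler_norm _))// (le_trans (Re_le_normc _))// Normc.normcM nu mul1r.
Qed.

Lemma le_normc_cint_bound f (g : T -> R) : cintble f ->
  mu.-integrable setT (fun x => (g x)%:E) -> (forall x, nc (f x) <= g x) ->
  nc (cint f) <= \int[mu]_x g x.
Proof.
move=> itf ig fg; apply: le_trans (le_normc_cint itf) _.
by apply: le_Rintegral => //; exact: cintble_normc.
Qed.

End ComplexIntegral.

(** * Fubini for real- and complex-valued functions *)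

Section Fubini.
Context d1 d2 (T1 : measurableType d1) (T2 : measurableType d2) {R : realType}.
Local Notation C := R[i].
Variable m1 : {sigma_finite_measure set T1 -> \bar R}.
Variable m2 : {sigma_finite_measure set T2 -> \bar R}.

(** The real-valued inner integral is [fine] of the extended one; the two differ only where the
    latter is infinite, a null set for integrable [f]. *)
Lemma Rfubini1 (f : T1 * T2 -> R) :
  (m1 \x m2)%E.-integrable setT (fun z => (f z)%:E) ->
  m1.-integrable setT (fun x => (\int[m2]_y f (x, y))%:E) /\
  \int[m1]_x \int[m2]_y f (x, y) = \int[(m1 \x m2)%E]_z f z.
Proof.
move=> itf; have iF := integrable_fubini_F itf.
have mF := measurable_fubini_F itf.
have mfF : measurable_fun setT (fun x => (\int[m2]_y f (x, y))%:E).
  by apply/measurable_EFinP; apply: measurableT_comp mF; exact: fine_measurable.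
split.
  apply: (le_integrable measurableT mfF _ iF) => x _.
  rewrite /Rintegral /fubini_F /=.
  by case: (\int[m2]_y _)%E => [r||] /=; rewrite ?normr0 ?leey.
rewrite /Rintegral -integral12_prod_meas1//; congr fine.
apply: ae_eq_integral => //.
have := integrable_ae measurableT iF; apply: filterS => x /= + _ => /(_ I).
by rewrite /fubini_F => /fineK.
Qed.

Lemma Rfubini2 (f : T1 * T2 -> R) :
  (m1 \x m2)%E.-integrable setT (fun z => (f z)%:E) ->
  m2.-integrable setT (fun y => (\int[m1]_x f (x, y))%:E) /\
  \int[m2]_y \int[m1]_x f (x, y) = \int[(m1 \x m2)%E]_z f z.
Proof.
move=> itf; have mF := measurable_fubini_G itf.
have mf := measurable_int _ itf.
have iF : m2.-integrable setT (fubini_G m1 (fun z => (f z)%:E)).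
  apply/integrableP; split => //.
  apply: le_lt_trans ((integrable21ltyP m1 m2 mf).1 itf).
  apply: ge0_le_integral => //; first exact: measurableT_comp.
    apply: (measurable_fun_fubini_tonelli_G (fun z => `|(f z)%:E|)%E) => //.
    exact: measurableT_comp.
  move=> y _; apply: le_abse_integral => //.
  by apply: (measurableT_comp mf).
have mfF : measurable_fun setT (fun y => (\int[m1]_x f (x, y))%:E).
  by apply/measurable_EFinP; apply: measurableT_comp mF; exact: fine_measurable.
split.
  apply: (le_integrable measurableT mfF _ iF) => x _.
  rewrite /Rintegral /fubini_G /=.
  by case: (\int[m1]_y _)%E => [r||] /=; rewrite ?normr0 ?leey.
rewrite /Rintegral -integral21_prod_meas1//; congr fine.
apply: ae_eq_integral => //.
have := integrable_ae measurableT iF; apply: filterS => x /= + _ => /(_ I).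
by rewrite /fubini_G => /fineK.
Qed.

Lemma cintble_fubini1 (f : T1 * T2 -> C) : cintble (m1 \x m2)%E f ->
  cintble m1 (fun x => cint m2 (fun y => f (x, y))).
Proof.
by move=> [/Rfubini1[? _] /Rfubini1[? _]]; split.
Qed.

Lemma cintble_fubini2 (f : T1 * T2 -> C) : cintble (m1 \x m2)%E f ->
  cintble m2 (fun y => cint m1 (fun x => f (x, y))).
Proof.
by move=> [/Rfubini2[? _] /Rfubini2[? _]]; split.
Qed.

Lemma cint_fubini (f : T1 * T2 -> C) : cintble (m1 \x m2)%E f ->
  cint m1 (fun x => cint m2 (fun y => f (x, y))) =
  cint m2 (fun y => cint m1 (fun x => f (x, y))).
Proof.
move=> [itr iti]; apply: complex_eq; rewrite /cint /=.
  by rewrite (Rfubini1 itr).2 (Rfubini2 itr).2.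
by rewrite (Rfubini1 iti).2 (Rfubini2 iti).2.
Qed.

Lemma integrable_prod (f : T1 -> R) (g : T2 -> R) :
  m1.-integrable setT (fun x => (f x)%:E) ->
  m2.-integrable setT (fun x => (g x)%:E) ->
  (m1 \x m2)%E.-integrable setT (fun z => (f z.1 * g z.2)%:E).
Proof.
move=> itf itg.
have mf : measurable_fun setT f by move/measurable_int/measurable_EFinP : itf.
have mg : measurable_fun setT g by move/measurable_int/measurable_EFinP : itg.
apply/integrable12ltyP.
  apply/measurable_EFinP; apply: measurable_funM.
    by apply: measurableT_comp mf _; exact: measurable_fst.
  by apply: measurableT_comp mg _; exact: measurable_snd.
rewrite (_ : (fun x => _) =
    (fun x => `|(f x)%:E| * \int[m2]_y `|(g y)%:E|)%E); last first.
  apply/funext => x /=; rewrite -ge0_integralZl//.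
    by apply: eq_integral => y _; rewrite normrM EFinM.
  by apply/measurable_EFinP; exact: measurableT_comp.
rewrite ge0_integralZr//.
- move/integrableP : itf => [_ hf]; move/integrableP : itg => [_ hg].
  by rewrite lte_mul_pinfty ?integral_ge0// ge0_fin_numE ?integral_ge0.
- by apply/measurable_EFinP; exact: measurableT_comp.
- exact: integral_ge0.
Qed.

Lemma le_cintble_prod (F : T1 * T2 -> C) (f : T1 -> R) (g : T2 -> R) :
  cmeas F -> m1.-integrable setT (fun x => (f x)%:E) ->
  m2.-integrable setT (fun x => (g x)%:E) ->
  (forall x y, nc (F (x, y)) <= f x * g y) -> cintble (m1 \x m2)%E F.
Proof.
move=> mF itf itg Ffg; apply: le_cintble (integrable_prod itf itg) _ => //.
by move=> [x y] /=.
Qed.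

End Fubini.

(** * Changes of variables *)

Section ScalingMap.
Context d (T : measurableType d) {R : realType}.
Local Notation C := R[i].
Variable mu : {measure set T -> \bar R}.

(** The pushforward of [mu] under [h] is [k mu]. One notion covers translations, dilations and
    reflections, and stated for nonnegative functions it passes to product measures by Tonelli. *)
Definition scaling_map (k : R) (h : T -> T) := [/\ 0 <= k, measurable_fun setT h &
  forall f : T -> \bar R, measurable_fun setT f -> (forall x, 0 <= f x)%E ->
   (\int[mu]_x f (h x) = k%:E * \int[mu]_x f x)%E].

Lemma scaling_integrable k h (f : T -> R) : scaling_map k h ->
  mu.-integrable setT (fun x => (f x)%:E) ->
  mu.-integrable setT (fun x => (f (h x))%:E) /\
  \int[mu]_x f (h x) = k * \int[mu]_x f x.
Proof.
move=> [k0 mh hE] itf; have [/measurable_EFinP mf finf] := integrableP _ _ _ itf.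
have mfh : measurable_fun setT (f \o h) by exact: measurableT_comp.
have itfh : mu.-integrable setT (fun x => (f (h x))%:E).
  apply/integrableP; split; first exact/measurable_EFinP.
  rewrite (hE (fun x => `|(f x)%:E|)%E)//; last first.
    by apply/measurable_EFinP; exact: measurableT_comp.
  by rewrite lte_mul_pinfty ?lee_fin.
split => //; rewrite /Rintegral.
rewrite integralE [in RHS]integralE.
have -> : (\int[mu]_x (fun x => (f (h x))%:E)^\+ x =
    \int[mu]_x (fun x => (f x)%:E)^\+ (h x))%E.
  by apply: eq_integral => x _; rewrite !funeposE.
have -> : (\int[mu]_x (fun x => (f (h x))%:E)^\- x =
    \int[mu]_x (fun x => (f x)%:E)^\- (h x))%E.
  by apply: eq_integral => x _; rewrite !funenegE.
have mp : measurable_fun setT ((fun x => (f x)%:E)^\+)%E.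
  by apply: measurable_funepos; exact/measurable_EFinP.
have mn : measurable_fun setT ((fun x => (f x)%:E)^\-)%E.
  by apply: measurable_funeneg; exact/measurable_EFinP.
rewrite !hE//.
have fp : (\int[mu]_x (fun x => (f x)%:E)^\+ x \is a fin_num)%E.
  exact: integrable_pos_fin_num.
have fn : (\int[mu]_x (fun x => (f x)%:E)^\- x \is a fin_num)%E.
  exact: integrable_neg_fin_num.
by case: (\int[mu]_x (fun x => (f x)%:E)^\+ x)%E fp => // p _;
  case: (\int[mu]_x (fun x => (f x)%:E)^\- x)%E fn => // n _ /=; rewrite mulrBr.
Qed.

Lemma scaling_cint k h (f : T -> C) : scaling_map k h -> cintble mu f ->
  cintble mu (fun x => f (h x)) /\
  cint mu (fun x => f (h x)) = k%:C * cint mu f.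
Proof.
move=> sh [/(scaling_integrable sh)[? Er] /(scaling_integrable sh)[? Ei]].
split; first by split.
by apply: complex_eq; rewrite ?ReM ?ImM /cint /= ?Er ?Ei; ring.
Qed.

End ScalingMap.

Section Affine1.
Context {R : realType}.
Local Notation leb := (@lebesgue_measure R).

Lemma measurable_affine (a b : R) :
  measurable_fun setT (fun x : measurableTypeR R => a * x + b : measurableTypeR R).
Proof.
have ma : measurable_fun setT (fun x : measurableTypeR R => a * x : R).
  exact: mulrl_measurable.
have mb : measurable_fun setT (fun _ : measurableTypeR R => b : R).
  exact: measurable_cst.
exact: measurable_funD ma mb.
Qed.

(** [a] times the pushforward of Lebesgue measure gives half-open intervals their length, so it is
    Lebesgue measure by uniqueness. *)
Lemma scaling_affine1 (a b : R) : 0 < a ->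
  scaling_map leb a^-1 (fun x : measurableTypeR R => a * x + b : measurableTypeR R).
Proof.
move=> a0; split; [by rewrite invr_ge0 ltW|exact: measurable_affine|].
move=> f mf f0.
set h := (fun x : measurableTypeR R => a * x + b : measurableTypeR R).
have mh : measurable_fun setT h := measurable_affine a b.
have ai0 : 0 <= a^-1 by rewrite invr_ge0 ltW.
have -> : (\int[leb]_x f (h x) = \int[pushforward leb h]_x f x)%E.
  by rewrite (ge0_integral_pushforward mh)//.
pose pf : {measure set (measurableTypeR R) -> \bar R} :=
  measure_function_pushforward__canonical__measure_function_Measure leb mh.
pose nu : {measure set (measurableTypeR R) -> \bar R} :=
  mscale (NngNum (ltW a0)) pf.
have -> : (\int[leb]_x f x = \int[nu]_x f x)%E.
  apply: eq_measure_integral => A mA _.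
  apply: lebesgue_measure_unique => // _ [[u v]] _ <-.
  rewrite [RHS](_ : _ = a%:E * leb (h @^-1` `]u, v]%classic))%E//.
  have -> : h @^-1` `]u, v] = `](u - b) / a, (v - b) / a]%classic.
    apply/seteqP; split => x /=; rewrite !in_itv/= /h.
      by rewrite ltr_pdivrMr// ler_pdivlMr// ltrBlDr lerBrDr mulrC.
    by rewrite ltr_pdivrMr// ler_pdivlMr// ltrBlDr lerBrDr mulrC.
  rewrite !lebesgue_measure_itv/= !lte_fin ltr_pM2r ?invr_gt0// ltrD2r.
  case: ifP => _; last by rewrite mule0.
  rewrite -!EFinD -EFinM; congr EFin.
  by field; rewrite gt_eqF.
rewrite ge0_integral_mscale//= muleA -EFinM mulVf ?mul1e// gt_eqF//.
Qed.

Lemma scaling_opp1 :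
  scaling_map leb 1 (fun x : measurableTypeR R => - x : measurableTypeR R).
Proof.
split; [by []|exact: oppr_measurable|].
move=> f mf f0; rewrite mul1e.
set h := (fun x : measurableTypeR R => - x : measurableTypeR R).
have mh : measurable_fun setT h by exact: oppr_measurable.
have -> : (\int[leb]_x f (h x) = \int[pushforward leb h]_x f x)%E.
  by rewrite (ge0_integral_pushforward mh)//.
by apply: eq_measure_integral => A mA _; exact: lebesgue_measureN.
Qed.

End Affine1.

Section Product.
Context d1 d2 (T1 : measurableType d1) (T2 : measurableType d2) {R : realType}.
Variable m1 : {sigma_finite_measure set T1 -> \bar R}.
Variable m2 : {sigma_finite_measure set T2 -> \bar R}.

Lemma scaling_map_prod k1 k2 h1 h2 : scaling_map m1 k1 h1 -> scaling_map m2 k2 h2 ->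
  scaling_map (m1 \x m2)%E (k1 * k2) (fun z => (h1 z.1, h2 z.2)).
Proof.
move=> [k10 mh1 h1E] [k20 mh2 h2E]; split; first exact: mulr_ge0.
  apply: measurable_fun_pair.
    by apply: measurableT_comp mh1 _; exact: measurable_fst.
  by apply: measurableT_comp mh2 _; exact: measurable_snd.
move=> f mf f0.
rewrite (fubini_tonelli1 (fun z => f (h1 z.1, h2 z.2)))//; last first.
  apply: measurableT_comp mf _; apply: measurable_fun_pair.
    by apply: measurableT_comp mh1 _; exact: measurable_fst.
  by apply: measurableT_comp mh2 _; exact: measurable_snd.
rewrite /fubini_F /=.
rewrite (fubini_tonelli1 f)// /fubini_F.
have mF : measurable_fun setT (fun x => \int[m2]_y f (x, y))%E.
  exact: measurable_fun_fubini_tonelli_F.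
under eq_integral => x _.
  rewrite (h2E (fun y => f (h1 x, y)))//; last exact: measurableT_comp.
  over.
rewrite ge0_integralZl//=.
- rewrite (h1E (fun x => \int[m2]_y f (x, y))%E)//; last first.
    by move=> x; exact: integral_ge0.
  by rewrite muleA -EFinM mulrC.
- by apply: (measurableT_comp mF).
- by move=> x _; exact: integral_ge0.
Qed.

End Product.

(** * Lebesgue measure on R^3 *)

Section Space3.
Context {R : realType}.
Local Notation C := R[i].
Local Notation leb := (@lebesgue_measure R).
Local Notation T1 := (measurableTypeR R).
Local Notation T3 := (T1 * T1 * T1)%type.
Implicit Types (x y xi : R3 R).

(** The l^1 norm is used throughout because [exp (- e |x|_1)] factors over the coordinates, which
    reduces its transform to dimension one. *)
Definition norm1 x : R := `|x.1.1| + `|x.1.2| + `|x.2|.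

Lemma norm1_ge0 x : 0 <= norm1 x.
Proof. by rewrite !addr_ge0. Qed.

Lemma norm1N x : norm1 (- x) = norm1 x.
Proof. by rewrite /norm1 /= !normrN. Qed.

Lemma norm1B x y : norm1 (x - y) = norm1 (y - x).
Proof. by rewrite -norm1N opprB. Qed.

Lemma norm1D x y : norm1 (x + y) <= norm1 x + norm1 y.
Proof.
rewrite /norm1 /=; have := ler_normD x.1.1 y.1.1.
by have := ler_normD x.1.2 y.1.2; have := ler_normD x.2 y.2; lra.
Qed.

Lemma norm1Z a x : norm1 (a *: x) = `|a| * norm1 x.
Proof. by rewrite /norm1 /= !normrM !mulrDr. Qed.

Lemma dotC x y : dot x y = dot y x.
Proof. by rewrite /dot; ring. Qed.
Lemma dotDl x y xi : dot (x + y) xi = dot x xi + dot y xi.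
Proof. by rewrite /dot /=; ring. Qed.
Lemma dotNl x xi : dot (- x) xi = - dot x xi.
Proof. by rewrite /dot /=; ring. Qed.
Lemma dotBl x y xi : dot (x - y) xi = dot x xi - dot y xi.
Proof. by rewrite dotDl dotNl. Qed.
Lemma dotDr x y xi : dot xi (x + y) = dot xi x + dot xi y.
Proof. by rewrite !(dotC xi) dotDl. Qed.
Lemma dotNr x xi : dot xi (- x) = - dot xi x.
Proof. by rewrite !(dotC xi) dotNl. Qed.
Lemma dotBr x y xi : dot xi (x - y) = dot xi x - dot xi y.
Proof. by rewrite !(dotC xi) dotBl. Qed.
Lemma dotZl a x xi : dot (a *: x) xi = a * dot x xi.
Proof. by rewrite /dot /= /GRing.scale /=; ring. Qed.
Lemma dotZr a x xi : dot xi (a *: x) = a * dot xi x.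
Proof. by rewrite !(dotC xi) dotZl. Qed.
Lemma abs_dot x y : `|dot x y| <= norm1 x * norm1 y.
Proof.
rewrite /dot /norm1; apply: le_trans (ler_normD _ _) _.
apply: le_trans (lerD (ler_normD _ _) (lexx _)) _; rewrite !normrM.
have := normr_ge0 x.1.1; have := normr_ge0 x.1.2; have := normr_ge0 x.2.
have := normr_ge0 y.1.1; have := normr_ge0 y.1.2; have := normr_ge0 y.2.
move: (`|x.1.1|) (`|x.1.2|) (`|x.2|) (`|y.1.1|) (`|y.1.2|) (`|y.2|) => a b c d e f.
by move=> *; nra.
Qed.

Lemma dot_ge0 x : 0 <= dot x x.
Proof. by rewrite /dot -!expr2 !addr_ge0// sqr_ge0. Qed.

Section Measurability.
Context d (T : measurableType d).
Implicit Types (f g : T -> T3).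

Lemma meas3P f : measurable_fun setT f <->
  [/\ measurable_fun setT (fun t => (f t).1.1 : R),
      measurable_fun setT (fun t => (f t).1.2 : R) &
      measurable_fun setT (fun t => (f t).2 : R)].
Proof.
split=> [mf|[m1 m2 m3]].
  have m1 : measurable_fun setT (fun t => (f t).1).
    by apply: measurableT_comp mf; exact: measurable_fst.
  split.
  - by apply: measurableT_comp m1; exact: measurable_fst.
  - by apply: measurableT_comp m1; exact: measurable_snd.
  - by apply: measurableT_comp mf; exact: measurable_snd.
rewrite (_ : f = fun t => ((f t).1.1, (f t).1.2, (f t).2)).
  by apply: measurable_fun_pair => //; exact: measurable_fun_pair.
by apply/funext => t; case: (f t) => [[]].
Qed.

Lemma meas3D f g : measurable_fun setT f -> measurable_fun setT g ->
  measurable_fun setT (fun t => (f t : R3 R) + g t : T3).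
Proof.
move=> /meas3P[? ? ?] /meas3P[? ? ?]; apply/meas3P.
by split; exact: measurable_funD.
Qed.

Lemma meas3N f : measurable_fun setT f ->
  measurable_fun setT (fun t => - (f t : R3 R) : T3).
Proof.
move=> /meas3P[m1 m2 m3]; apply/meas3P.
by split; [exact: measurable_funN m1|exact: measurable_funN m2|exact: measurable_funN m3].
Qed.

Lemma meas3B f g : measurable_fun setT f -> measurable_fun setT g ->
  measurable_fun setT (fun t => (f t : R3 R) - g t : T3).
Proof. by move=> mf mg; apply: meas3D mf _; exact: meas3N. Qed.

Lemma meas3Z a f : measurable_fun setT f ->
  measurable_fun setT (fun t => a *: (f t : R3 R) : T3).
Proof.
have h (u : T -> R) : measurable_fun setT u -> measurable_fun setT (fun t => a * u t).
  by move=> mu; apply: measurable_funM mu; exact: measurable_cst.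
by move=> /meas3P[m1 m2 m3]; apply/meas3P; split; apply: h.
Qed.

Lemma meas_dot f g : measurable_fun setT f -> measurable_fun setT g ->
  measurable_fun setT (fun t => dot (f t) (g t)).
Proof.
move=> /meas3P[? ? ?] /meas3P[? ? ?].
by apply: measurable_funD; [apply: measurable_funD|]; exact: measurable_funM.
Qed.

Lemma meas_norm1 f : measurable_fun setT f ->
  measurable_fun setT (fun t => norm1 (f t)).
Proof.
by move=> /meas3P[? ? ?]; apply: measurable_funD; [apply: measurable_funD|];
  exact: measurableT_comp.
Qed.

Lemma cmeas_comp f (k : R3 R -> C) : cmeas (k : T3 -> C) -> measurable_fun setT f ->
  cmeas (fun t => k (f t)).
Proof.
by move=> [mr mi] mf; split; [exact: measurableT_comp mr mf|exact: measurableT_comp mi mf].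
Qed.

End Measurability.

Definition leb2 : {measure set (T1 * T1)%type -> \bar R} := (leb \x leb)%E.

Lemma leb_sym_itv (r : R) : 0 <= r -> leb `[- r, r]%classic = (2 * r)%:E.
Proof.
move=> r0; rewrite lebesgue_measure_itv/= lte_fin.
case: ifPn => [_|]; first by rewrite -EFinB; congr EFin; ring.
by rewrite -leNgt => h; congr EFin; lra.
Qed.

Lemma leb2_square (r : R) : 0 <= r ->
  leb2 (`[- r, r]%classic `*` `[- r, r]%classic) = ((2 * r) * (2 * r))%:E.
Proof.
move=> r0; rewrite /leb2; etransitivity; first exact: product_measure1E.
by rewrite EFinM; congr (_ * _)%E; exact: leb_sym_itv.
Qed.

Lemma leb2_sigma_finite : sigma_finite setT leb2.
Proof.
exists (fun n => `[- n%:R, n%:R]%classic `*` `[- n%:R, n%:R]%classic); last first.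
  move=> n; split; first exact: measurableX.
  by rewrite leb2_square// ltry.
apply/seteqP; split => // -[a b] _.
exists (Num.truncn (`|a| + `|b|)).+1 => //=.
have := truncnS_gt (`|a| + `|b|) => h.
have := normr_ge0 a; have := normr_ge0 b.
by rewrite !in_itv /= -!ler_norml => *; split; lra.
Qed.

(** The same measure as [leb2], bundled with its sigma-finiteness so that product measures and
    Fubini apply to it; [leb3s] plays the same part for [leb3]. *)
Definition leb2s : {sigma_finite_measure set (T1 * T1)%type -> \bar R} :=
  HB.pack_for (SigmaFiniteMeasure.type (T1 * T1)%type R) (Measure.sort leb2)
    (@Measure_isSigmaFinite.Build _ (T1 * T1)%type R leb2 leb2_sigma_finite).

Lemma scaling_affine (a : R) (b : R3 R) : 0 < a ->
  scaling_map (@leb3 R) (a ^- 3) (fun x : T3 => a *: (x : R3 R) + b : T3).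
Proof.
move=> a0.
have H2 : scaling_map leb2s _ _ :=
  scaling_map_prod (scaling_affine1 b.1.1 a0) (scaling_affine1 b.1.2 a0).
have H : scaling_map (@leb3 R) _ _ := scaling_map_prod H2 (scaling_affine1 b.2 a0).
have -> : a ^- 3 = a^-1 * a^-1 * a^-1 by rewrite -exprVn exprS expr2 mulrA.
rewrite (_ : (fun x : T3 => _) = (fun z : T3 =>
  ((a * z.1.1 + b.1.1, a * z.1.2 + b.1.2), a * z.2 + b.2)))//.
Qed.

Lemma scaling_opp : scaling_map (@leb3 R) 1 (fun x : T3 => - (x : R3 R) : T3).
Proof.
have H2 : scaling_map leb2s _ _ := scaling_map_prod (@scaling_opp1 R) (@scaling_opp1 R).
have H : scaling_map (@leb3 R) _ _ := scaling_map_prod H2 (@scaling_opp1 R).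
rewrite !mul1r in H.
rewrite (_ : (fun x : T3 => _) = (fun z : T3 => ((- z.1.1, - z.1.2), - z.2)))//.
Qed.

Lemma scaling_comp d (T : measurableType d) (mu : {measure set T -> \bar R})
    k1 k2 h1 h2 : scaling_map mu k1 h1 -> scaling_map mu k2 h2 ->
  scaling_map mu (k2 * k1) (fun t : T => h1 (h2 t)).
Proof.
move=> [k10 mh1 h1E] [k20 mh2 h2E]; split; [exact: mulr_ge0|exact: measurableT_comp|].
move=> f mf f0; rewrite (h2E (fun t => f (h1 t)))//; last exact: measurableT_comp.
by rewrite h1E// muleA -EFinM.
Qed.

Lemma scaling_shift (b : R3 R) :
  scaling_map (@leb3 R) 1 (fun x : T3 => (x : R3 R) + b : T3).
Proof.
have := scaling_affine b ltr01; rewrite expr1n invr1.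
by rewrite (_ : (fun x => _) = (fun x : T3 => (x : R3 R) + b : T3))//;
  apply/funext => x; rewrite scale1r.
Qed.

Lemma scaling_refl (b : R3 R) :
  scaling_map (@leb3 R) 1 (fun x : T3 => b - (x : R3 R) : T3).
Proof.
have := scaling_comp (scaling_shift b) scaling_opp; rewrite mul1r.
by rewrite (_ : (fun x => _) = (fun x : T3 => b - (x : R3 R) : T3))//;
  apply/funext => x; rewrite addrC.
Qed.

Lemma bigcup_rat3_measurable d (T : measurableType d) (F : rat * rat * rat -> set T) :
  (forall q, measurable (F q)) -> measurable (\bigcup_q F q).
Proof.
move=> mF; rewrite (_ : \bigcup_q F q =
    \bigcup_n (if unpickle n is Some q then F q else set0)).
  by apply: bigcupT_measurable => n; case: unpickle.
apply/seteqP; split=> [t [q _ Fq]|t [n _]].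
  by exists (pickle q); [exact: I|rewrite pickleK].
by case: (unpickle n) => // q Fq; exists q.
Qed.

Definition ratr3 (q : rat * rat * rat) : R3 R := (ratr q.1.1, ratr q.1.2, ratr q.2).

Lemma ratr3_dense x (e : R) : 0 < e -> exists q, norm1 (x - ratr3 q) < e.
Proof.
move=> e0.
have h (u : R) : exists q : rat, `|u - ratr q| < e / 3.
  have /rat_in_itvoo[q] : u - e / 3 < u + e / 3.
    by rewrite ltrBlDr -addrA ltrDl addr_gt0// divr_gt0.
  rewrite inE /= => /itvP qI; exists q.
  have h1 : u - e / 3 < ratr q by rewrite qI.
  have h2 : ratr q < u + e / 3 by rewrite qI.
  by rewrite ltr_norml; lra.
have [q1 h1] := h x.1.1; have [q2 h2] := h x.1.2; have [q3 h3] := h x.2.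
by exists (q1, q2, q3); rewrite /norm1 /=; lra.
Qed.

(** By the Lipschitz bound, [f x < c] holds exactly when [f q + L |x - q| < c] for some rational
    point [q]. Sublevel sets are thus countable unions of sets visibly measurable in the product
    sigma-algebra. *)
Lemma lip_measurable (f : R3 R -> R) (L : R) :
  (forall x y, `|f x - f y| <= L * norm1 (x - y)) ->
  measurable_fun setT (f : T3 -> R).
Proof.
move=> fL.
have L0 : 0 <= L.
  have := fL (1, 0, 0) 0; rewrite subr0 /norm1 /= normr1 normr0 !addr0 mulr1.
  exact: le_trans.
apply: (measurability _ (RGenInftyO.measurableE R)) => //.
move=> /= _ [_ [c ->] <-]; rewrite setTI.
rewrite (_ : _ @^-1` _ =
    \bigcup_q [set x : T3 | f (ratr3 q) + L * norm1 ((x : R3 R) - ratr3 q) < c]).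
  apply: bigcup_rat3_measurable => q.
  rewrite -[X in measurable X]setTI.
  apply: measurable_fun_ltr (measurableT) _ _ => //.
  apply: measurable_funD; first exact: measurable_cst.
  apply: measurable_funM; first exact: measurable_cst.
  apply: meas_norm1; apply: meas3B; first exact: measurable_id.
  exact: measurable_cst.
apply/seteqP; split => [x /=|x [q _ /=]]; rewrite in_itv /=; last first.
  by apply: le_lt_trans; have := ler_norm (f x - f (ratr3 q)); have := fL x (ratr3 q); lra.
(* Since [f q + L |x - q| <= f x + 2 L |x - q|], a rational point closer than this suffices; the
   added 1 keeps the denominator positive when [L = 0]. *)
move=> fc; have e0 : 0 < (c - f x) / (2 * L + 1).
  by rewrite divr_gt0 ?subr_gt0// ltr_wpDl// mulr_ge0.
have [q hq] := ratr3_dense x e0; exists q => //=.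
rewrite ltr_pdivlMr in hq; last by rewrite ltr_wpDl// mulr_ge0.
have := fL (ratr3 q) x; rewrite norm1B => hL.
have := ler_norm (f (ratr3 q) - f x).
have [->|n0] := eqVneq (norm1 (x - ratr3 q)) 0.
  move: hL; have [|n0'] := eqVneq (norm1 (x - ratr3 q)) 0.
    by move=> ->; rewrite !mulr0 addr0; lra.
  by have := norm1_ge0 (x - ratr3 q); nra.
by have := norm1_ge0 (x - ratr3 q); nra.
Qed.

Definition clip (L : R) (f : R3 R -> C) := forall x y, nc (f x - f y) <= L * norm1 (x - y).

Lemma clip_cmeas L f : clip L f -> cmeas (f : T3 -> C).
Proof.
move=> fL; split; apply: (@lip_measurable _ L) => x y.
  by apply: le_trans (fL x y); rewrite -ReN -ReD Re_le_normc.
by apply: le_trans (fL x y); rewrite -ImN -ImD Im_le_normc.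
Qed.

Definition box (r : R) : set T3 :=
  [set x | [/\ `|x.1.1| <= r, `|x.1.2| <= r & `|x.2| <= r]].

Lemma boxE r : box r = (`[- r, r] `*` `[- r, r]) `*` `[- r, r].
Proof.
apply/seteqP; split => [[[a b] c]|[[a b] c]] /=; rewrite !in_itv /= -!ler_norml.
  by case=> /= -> -> ->.
by move=> [[h1 h2] h3]; split.
Qed.

Lemma measurable_box r : measurable (box r).
Proof.
by rewrite boxE; apply: measurableX => //; apply: measurableX.
Qed.

Lemma leb3_box r : 0 <= r -> leb3 (box r) = ((2 * r) ^+ 3)%:E.
Proof.
move=> r0; rewrite boxE.
have m1 : measurable (`[- r, r]%classic : set T1) by exact: measurable_itv.
have m2 : measurable (`[- r, r] `*` `[- r, r] : set (T1 * T1)) by exact: measurableX.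
rewrite (_ : (2 * r) ^+ 3 = (2 * r) * (2 * r) * (2 * r)); last by ring.
etransitivity; first exact: (product_measure1E leb2s leb m2 m1).
rewrite EFinM; congr (_ * _)%E; [exact: leb2_square|exact: leb_sym_itv].
Qed.

Lemma leb3_sigma_finite : sigma_finite setT (@leb3 R).
Proof.
exists (fun n => box n%:R); last first.
  by move=> n; split; [exact: measurable_box|rewrite leb3_box// ltry].
apply/seteqP; split => // x _.
exists (Num.truncn (norm1 x)).+1 => //=.
have := truncnS_gt (norm1 x); rewrite /norm1 => h.
have := normr_ge0 x.1.1; have := normr_ge0 x.1.2; have := normr_ge0 x.2.
by move=> *; split; lra.
Qed.

Definition leb3s : {sigma_finite_measure set T3 -> \bar R} :=
  HB.pack_for (SigmaFiniteMeasure.type T3 R) (Measure.sort (@leb3 R))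
    (@Measure_isSigmaFinite.Build _ T3 R (@leb3 R) leb3_sigma_finite).

Lemma integrable_box r : leb3.-integrable setT (fun x => (\1_(box r) x : R)%:E).
Proof.
have mb := measurable_box r.
apply/integrableP; split; first by apply/measurable_EFinP; exact: measurable_indic.
have -> : (\int[@leb3 R]_x `|(\1_(box r) x)%:E| =
    \int[@leb3 R]_x (\1_(box r) x)%:E)%E.
  by apply: eq_integral => t _; rewrite gee0_abs// lee_fin.
rewrite integral_indic ?setIT//.
have [r0|r0] := leP 0 r; first by rewrite leb3_box// ltry.
rewrite (_ : box r = set0) ?measure0//.
apply/seteqP; split => // x [/=]; have := normr_ge0 x.1.1; lra.
Qed.

Lemma Rintegral_box r : 0 <= r -> \int[@leb3 R]_x \1_(box r) x = (2 * r) ^+ 3.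
Proof.
move=> r0; rewrite /Rintegral integral_indic ?setIT//; last exact: measurable_box.
by rewrite leb3_box.
Qed.

Lemma box_le r s x : r <= s -> box r x -> box s x.
Proof. by move=> rs [? ? ?]; split; apply: le_trans rs. Qed.

Lemma indic_box_le r s x : r <= s -> (\1_(box r) x : R) <= \1_(box s) x.
Proof.
move=> rs; rewrite !indicE; have [|] := boolP (x \in box r); last by rewrite ler0n.
by rewrite inE => h; rewrite mem_set//; exact: box_le h.
Qed.

End Space3.

(** * One-dimensional transforms of [exp (- |x|)] and the mass of [2 / (1 + x^2)] *)

Section Laplace.
Context {R : realType}.
Local Notation C := R[i].
Local Notation leb := (@lebesgue_measure R).

Lemma continuous_comp_norm (f : R -> R) : continuous f ->
  continuous (fun x : R => f `|x|).
Proof.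
move=> cf x; apply: (@continuous_comp _ _ _ (fun x : R => `|x|) f); last exact: cf.
exact: norm_continuous.
Qed.

Lemma integral_even_FTC (f F : R -> R) (l : R) :
  (forall x : R, is_derive x 1 F (f x)) -> continuous f -> (forall x : R, 0 <= f `|x|) ->
  F x @[x --> +oo] --> l ->
  (\int[leb]_x (f `|x|)%:E = (2 * (l - F 0))%:E)%E.
Proof.
move=> dF cf f0 Fl.
have cg : continuous (fun x : R => f `|x|).
  exact: continuous_comp_norm.
rewrite (@ge0_symfun_integralT _ (fun x : R => f `|x|))//; last first.
  by move=> x /=; rewrite normrN.
rewrite (_ : [set x : R | 0 <= x] = `[0, +oo[%classic); last first.
  by apply/seteqP; split => x /=; rewrite in_itv/= andbT.
have -> : (\int[leb]_(x in `[0%R, +oo[) (f `|x|)%:E =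
    \int[leb]_(x in `[0%R, +oo[) (f x)%:E)%E.
  by apply: eq_integral => x; rewrite inE /= in_itv /= andbT => x0; rewrite ger0_norm.
have F' (x : R) : derive1 F x = f x by rewrite derive1E; apply: derive_val.
have dF1 (x : R) : derivable F x 1 by have [] := dF x.
rewrite (@ge0_continuous_FTC2y _ f F 0 l)//.
- by move=> x x0; have := f0 x; rewrite ger0_norm.
- by apply: continuous_subspaceT => x; exact: cf.
- by apply: cvg_at_right_filter; apply: differentiable_continuous; exact/derivable1_diffP.
Qed.

Lemma is_derive_expRN (x : R) : is_derive x 1 (fun u => expR (- u)) (- expR (- x)).
Proof.
have := @is_derive1_comp R expR -%R x (expR (- x)) (-1) _ _.
by rewrite mulrN1; apply.
Qed.

Lemma continuous_expRN : continuous (fun u : R => expR (- u)).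
Proof.
move=> x; apply: differentiable_continuous; apply/derivable1_diffP.
by have [] := is_derive_expRN x.
Qed.

Lemma integral_expRN : (\int[leb]_x (expR (- `|x|))%:E = 2%:E)%E.
Proof.
have dF (x : R) : is_derive x 1 (fun x => - expR (- x)) (expR (- x)).
  have d := is_derive_expRN x.
  have -> : (fun x => - expR (- x)) = - (fun x : R => expR (- x)) by [].
  by apply: is_derive_eq; rewrite opprK.
have F0 : - expR (- x) @[x --> +oo%R] --> (0 : R).
  by rewrite -oppr0; apply: cvgN; exact: cvgr_expR.
rewrite (integral_even_FTC dF continuous_expRN _ F0); last by move=> x; exact: expR_ge0.
by rewrite oppr0 expR0 sub0r opprK mulr1.
Qed.

Lemma measurable_expRN : measurable_fun setT (fun x : R => expR (- `|x|)).
Proof.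
apply: continuous_measurable_fun.
exact: continuous_comp_norm continuous_expRN.
Qed.

Lemma integrable_expRN : leb.-integrable setT (fun x => (expR (- `|x|))%:E).
Proof.
apply/integrableP; split; first by apply/measurable_EFinP; exact: measurable_expRN.
rewrite (_ : (\int[_]_x _ = \int[leb]_x (expR (- `|x|))%:E)%E); last first.
  by apply: eq_integral => x _; rewrite gee0_abs// lee_fin expR_ge0.
by rewrite integral_expRN ltry.
Qed.

Lemma is_derive_cosZ (xi x : R) :
  is_derive x 1 (fun u => cos (xi * u)) (- xi * sin (xi * x)).
Proof.
have d : is_derive x 1 (fun u => xi * u) xi.
  have -> : (fun u => xi * u) = xi *: (id : R -> R) by [].
  by apply: is_derive_eq; rewrite /GRing.scale /= mulr1.
have dc := @is_derive1_comp R (@cos R) (fun u => xi * u) x _ _ (is_derive_cos _) d.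
by apply: is_derive_eq; rewrite mulrC mulrN mulNr.
Qed.

Lemma is_derive_sinZ (xi x : R) :
  is_derive x 1 (fun u => sin (xi * u)) (xi * cos (xi * x)).
Proof.
have d : is_derive x 1 (fun u => xi * u) xi.
  have -> : (fun u => xi * u) = xi *: (id : R -> R) by [].
  by apply: is_derive_eq; rewrite /GRing.scale /= mulr1.
have dc := @is_derive1_comp R (@sin R) (fun u => xi * u) x _ _ (is_derive_sin _) d.
by apply: is_derive_eq; rewrite mulrC.
Qed.

(* The factor 1 - cos instead of cos makes the integrand nonnegative. *)
Lemma integral_expRN_1Bcos (xi : R) :
  (\int[leb]_x (expR (- `|x|) * (1 - cos (xi * `|x|)))%:E =
   (2 * (1 - (1 + xi ^+ 2)^-1))%:E)%E.
Proof.
have n0 : 1 + xi ^+ 2 != 0 by rewrite gt_eqF// ltr_wpDr// sqr_ge0.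
(* [exp (- u) (xi sin (xi u) - cos (xi u)) / (1 + xi^2)] is a primitive of [exp (- u) cos (xi u)],
   so [- exp (- u) G u] is one of [exp (- u) (1 - cos (xi u))]. *)
pose G u := 1 + (xi * sin (xi * u) - cos (xi * u)) / (1 + xi ^+ 2).
have dF (x : R) : is_derive x 1 (fun x => - (expR (- x) * G x))
    (expR (- x) * (1 - cos (xi * x))).
  have dG : is_derive x 1 G ((xi * (xi * cos (xi * x)) + xi * sin (xi * x)) / (1 + xi ^+ 2)).
    have dc := is_derive_cosZ xi x; have ds := is_derive_sinZ xi x.
    have -> : G = cst 1 + (1 + xi ^+ 2)^-1 *:
        (xi *: (fun u => sin (xi * u)) - (fun u => cos (xi * u))).
      by apply/funext => u; rewrite /G /GRing.scale /= mulrC.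
    have d1 := is_deriveB (is_deriveZ xi ds) dc.
    have d2 := is_deriveD (is_derive_cst (1 : R) x 1) (is_deriveZ (1 + xi ^+ 2)^-1 d1).
    apply: (is_derive_eq d2); rewrite add0r [LHS]mulrC.
    by rewrite mulNr opprK.
  have de := is_derive_expRN x.
  have -> : (fun x => - (expR (- x) * G x)) = - ((fun x => expR (- x)) * G) by [].
  apply: is_derive_eq; rewrite /GRing.scale /= /G.
  by field.
have cf : continuous (fun x => expR (- x) * (1 - cos (xi * x))).
  move=> x; apply: cvgM; first exact: continuous_expRN.
  apply: cvgB; first exact: cvg_cst.
  apply: differentiable_continuous; apply/derivable1_diffP.
  by have [] := is_derive_cosZ xi x.
have F0 : - (expR (- x) * G x) @[x --> +oo%R] --> (0 : R).
  rewrite -oppr0; apply: cvgN.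
  pose K := 1 + (`|xi| + 1) / (1 + xi ^+ 2).
  have GK u : `|G u| <= K.
    apply: le_trans (ler_normD _ _) _; rewrite normr1 lerD2l normrM.
    rewrite [X in _ * X]ger0_norm ?invr_ge0 ?addr_ge0 ?sqr_ge0//.
    rewrite ler_wpM2r ?invr_ge0 ?addr_ge0 ?sqr_ge0//.
    apply: le_trans (ler_normB _ _) _; rewrite normrM; apply: lerD.
      by rewrite ler_piMr// sin_max.
    exact: cos_max.
  apply: norm_cvg0.
  have sq : \forall u \near +oo%R, 0 <= `|expR (- u) * G u| <= expR (- u) * K.
    apply: nearW => u; rewrite normr_ge0 normrM ger0_norm ?expR_ge0//.
    by rewrite ler_wpM2l ?expR_ge0.
  apply: (squeeze_cvgr sq (cvg_cst 0)).
  by rewrite -[X in _ --> X](mul0r K); apply: cvgMl; exact: cvgr_expR.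
rewrite (integral_even_FTC dF cf _ F0).
  rewrite oppr0 expR0 mul1r /G mulr0 sin0 cos0 mulr0 !sub0r opprK.
  by congr EFin; rewrite mulN1r.
by move=> x; rewrite mulr_ge0 ?expR_ge0// subr_ge0 cos_le1.
Qed.

(** The reflection of [x] conjugates the integral, so its imaginary part vanishes; the real part is
    the integral of [exp (- |x|)] minus that of [exp (- |x|) (1 - cos)]. *)
Lemma cint_expRN (xi : R) :
  cintble leb (fun x : measurableTypeR R => expi (- (x * xi)) * (expR (- `|x|))%:C) /\
  cint leb (fun x : measurableTypeR R => expi (- (x * xi)) * (expR (- `|x|))%:C) =
  (2 * (1 + xi ^+ 2)^-1)%:C.
Proof.
set f := (fun x : measurableTypeR R => _).
have mx : measurable_fun setT (fun x : measurableTypeR R => - (x * xi)).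
  by apply: measurable_funN; exact: mulrr_measurable.
have itf : cintble leb f.
  apply: le_cintble integrable_expRN _.
    by apply: cmeasM; [exact: cmeas_expi|apply: cmeas_real; exact: measurable_expRN].
  by move=> x; rewrite Normc.normcM normc_expi mul1r normc_real ger0_norm ?expR_ge0.
split=> //.
have fJ : cint leb f = (cint leb f)^*.
  rewrite -cintJ// -[LHS]mul1r -(scaling_cint (@scaling_opp1 R) itf).2.
  apply: eq_cint => x; rewrite /f mulNr opprK normrN.
  by apply: complex_eq; rewrite !cReE /= cosN sinN; ring.
apply: complex_eq => /=; last first.
  by have := congr1 (@complex.Im R) fJ; rewrite ImJ => h; have : cIm (cint leb f) = 0 by lra.
have i1 := integrable_expRN.
have i2 : leb.-integrable setT (fun x => (expR (- `|x|) * (1 - cos (xi * `|x|)))%:E).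
  apply/integrableP; split.
    apply/measurable_EFinP; apply: measurable_funM; first exact: measurable_expRN.
    apply: measurable_funB; first exact: measurable_cst.
    apply: continuous_measurable_fun.
    apply: (@continuous_comp_norm (fun x => cos (xi * x))) => x.
    apply: differentiable_continuous; apply/derivable1_diffP.
    by have [] := is_derive_cosZ xi x.
  rewrite (_ : (\int[_]_x _ = \int[leb]_x (expR (- `|x|) * (1 - cos (xi * `|x|)))%:E)%E).
    by rewrite integral_expRN_1Bcos ltry.
  apply: eq_integral => x _; rewrite gee0_abs// lee_fin.
transitivity (\int[leb]_x (expR (- `|x|) - expR (- `|x|) * (1 - cos (xi * `|x|)))).
  apply: eq_Rintegral => x _; rewrite mulr0 subr0 cosN.
  rewrite -(cos_norm (x * xi)) normrM -(cos_norm (xi * _)) normrM normr_id.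
  by rewrite mulrC (mulrC `|xi|); ring.
rewrite RintegralB// /Rintegral integral_expRN integral_expRN_1Bcos /=; ring.
Qed.

Lemma integral_oneDsqrV : (\int[leb]_x (2 * (1 + x ^+ 2)^-1)%:E = (2 * pi)%:E)%E.
Proof.
have cont : continuous (fun x : R => (1 + x ^+ 2)^-1) := @continuous_oneDsqrV R.
have H := integral_even_FTC (@is_derive1_atan R) cont _ (@cvgy_atan R).
rewrite atan0 subr0 in H.
under eq_integral do rewrite EFinM.
rewrite ge0_integralZl//=.
- under eq_integral => x _ do rewrite -(real_normK (num_real x)).
  by rewrite H//; congr EFin; field.
- by apply/measurable_EFinP; exact: continuous_measurable_fun.
- by move=> x _; rewrite lee_fin invr_ge0 addr_ge0// sqr_ge0.
Qed.

Lemma integrable_oneDsqrV : leb.-integrable setT (fun x => (2 * (1 + x ^+ 2)^-1)%:E).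
Proof.
apply/integrableP; split.
  apply/measurable_EFinP; apply: measurable_funM; first exact: measurable_cst.
  by apply: continuous_measurable_fun; exact: continuous_oneDsqrV.
rewrite (_ : (\int[_]_x _ = \int[leb]_x (2 * (1 + x ^+ 2)^-1)%:E)%E); last first.
  apply: eq_integral => x _; rewrite gee0_abs// lee_fin mulr_ge0// invr_ge0 addr_ge0//.
  exact: sqr_ge0.
by rewrite integral_oneDsqrV ltry.
Qed.

End Laplace.

(** * The Abel weight, the Poisson kernel and the multiplication formula *)

Section Kernel.
Context {R : realType}.
Local Notation C := R[i].
Local Notation leb := (@lebesgue_measure R).
Local Notation T1 := (measurableTypeR R).
Local Notation T3 := (T1 * T1 * T1)%type.
Implicit Types (x y xi : R3 R) (f g k w : R3 R -> C) (e : R).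

Lemma cint_prod d1 d2 (U1 : measurableType d1) (U2 : measurableType d2)
    (m1 : {sigma_finite_measure set U1 -> \bar R})
    (m2 : {sigma_finite_measure set U2 -> \bar R}) (u : U1 -> C) (v : U2 -> C) :
  cintble m1 u -> cintble m2 v ->
  cintble (m1 \x m2)%E (fun z => u z.1 * v z.2) /\
  cint (m1 \x m2)%E (fun z => u z.1 * v z.2) = cint m1 u * cint m2 v.
Proof.
move=> iu iv.
have iuv : cintble (m1 \x m2)%E (fun z => u z.1 * v z.2).
  apply: (le_cintble_prod _ (cintble_normc iu) (cintble_normc iv)); last first.
    by move=> s t /=; rewrite Normc.normcM.
  apply: cmeasM.
    have [mr mi] := cintble_meas iu.
    by split; [exact: measurableT_comp mr measurable_fst|exact: measurableT_comp mi measurable_fst].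
  have [mr mi] := cintble_meas iv.
  by split; [exact: measurableT_comp mr measurable_snd|exact: measurableT_comp mi measurable_snd].
split => //.
transitivity (cint m1 (fun s => cint m2 (fun t => u s * v t))).
  have [ir ii] := iuv.
  by rewrite /cint (Rfubini1 ir).2 (Rfubini1 ii).2.
rewrite (eq_cint m1 (g := fun s => cint m2 v * u s)).
  by rewrite cintZ// mulrC.
by move=> s; rewrite cintZ// mulrC.
Qed.

Definition abel (e : R) x : R := expR (- (e * norm1 x)).

Definition poisson1 x : R :=
  2 * (1 + x.1.1 ^+ 2)^-1 * (2 * (1 + x.1.2 ^+ 2)^-1) * (2 * (1 + x.2 ^+ 2)^-1).

(** Its mass is [(2 pi)^3] for every [e > 0] and concentrates at the origin as [e] tends to 0: up to
    that factor, an approximate identity. *)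
Definition poisson (e : R) x : R := e ^- 3 * poisson1 (e^-1 *: x).

Lemma abel_ge0 e x : 0 <= abel e x. Proof. exact: expR_ge0. Qed.

Lemma abel_gt0 e x : 0 < abel e x. Proof. exact: expR_gt0. Qed.

Lemma abel_le1 e x : 0 <= e -> abel e x <= 1.
Proof. by move=> e0; rewrite -expR0 ler_expR oppr_le0 mulr_ge0// norm1_ge0. Qed.

Lemma poisson1_ge0 x : 0 <= poisson1 x.
Proof.
by rewrite /poisson1 !mulr_ge0// ?invr_ge0 ?addr_ge0// ?sqr_ge0.
Qed.

Lemma poisson_ge0 e x : 0 <= e -> 0 <= poisson e x.
Proof. by move=> e0; rewrite mulr_ge0 ?poisson1_ge0// invr_ge0 exprn_ge0. Qed.

Lemma poissonN e x : poisson e (- x) = poisson e x.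
Proof. by rewrite /poisson /poisson1 scalerN /= !sqrrN. Qed.

Lemma integrable_poisson1 :
  (@leb3 R).-integrable setT (fun x => (poisson1 x)%:E) /\
  \int[@leb3 R]_x poisson1 x = (2 * pi) ^+ 3.
Proof.
have i1 := cintble_real (@integrable_oneDsqrV R).
have i2 := @cint_prod _ _ _ _ leb leb _ _ i1 i1.
have i3 := @cint_prod _ _ _ _ leb2s leb _ _ i2.1 i1.
have I : cint leb (fun x : T1 => (2 * (1 + x ^+ 2)^-1)%:C) = (2 * pi)%:C.
  by rewrite cint_real /Rintegral integral_oneDsqrV.
have E (x : T3) : (2 * (1 + x.1.1 ^+ 2)^-1)%:C * (2 * (1 + x.1.2 ^+ 2)^-1)%:C
    * (2 * (1 + x.2 ^+ 2)^-1)%:C = (poisson1 x)%:C :> C.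
  by rewrite -!rmorphM.
have [[j1 _] j3] : cintble (@leb3 R) (fun x => (poisson1 x)%:C) /\
    cint (@leb3 R) (fun x => (poisson1 x)%:C) = ((2 * pi) ^+ 3)%:C.
  have [a b] := i3.
  split; first by under eq_fun do rewrite -E; exact: a.
  under eq_cint do rewrite -E.
  etransitivity; first exact: b.
  transitivity (((2 * pi)%:C * (2 * pi)%:C) * (2 * pi)%:C : C).
    by rewrite I; congr (_ * _); rewrite -I; exact: i2.2.
  by rewrite -!rmorphM /= exprS expr2 mulrA.
split=> //; move: j3; rewrite cint_real => /complexI.
by [].
Qed.

Lemma cint_abel1 xi :
  cintble (@leb3 R) (fun x => expi (- dot x xi) * (abel 1 x)%:C) /\
  cint (@leb3 R) (fun x => expi (- dot x xi) * (abel 1 x)%:C) = (poisson1 xi)%:C.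
Proof.
have [a1 b1] := cint_expRN xi.1.1; have [a2 b2] := cint_expRN xi.1.2.
have [a3 b3] := cint_expRN xi.2.
have i2 := @cint_prod _ _ _ _ leb leb _ _ a1 a2.
have [a b] := @cint_prod _ _ _ _ leb2s leb _ _ i2.1 a3.
have E (x : T3) : expi (- (x.1.1 * xi.1.1)) * (expR (- `|x.1.1|))%:C *
    (expi (- (x.1.2 * xi.1.2)) * (expR (- `|x.1.2|))%:C) *
    (expi (- (x.2 * xi.2)) * (expR (- `|x.2|))%:C) =
    expi (- dot x xi) * (abel 1 x)%:C :> C.
  rewrite /abel /dot /norm1 mul1r !opprD !expRD !expiD !rmorphM; ring.
split; first by under eq_fun do rewrite -E; exact: a.
under eq_cint do rewrite -E.
etransitivity; first exact: b.
rewrite b3 /poisson1 !rmorphM; congr (_ * _).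
by etransitivity; first exact: i2.2; rewrite b1 b2 !rmorphM.
Qed.

Lemma integrable_poisson e : 0 < e ->
  (@leb3 R).-integrable setT (fun x => (poisson e x)%:E) /\
  \int[@leb3 R]_x poisson e x = (2 * pi) ^+ 3.
Proof.
move=> e0; have [i1 I1] := integrable_poisson1.
have e0' : 0 < e^-1 by rewrite invr_gt0.
have := scaling_integrable (scaling_affine 0 e0') i1.
under eq_fun do rewrite addr0.
under [X in _ /\ X = _ -> _]eq_Rintegral do rewrite addr0.
move=> [i2 I2]; split.
  by under eq_fun do rewrite EFinM; exact: integrableZl.
rewrite RintegralZl// I2 I1 mulrA exprVn invrK mulVf ?mul1r//.
by rewrite expf_neq0// gt_eqF.
Qed.

Lemma cint_abel e xi : 0 < e ->
  cintble (@leb3 R) (fun x => expi (- dot x xi) * (abel e x)%:C) /\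
  cint (@leb3 R) (fun x => expi (- dot x xi) * (abel e x)%:C) = (poisson e xi)%:C.
Proof.
move=> e0; have [i1 I1] := cint_abel1 (e^-1 *: xi).
have [i2 I2] := scaling_cint (scaling_affine 0 e0) i1.
have E x : expi (- dot (e *: x + 0) (e^-1 *: xi)) * (abel 1 (e *: x + 0))%:C =
    expi (- dot x xi) * (abel e x)%:C :> C.
  rewrite addr0 dotZl dotZr mulrA mulfV ?gt_eqF// mul1r.
  by rewrite /abel norm1Z mul1r ger0_norm// ltW.
split; first by under eq_fun do rewrite -E; exact: i2.
under eq_cint do rewrite -E.
etransitivity; first exact: I2.
by rewrite I1 -RCM.
Qed.

Lemma measurable_abel e : measurable_fun setT (abel e : T3 -> R).
Proof.
apply: measurableT_comp; first exact: measurable_expR.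
apply: measurable_funN; apply: measurable_funM; first exact: measurable_cst.
by apply: meas_norm1; exact: measurable_id.
Qed.

Lemma integrable_abel e : 0 < e ->
  (@leb3 R).-integrable setT (fun x => (abel e x)%:E).
Proof.
move=> e0; have [i1 _] := cint_abel 0 e0.
have := cintble_normc i1.
by under eq_fun do rewrite Normc.normcM normc_expi mul1r normc_real ger0_norm ?abel_ge0//.
Qed.

Lemma cmeas_expi_dot d (U : measurableType d) (u v : U -> T3) :
  measurable_fun setT u -> measurable_fun setT v ->
  cmeas (fun t => expi (- dot (u t) (v t))).
Proof.
by move=> mu mv; apply: cmeas_expi; apply: measurable_funN; exact: meas_dot.
Qed.

(** The unnormalised transform, which keeps the power of [2 pi] out of the Fubini arguments;
    [fourierL1E] puts it back. *)
Definition FTu f xi : C := cint (@leb3 R) (fun x => expi (- dot x xi) * f x).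

Lemma fourierL1E f xi : fourierL1 f xi = ((2 * pi) `^ (- (3 / 2)))%:C * FTu f xi.
Proof. by []. Qed.

Lemma cintble_expi f (h : R3 R -> R) : cintble (@leb3 R) f ->
  measurable_fun setT (h : T3 -> R) ->
  cintble (@leb3 R) (fun x => expi (h x) * f x).
Proof.
move=> itf mh; apply: le_cintble (cintble_normc itf) _.
  by apply: cmeasM; [exact: cmeas_expi|exact: cintble_meas itf].
by move=> x; rewrite Normc.normcM normc_expi mul1r.
Qed.

Lemma cintble_FTu f xi : cintble (@leb3 R) f ->
  cintble (@leb3 R) (fun x => expi (- dot x xi) * f x).
Proof.
move=> itf; apply: cintble_expi itf _; apply: measurable_funN.
by apply: meas_dot; [exact: measurable_id|exact: measurable_cst].
Qed.

Lemma normc_FTu f xi : cintble (@leb3 R) f ->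
  nc (FTu f xi) <= \int[@leb3 R]_x nc (f x).
Proof.
move=> itf; apply: le_normc_cint_bound (cintble_normc itf) _.
  exact: cintble_FTu.
by move=> x; rewrite Normc.normcM normc_expi mul1r.
Qed.

Lemma cintble_FTu_kernel f w : cintble (@leb3 R) f -> cintble (@leb3 R) w ->
  cintble (@leb3s R \x @leb3s R)%E
    (fun z : T3 * T3 => expi (- dot z.1 z.2) * f z.1 * w z.2).
Proof.
move=> itf itw.
have nf : (@leb3s R).-integrable setT (fun x => (nc (f x))%:E) := cintble_normc itf.
have nw : (@leb3s R).-integrable setT (fun x => (nc (w x))%:E) := cintble_normc itw.
apply: (le_cintble_prod _ nf nw).
  apply: cmeasM; first apply: cmeasM.
  - by apply: cmeas_expi_dot; [exact: measurable_fst|exact: measurable_snd].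
  - by apply: cmeas_comp (cintble_meas itf) _; exact: measurable_fst.
  - by apply: cmeas_comp (cintble_meas itw) _; exact: measurable_snd.
by move=> x y /=; rewrite !Normc.normcM normc_expi mul1r.
Qed.

(** Fubini for the kernel [expi (- x . xi) f x w xi], whose modulus is [|f x| |w xi|]. *)
Lemma FTu_mult f w : cintble (@leb3 R) f -> cintble (@leb3 R) w ->
  cintble (@leb3 R) (fun xi => FTu f xi * w xi) /\
  cint (@leb3 R) (fun xi => FTu f xi * w xi) = cint (@leb3 R) (fun x => f x * FTu w x).
Proof.
move=> itf itw; have itK := cintble_FTu_kernel itf itw.
have E1 xi : cint (@leb3s R) (fun x => expi (- dot x xi) * f x * w xi) = FTu f xi * w xi.
  rewrite mulrC -cintZ; last exact: cintble_FTu.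
  by apply: eq_cint => x; rewrite mulrC.
have E2 x : cint (@leb3s R) (fun xi => expi (- dot x xi) * f x * w xi) = f x * FTu w x.
  rewrite -cintZ; last exact: cintble_FTu.
  by apply: eq_cint => xi; rewrite dotC; ring.
split.
  by have := cintble_fubini2 itK; under eq_fun do rewrite /= E1.
rewrite -(eq_cint (@leb3 R) E1) -(eq_cint (@leb3 R) E2).
exact/esym/(cint_fubini itK).
Qed.

(** Fubini yields measurability of the product of [FTu f] with the integrable weight [abel 1]; this
    weight is positive and can be divided out. *)
Lemma cmeas_FTu f : cintble (@leb3 R) f -> cmeas (FTu f : T3 -> C).
Proof.
move=> itf; have [/cintble_meas m _] := FTu_mult itf (cintble_real (integrable_abel ltr01)).
have mi : cmeas (fun x : T3 => ((abel 1 x)^-1)%:C : C).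
  apply: cmeas_real.
  rewrite (_ : (fun x => _) = (fun x => expR (1 * norm1 x))).
    apply: measurableT_comp; first exact: measurable_expR.
    apply: measurable_funM; first exact: measurable_cst.
    by apply: meas_norm1; exact: measurable_id.
  by apply/funext => x; rewrite /abel expRN invrK.
have := cmeasM m mi; rewrite (_ : (fun x => _) = FTu f)//.
apply/funext => x; rewrite -mulrA -rmorphM mulfV ?mulr1//.
by rewrite gt_eqF// abel_gt0.
Qed.

(** The multiplication formula with a modulated Abel weight, whose transform is a translated Poisson
    kernel. It serves both the contraction and the inversion. *)
Lemma FTu_abel f x e : 0 < e -> cintble (@leb3 R) f ->
  cint (@leb3 R) (fun xi => FTu f xi * (expi (- dot xi x) * (abel e xi)%:C)) =
  cint (@leb3 R) (fun y => f y * (poisson e (x + y))%:C).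
Proof.
move=> e0 itf; have [itw _] := cint_abel x e0.
rewrite (FTu_mult itf itw).2; apply: eq_cint => y; congr (_ * _).
rewrite -(cint_abel (x + y) e0).2; apply: eq_cint => xi.
by rewrite mulrA -expiD dotDr; congr (expi _ * _); ring.
Qed.

End Kernel.

(** * The Fourier transform is an L^2 contraction *)

Section Contraction.
Context {R : realType}.
Local Notation C := R[i].
Local Notation T1 := (measurableTypeR R).
Local Notation T3 := (T1 * T1 * T1)%type.
Implicit Types (x y xi : R3 R) (f g k w : R3 R -> C) (e : R).

Definition sqint f : \bar R := (\int[@leb3 R]_x (nc (f x) ^+ 2)%:E)%E.

Lemma measurable_sqnc d (U : measurableType d) (f : U -> C) : cmeas f ->
  measurable_fun setT (fun t => (nc (f t) ^+ 2)%:E).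
Proof.
by move=> mf; apply/measurable_EFinP; apply: measurable_funX; exact: measurable_normc.
Qed.

Lemma sqint_ge0 f : (0 <= sqint f)%E.
Proof. by apply: integral_ge0 => x _; rewrite lee_fin sqr_ge0. Qed.

Lemma integrable_fineE (f : T3 -> R) : (@leb3 R).-integrable setT (fun x => (f x)%:E) ->
  (\int[@leb3 R]_x f x)%:E = (\int[@leb3 R]_x (f x)%:E)%E.
Proof. by move=> itf; rewrite /Rintegral fineK//; exact: integrable_fin_num. Qed.

Lemma measurable_poisson e : 0 < e -> measurable_fun setT (poisson e : T3 -> R).
Proof. by move=> /integrable_poisson[/measurable_int/measurable_EFinP]. Qed.

Lemma poisson_le e x : 0 <= e -> poisson e x <= 8 * e ^- 3.
Proof.
move=> e0; rewrite /poisson [leRHS]mulrC.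
apply: ler_wpM2l; first by rewrite invr_ge0 exprn_ge0.
rewrite /poisson1; have h (u : R) : 0 <= 2 * (1 + u ^+ 2)^-1 <= 2.
  have u0 := sqr_ge0 u.
  by rewrite mulr_ge0 ?invr_ge0 ?addr_ge0//= ler_piMr// invf_le1 ?lerDl// ltr_wpDr.
set z := (_ *: _); have := h z.1.1; have := h z.1.2; have := h z.2.
move: (2 * _) (2 * _) (2 * _) => a b c /andP[a0 a2] /andP[b0 b2] /andP[c0 c2].
have -> : (8 : R) = 2 * 2 * 2 by ring.
by apply: ler_pM => //; [exact: mulr_ge0|exact: ler_pM].
Qed.

(** With [w = abel e * conj (FTu f)], the multiplication formula turns the left side into the
    integral of [f * FTu w], and [FTu w] is the conjugate of [f] averaged against the Poisson
    kernel. Schur's test concludes: this kernel has mass [(2 pi)^3] in each variable. *)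
Let abel_bound f e : 0 < e -> cintble (@leb3 R) f ->
  (\int[@leb3 R]_xi (abel e xi * nc (FTu f xi) ^+ 2)%:E <=
   ((2 * pi) ^+ 3)%:E * sqint f)%E.
Proof.
move=> e0 itf.
have mf := cintble_meas itf.
have mF := cmeas_FTu itf.
(* Chosen so that [FTu fb] is the conjugate of [FTu f]. *)
pose fb y := (f (- y))^*.
have itfb : cintble (@leb3 R) fb.
  exact: cintbleJ (scaling_cint (@scaling_opp R) itf).1.
have fbE xi : FTu fb xi = (FTu f xi)^*.
  rewrite /FTu -cintJ; last exact: cintble_FTu.
  have itg : cintble (@leb3 R) (fun x => (expi (- dot x xi) * f x)^*).
    by apply: cintbleJ; exact: cintble_FTu.
  rewrite -[RHS]mul1r -(scaling_cint (@scaling_opp R) itg).2.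
  apply: eq_cint => x; rewrite /fb dotNl opprK expiN.
  by rewrite -[in LHS]/(expi (dot x xi)); apply: complex_eq; rewrite !cReE /= ?cosN ?sinN; ring.
pose w xi := FTu fb xi * (abel e xi)%:C.
have itw : cintble (@leb3 R) w.
  exact: (FTu_mult itfb (cintble_real (integrable_abel e0))).1.
have E1 : cint (@leb3 R) (fun xi => FTu f xi * w xi) =
    (\int[@leb3 R]_xi (abel e xi * nc (FTu f xi) ^+ 2))%:C.
  rewrite -cint_real; apply: eq_cint => xi.
  by rewrite /w fbE mulrA mulJc_normc -RCM mulrC.
have itp x : cintble (@leb3 R) (fun y => (f y)^* * (poisson e (x - y))%:C).
  have mp : measurable_fun setT (fun y : T3 => poisson e (x - y) : R).
    apply: measurableT_comp; first exact: measurable_poisson.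
    by apply: meas3B; [exact: measurable_cst|exact: measurable_id].
  apply: (@le_cintble _ T3 R (@leb3 R) _ (fun y : T3 => 8 * e ^- 3 * nc (f y))).
  - by apply: cmeasM; [exact: cmeasJ|exact: cmeas_real].
  - by under eq_fun do rewrite EFinM; apply: integrableZl => //; exact: cintble_normc.
  - move=> y; rewrite Normc.normcM normcJ normc_real mulrC ler_wpM2r ?normc_ge0//.
    by rewrite ger0_norm; [exact: poisson_le (ltW e0)|exact: poisson_ge0 (ltW e0)].
have E2 x : FTu w x = cint (@leb3 R) (fun y => (f y)^* * (poisson e (x - y))%:C).
  rewrite /FTu (_ : (fun _ => _) =
      (fun xi => FTu fb xi * (expi (- dot xi x) * (abel e xi)%:C))); last first.
    by apply/funext => xi; rewrite /w mulrCA.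
  rewrite FTu_abel//.
  have := (scaling_cint (@scaling_opp R) (itp x)).2; rewrite mul1r => <-.
  by apply: eq_cint => y; rewrite /fb opprK.
have itFw : cintble (@leb3 R) (fun xi => FTu f xi * w xi) := (FTu_mult itf itw).1.
have itfw : cintble (@leb3 R) (fun x => f x * FTu w x).
  by have := (FTu_mult itw itf).1; under eq_fun do rewrite mulrC.
have itL : (@leb3 R).-integrable setT (fun xi => (abel e xi * nc (FTu f xi) ^+ 2)%:E).
  have := itFw.1; apply: eq_integrable => // xi _.
  by rewrite /w fbE mulrA mulJc_normc -RCM mulrC.
rewrite -integrable_fineE//.
have le1 : \int[@leb3 R]_xi (abel e xi * nc (FTu f xi) ^+ 2) <=
    \int[@leb3 R]_x nc (f x * FTu w x).
  apply: le_trans (le_normc_cint itfw).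
  rewrite -(FTu_mult itf itw).2 E1 normc_real; exact: ler_norm.
apply: le_trans (_ : (\int[@leb3 R]_x nc (f x * FTu w x))%:E <= _)%E; first by rewrite lee_fin.
rewrite integrable_fineE; last exact: cintble_normc.
have mK : measurable_fun setT (fun z : T3 * T3 => poisson e (z.1 - z.2) : R).
  apply: measurableT_comp; first exact: measurable_poisson.
  by apply: meas3B; [exact: measurable_fst|exact: measurable_snd].
have mp x : measurable_fun setT (fun y : T3 => poisson e (x - y) : R).
  by have := measurableT_comp mK (@pair1_measurable _ _ T3 T3 x).
have mp' y : measurable_fun setT (fun x : T3 => poisson e (x - y) : R).
  by have := measurableT_comp mK (@pair2_measurable _ _ T3 T3 y).
have mn := measurable_normc mf.
have mn2 := measurable_sqnc mf.
have Ip x : (\int[@leb3 R]_y (poisson e (x - y))%:E = ((2 * pi) ^+ 3)%:E)%E.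
  have [ip Ip] := integrable_poisson e0.
  have [ip2 Ip2] := scaling_integrable (scaling_refl x) ip.
  by rewrite -integrable_fineE// Ip2 Ip mul1r.
have Ip' y : (\int[@leb3 R]_x (poisson e (x - y))%:E = ((2 * pi) ^+ 3)%:E)%E.
  by rewrite -(Ip y); apply: eq_integral => x _; rewrite -poissonN opprB.
have p0 z : 0 <= poisson e z by rewrite poisson_ge0// ltW.
(* [K] and [K'] are the two halves of [|f x| |f y| p <= (|f x|^2 + |f y|^2) p / 2]. They are
   integrated in [\bar R] because [sqint f] may be infinite, [f] being only integrable. *)
pose K (z : T3 * T3) : \bar R := (2^-1 * (nc (f z.1) ^+ 2 * poisson e (z.1 - z.2)))%:E.
pose K' (z : T3 * T3) : \bar R := (2^-1 * (nc (f z.2) ^+ 2 * poisson e (z.1 - z.2)))%:E.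
have mKK (h : T3 * T3 -> T3) : measurable_fun setT h ->
    measurable_fun setT (fun z => (2^-1 * (nc (f (h z)) ^+ 2 * poisson e (z.1 - z.2)))%:E).
  move=> mh; apply/measurable_EFinP; apply: measurable_funM; first exact: measurable_cst.
  apply: measurable_funM mK; apply: measurable_funX.
  by apply: (measurableT_comp mn).
have mK1 : measurable_fun setT K by exact: (mKK fst measurable_fst).
have mK2 : measurable_fun setT K' by exact: (mKK snd measurable_snd).
have K0 z : (0 <= K z)%E.
  by rewrite lee_fin; apply: mulr_ge0 => //; apply: mulr_ge0 => //; exact: sqr_ge0.
have K'0 z : (0 <= K' z)%E.
  by rewrite lee_fin; apply: mulr_ge0 => //; apply: mulr_ge0 => //; exact: sqr_ge0.
have IZ (h : T3 -> R) b : 0 <= b -> measurable_fun setT h -> (forall x, 0 <= h x) ->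
    (\int[@leb3 R]_x (h x)%:E = ((2 * pi) ^+ 3)%:E)%E ->
    (\int[@leb3 R]_x (2^-1 * (b * h x))%:E = (2^-1 * (2 * pi) ^+ 3)%:E * b%:E)%E.
  move=> b0 mh h0 Ih; under eq_integral do rewrite mulrA EFinM.
  rewrite ge0_integralZl//.
  - by rewrite Ih -!EFinM; congr EFin; ring.
  - exact/measurable_EFinP.
  - by move=> y _; rewrite lee_fin.
  - by rewrite lee_fin mulr_ge0.
have IO : (\int[@leb3 R]_x ((2^-1 * (2 * pi) ^+ 3)%:E * (nc (f x) ^+ 2)%:E) =
    2^-1%:E * (((2 * pi) ^+ 3)%:E * sqint f))%E.
  rewrite ge0_integralZl//.
  - by rewrite EFinM muleA.
  - by move=> x _; rewrite lee_fin sqr_ge0.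
  - by rewrite lee_fin mulr_ge0// exprn_ge0// mulr_ge0// pi_ge0.
have IK : (\int[@leb3 R]_x \int[@leb3 R]_y K (x, y) =
    2^-1%:E * (((2 * pi) ^+ 3)%:E * sqint f))%E.
  rewrite -IO; apply: eq_integral => x _.
  have e1 := IZ _ _ (sqr_ge0 (nc (f x))) (mp x) (fun y => p0 (x - y)) (Ip x).
  exact: e1.
have IK' : (\int[@leb3 R]_x \int[@leb3 R]_y K' (x, y) =
    2^-1%:E * (((2 * pi) ^+ 3)%:E * sqint f))%E.
  have FT : (\int[@leb3s R]_x \int[@leb3s R]_y K' (x, y) =
      \int[@leb3s R]_y \int[@leb3s R]_x K' (x, y))%E := fubini_tonelli K' mK2 K'0.
  have {}FT : (\int[@leb3 R]_x \int[@leb3 R]_y K' (x, y) =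
      \int[@leb3 R]_y \int[@leb3 R]_x K' (x, y))%E := FT.
  rewrite FT -IO; apply: eq_integral => y _.
  have e1 := IZ _ _ (sqr_ge0 (nc (f y))) (mp' y) (fun x => p0 (x - y)) (Ip' y).
  exact: e1.
have -> : (((2 * pi) ^+ 3)%:E * sqint f =
    \int[@leb3 R]_x \int[@leb3 R]_y K (x, y) + \int[@leb3 R]_x \int[@leb3 R]_y K' (x, y))%E.
  rewrite IK IK' -ge0_muleDl ?lee_fin// -EFinD.
  by rewrite (_ : 2^-1 + 2^-1 = 1 :> R) ?mul1e//; field.
have mI1 : measurable_fun setT (fun x => \int[@leb3 R]_y K (x, y))%E.
  exact: (measurable_fun_fubini_tonelli_F (m2 := @leb3s R)).
have mI2 : measurable_fun setT (fun x => \int[@leb3 R]_y K' (x, y))%E.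
  exact: (measurable_fun_fubini_tonelli_F (m2 := @leb3s R)).
rewrite -ge0_integralD//; try by move=> x _; exact: integral_ge0.
apply: ge0_le_integral => //.
- by move=> x _; rewrite lee_fin normc_ge0.
- by apply/measurable_EFinP; apply: measurable_normc; exact: cintble_meas itfw.
- exact: emeasurable_funD.
move=> x _.
have mKx : measurable_fun setT (fun y => K (x, y)).
  exact: measurableT_comp mK1 (@pair1_measurable _ _ T3 T3 x).
have mKx' : measurable_fun setT (fun y => K' (x, y)).
  exact: measurableT_comp mK2 (@pair1_measurable _ _ T3 T3 x).
rewrite -ge0_integralD//.
have itx : (@leb3 R).-integrable setT (fun y => (nc (f x) * (nc (f y) * poisson e (x - y)))%:E).
  have := cintble_normc (itp x).
  under eq_fun do rewrite Normc.normcM normcJ normc_real ger0_norm//.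
  by under [in X in _ -> X]eq_fun do rewrite EFinM; exact: integrableZl.
apply: (@le_trans _ _ (\int[@leb3 R]_y (nc (f x) * (nc (f y) * poisson e (x - y)))%:E)%E).
  rewrite -integrable_fineE// lee_fin Normc.normcM E2.
  have := cintble_normc (itp x).
  under eq_fun do rewrite Normc.normcM normcJ normc_real ger0_norm//.
  move=> itn; rewrite RintegralZl// ler_wpM2l ?normc_ge0//.
  apply: le_normc_cint_bound => // y.
  by rewrite Normc.normcM normcJ normc_real ger0_norm.
apply: ge0_le_integral => //.
- move=> y _; rewrite lee_fin; apply: mulr_ge0; first exact: normc_ge0.
  by apply: mulr_ge0; [exact: normc_ge0|exact: p0].
- exact: measurable_int itx.
- exact: emeasurable_funD.
move=> y _; rewrite /K /K' /= -EFinD lee_fin.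
move: (poisson e (x - y)) (p0 (x - y)) (nc (f x)) (nc (f y)) => p pp a b.
have := mulr_ge0 pp (sqr_ge0 (a - b)); rewrite !expr2; nra.
Qed.

(** The weights [abel (1 / (n + 1))] increase to 1 and the bound of [abel_bound] does not depend on
    the weight, so monotone convergence removes it. *)
Lemma sqint_FTu f : cintble (@leb3 R) f ->
  (sqint (FTu f) <= ((2 * pi) ^+ 3)%:E * sqint f)%E.
Proof.
move=> itf; have mF := cmeas_FTu itf.
pose e n : R := n.+1%:R^-1.
have e0 n : 0 < e n by rewrite invr_gt0.
pose h n (xi : T3) := (abel (e n) xi * nc (FTu f xi) ^+ 2)%:E.
have mh n : measurable_fun setT (h n).
  apply/measurable_EFinP; apply: measurable_funM; first exact: measurable_abel.
  by apply: measurable_funX; exact: measurable_normc.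
have h0 n xi : (0 <= h n xi)%E.
  by rewrite lee_fin; apply: mulr_ge0; [exact: abel_ge0|exact: sqr_ge0].
have ndh xi : {homo h ^~ xi : n m / (n <= m)%N >-> (n <= m)%E}.
  move=> n m nm; rewrite lee_fin ler_wpM2r ?sqr_ge0// ler_expR lerN2.
  by rewrite ler_wpM2r ?norm1_ge0// lef_pV2 ?posrE// ler_nat.
have hcvg xi : h n xi @[n --> \oo] --> (nc (FTu f xi) ^+ 2)%:E.
  apply: cvg_EFin; first exact: nearW.
  rewrite -[X in _ --> X]mul1r; apply: cvgMl.
  have e_cvg : - (e n * norm1 xi) @[n --> \oo] --> (0 : R).
    rewrite -oppr0; apply: cvgN; rewrite -(mul0r (norm1 xi)); apply: cvgMl.
    exact: cvg_harmonic.
  have := @continuous_cvg _ _ _ _ _ _ expR _ (@continuous_expR R 0) e_cvg.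
  by rewrite expR0; apply.
have cvgI := cvg_monotone_convergence (mu := @leb3 R) measurableT mh
  (fun n x _ => h0 n x) (fun x _ => @ndh x).
have limE : (\int[@leb3 R]_xi limn (h ^~ xi) = sqint (FTu f))%E.
  by apply: eq_integral => xi _; apply/cvg_lim => //; exact: hcvg.
rewrite limE in cvgI; rewrite -(cvg_lim _ cvgI)//.
apply: lime_le; first by apply/cvg_ex; exists (sqint (FTu f)).
by apply: nearW => n; exact: abel_bound.
Qed.

Lemma c0_gt0 : 0 < (2 * pi) `^ (- (3 / 2)) :> R.
Proof. by rewrite powR_gt0// mulr_gt0// pi_gt0. Qed.

Lemma c0_sqr : ((2 * pi) `^ (- (3 / 2))) ^+ 2 * (2 * pi) ^+ 3 = 1 :> R.
Proof.
have p0 : 0 < 2 * pi :> R by rewrite mulr_gt0// pi_gt0.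
rewrite -powR_mulrn ?powR_ge0// -powRrM -(powR_mulrn 3 (ltW p0)) -powRD.
  by rewrite (_ : - (3 / 2) * 2%:R + 3%:R = 0) ?powRr0//; field.
by rewrite (gt_eqF p0) implybT.
Qed.

Lemma sqintZ c f : cmeas (f : T3 -> C) ->
  sqint (fun x => c%:C * f x) = ((c ^+ 2)%:E * sqint f)%E.
Proof.
move=> mf; rewrite /sqint -ge0_integralZl//.
- apply: eq_integral => x _; rewrite Normc.normcM normc_real exprMn -EFinM.
  by rewrite real_normK// num_real.
- exact: measurable_sqnc.
- by move=> x _; rewrite lee_fin sqr_ge0.
- by rewrite lee_fin sqr_ge0.
Qed.

Lemma cmeas_fourierL1 f : cintble (@leb3 R) f -> cmeas (fourierL1 f : T3 -> C).
Proof.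
by move=> itf; apply: cmeasM; [exact: cmeas_cst|exact: cmeas_FTu].
Qed.

Lemma sqint_fourierL1 f : cintble (@leb3 R) f -> (sqint (fourierL1 f) <= sqint f)%E.
Proof.
move=> itf; rewrite (_ : fourierL1 f =
  (fun x => ((2 * pi) `^ (- (3 / 2)))%:C * FTu f x))// sqintZ; last exact: cmeas_FTu.
apply: le_trans (_ : (_ * (((2 * pi) ^+ 3)%:E * sqint f) <= _)%E).
  by apply: lee_pmul => //; [rewrite lee_fin sqr_ge0|exact: sqint_ge0|exact: sqint_FTu].
by rewrite muleA -EFinM c0_sqr mul1e.
Qed.

End Contraction.

Local Arguments L2norm {R} f%_R.

Lemma ae_imp d (T : measurableType d) (R : realType)
    (mu : {measure set T -> \bar R}) (P Q : T -> Prop) :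
  (forall t, P t -> Q t) -> {ae mu, forall t, P t} -> {ae mu, forall t, Q t}.
Proof. by move=> PQ; apply: filterS. Qed.

(** * The L^2 norm, uniqueness of the L^2 transform and evaluation of the Sobolev norm *)

Section L2.
Context {R : realType}.
Local Notation C := R[i].
Local Notation T1 := (measurableTypeR R).
Local Notation T3 := (T1 * T1 * T1)%type.
Implicit Types (x y xi : R3 R) (f g k w : R3 R -> C) (e : R).

Lemma L2normE f : L2norm f = ((sqint f) `^ 2^-1)%E.
Proof.
rewrite /L2norm unlock; congr (_ `^ _)%E; apply: eq_integral => x _.
by rewrite /= ger0_norm ?normc_ge0// -powR_mulrn ?normc_ge0.
Qed.

Lemma L2norm_ge0 f : (0 <= L2norm f)%E. Proof. exact: Lnorm_ge0. Qed.

Lemma le_L2norm f g : cmeas (f : T3 -> C) -> cmeas (g : T3 -> C) ->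
  (forall x, nc (f x) <= nc (g x)) -> (L2norm f <= L2norm g)%E.
Proof.
move=> mf mg fg; rewrite !L2normE; apply: gt0_ler_poweR; rewrite ?in_itv/= ?leey ?sqint_ge0//.
apply: ge0_le_integral => //.
- by move=> x _; rewrite lee_fin sqr_ge0.
- exact: measurable_sqnc.
- exact: measurable_sqnc.
- by move=> x _; rewrite lee_fin ler_sqr ?nnegrE ?normc_ge0.
Qed.

Lemma L2norm_sqint_le f g : (sqint f <= sqint g)%E -> (L2norm f <= L2norm g)%E.
Proof.
move=> fg; rewrite !L2normE; apply: gt0_ler_poweR => //;
  by rewrite ?in_itv/= ?leey ?sqint_ge0.
Qed.

Lemma L2norm_lty f : (sqint f < +oo)%E -> (L2norm f < +oo)%E.
Proof. by move=> h; rewrite L2normE; apply: poweR_lty. Qed.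

Lemma inL2_sqint f : cmeas (f : T3 -> C) -> (sqint f < +oo)%E -> inL2 f.
Proof. by move=> mf sf; split => //; exact: L2norm_lty. Qed.

Lemma L2normD f g : cmeas (f : T3 -> C) -> cmeas (g : T3 -> C) ->
  (L2norm (f \+ g) <= L2norm f + L2norm g)%E.
Proof.
move=> mf mg.
have := @minkowski_EFin _ _ _ (@leb3 R) (fun x => nc (f x)) (fun x => nc (g x)) 2
  (measurable_normc mf) (measurable_normc mg) (ler1n _ 2).
apply: le_trans; rewrite /L2norm.
have h : L2norm (fun x => (nc (f x) + nc (g x))%:C) =
    (Lnorm (@leb3 R) 2%:E (EFin \o ((fun x => nc (f x)) \+ (fun x => nc (g x)))%R)).
  apply: eq_Lnorm => x.
  by rewrite normc_real ger0_norm// addr_ge0// normc_ge0.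
rewrite -[leRHS]h; apply: le_L2norm; first exact: cmeasD.
  by apply: cmeas_real; apply: measurable_funD; exact: measurable_normc.
move=> x; rewrite normc_real ger0_norm ?addr_ge0 ?normc_ge0//.
exact: le_normcD.
Qed.

Lemma L2normB_sym f g : L2norm (f \- g) = L2norm (g \- f).
Proof. by rewrite !L2normE; congr (_ `^ _)%E; apply: eq_integral => x _; rewrite normcB. Qed.

Lemma L2norm_triB f g k : cmeas (f : T3 -> C) -> cmeas (g : T3 -> C) ->
  cmeas (k : T3 -> C) -> (L2norm (f \- g) <= L2norm (f \- k) + L2norm (k \- g))%E.
Proof.
move=> mf mg mk; have := @L2normD (f \- k) (k \- g) (cmeasB mf mk) (cmeasB mk mg).
apply: le_trans; rewrite (_ : (_ \+ _) = f \- g)//.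
by apply/funext => x /=; rewrite addrA subrK.
Qed.

Lemma L2norm_cvg0 (fn : nat -> R3 R -> C) : sqint (fn n) @[n --> \oo] --> 0%E ->
  L2norm (fn n) @[n --> \oo] --> 0%E.
Proof.
move=> h; have h1 : (fine (sqint (fn n))) @[n --> \oo] --> (0 : R) by exact: (fine_cvg h).
have fin : \forall n \near \oo, sqint (fn n) \is a fin_num.
  by have [] := (fine_cvgP _ _).1 h.
have cs : Num.sqrt (fine (sqint (fn n))) @[n --> \oo] --> (0 : R).
  have := @continuous_cvg _ _ _ _ _ _ Num.sqrt _ (@sqrt_continuous R 0) h1.
  by rewrite sqrtr0; apply.
have E : \forall n \near \oo, (Num.sqrt (fine (sqint (fn n))))%:E = L2norm (fn n).
  near=> n; rewrite L2normE.
  have nf : sqint (fn n) \is a fin_num by near: n.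
  rewrite -{2}(fineK nf) poweR_EFin; congr EFin.
  by rewrite powR12_sqrt// fine_ge0// sqint_ge0.
apply/fine_cvgP; split.
  by near=> n; rewrite -(near E n).
apply: cvg_trans cs; apply: near_eq_cvg; near=> n.
by rewrite /= -(near E n).
Unshelve. all: by end_near. Qed.

Lemma sqint_bound f (B r : R) : cmeas (f : T3 -> C) -> 0 <= r ->
  (forall x, nc (f x) <= B * \1_(box r) x) ->
  (sqint f <= (B ^+ 2 * (2 * r) ^+ 3)%:E)%E.
Proof.
move=> mf r0 fB.
have B0 : 0 <= B.
  have := fB 0; rewrite indicE mem_set/= ?mulr1; first exact: le_trans (normc_ge0 _).
  by split; rewrite /= normr0.
have mI : measurable_fun setT (fun x : T3 => (\1_(box r) x : R)%:E).
  by apply/measurable_EFinP; exact: measurable_indic (measurable_box r).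
have -> : ((B ^+ 2 * (2 * r) ^+ 3)%:E =
    \int[@leb3 R]_x ((B ^+ 2)%:E * (\1_(box r) x)%:E))%E.
  rewrite ge0_integralZl// ?lee_fin ?sqr_ge0// integral_indic ?setIT//.
    by rewrite leb3_box.
  exact: measurable_box.
apply: ge0_le_integral => //.
- by move=> x _; rewrite lee_fin sqr_ge0.
- exact: measurable_sqnc.
- apply/measurable_EFinP; apply: measurable_funM; first exact: measurable_cst.
  exact: measurable_indic (measurable_box r).
- move=> x _; rewrite -EFinM lee_fin; apply: le_trans (_ : (B * \1_(box r) x) ^+ 2 <= _).
    by rewrite ler_sqr ?nnegrE ?normc_ge0 ?mulr_ge0.
  by rewrite exprMn indicE; case: (_ \in _); rewrite ?expr1n ?expr0n ?mulr1 ?mulr0.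
Qed.

Lemma sqint0_ae f : cmeas (f : T3 -> C) -> L2norm f = 0%E ->
  {ae (@leb3 R), forall x, f x = 0}.
Proof.
move=> mf /Lnorm_eq0_eq0 H.
have : (fun x => (nc (f x))%:E) = \0%E %[ae (@leb3 R)].
  by apply: H => //; apply/measurable_EFinP; exact: measurable_normc.
by apply: ae_imp => x /(_ I) [h]; exact: normc_eq0.
Qed.

Lemma L2norm_ae_mul (m : R3 R -> R) f g : measurable_fun setT (m : T3 -> R) ->
  cmeas (f : T3 -> C) -> cmeas (g : T3 -> C) -> L2norm (f \- g) = 0%E ->
  L2norm (fun x => (m x)%:C * f x) = L2norm (fun x => (m x)%:C * g x).
Proof.
move=> mm mf mg h; have ae := sqint0_ae (cmeasB mf mg) h.
rewrite !L2normE; congr (_ `^ _)%E; apply: ge0_ae_eq_integral => //.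
- by apply: measurable_sqnc; apply: cmeasM => //; exact: cmeas_real.
- by apply: measurable_sqnc; apply: cmeasM => //; exact: cmeas_real.
- by move=> x _; rewrite lee_fin sqr_ge0.
- by move=> x _; rewrite lee_fin sqr_ge0.
- by move: ae; apply: ae_imp => x /= /eqP; rewrite subr_eq0 => /eqP ->.
Qed.

Lemma L2norm_fourierL1B f g : cintble (@leb3 R) f -> cintble (@leb3 R) g ->
  (L2norm (fourierL1 f \- fourierL1 g) <= L2norm (f \- g))%E.
Proof.
move=> itf itg; apply: L2norm_sqint_le.
have := sqint_fourierL1 (cintbleB itf itg); congr (_ <= _)%E; congr sqint.
apply/funext => xi; rewrite /= !fourierL1E -mulrBr /FTu -cintB; try exact: cintble_FTu.
by congr (_ * _); apply: eq_cint => x; rewrite mulrBr.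
Qed.

(** By the contraction, the transforms of two approximating sequences of [f] are as close as the
    sequences themselves, so their limits coincide in L^2. *)
Lemma is_fourier_unique f fh fh' : is_fourier f fh -> is_fourier f fh' ->
  L2norm (fh \- fh') = 0%E.
Proof.
move=> [[mf _] [mfh _] [u [ui uf uh]]] [_ [mfh' _] [v [vi vf vh]]].
have mu n : cmeas (u n : T3 -> C) by exact: cintble_meas (ui n).1.
have mv n : cmeas (v n : T3 -> C) by exact: cintble_meas (vi n).1.
have mFu n : cmeas (fourierL1 (u n) : T3 -> C) by exact: cmeas_fourierL1 (ui n).1.
have mFv n : cmeas (fourierL1 (v n) : T3 -> C) by exact: cmeas_fourierL1 (vi n).1.
have le n : (L2norm (fh \- fh') <= L2norm (fourierL1 (u n) \- fh) +
    (L2norm (u n \- f) + L2norm (v n \- f)) + L2norm (fourierL1 (v n) \- fh'))%E.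
  apply: le_trans (L2norm_triB mfh mfh' (mFu n)) _.
  rewrite L2normB_sym -addeA leeD2l//.
  apply: le_trans (L2norm_triB (mFu n) mfh' (mFv n)) _.
  apply: leeD => //; apply: le_trans (L2norm_fourierL1B (ui n).1 (vi n).1) _.
  by apply: le_trans (L2norm_triB (mu n) (mv n) mf) _; rewrite (L2normB_sym f).
apply/eqP; rewrite eq_le L2norm_ge0 andbT.
have cv := cvgeD _ (cvgeD _ uh (cvgeD _ uf vf)) vh.
have {}cv : (L2norm (fourierL1 (u n) \- fh) + (L2norm (u n \- f) + L2norm (v n \- f))
    + L2norm (fourierL1 (v n) \- fh'))%E @[n --> \oo] --> 0%E.
  by have := cv; rewrite !adde0; apply.
rewrite -(cvg_lim _ cv)//; apply: lime_ge; first by apply/cvg_ex; exists 0%E.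
exact: nearW.
Qed.

(** The set under the infimum is a singleton by uniqueness. Lower bounds on [Hnorm] thus reduce to
    one explicit transform. *)
Lemma Hnorm_fourier (s : R) f fh : is_fourier f fh ->
  Hnorm s f = L2norm (fun xi => (japanese xi `^ s)%:C * fh xi).
Proof.
move=> ff.
have mj : measurable_fun setT (fun xi : T3 => japanese xi `^ s : R).
  have ms : measurable_fun setT (@Num.sqrt R).
    exact: continuous_measurable_fun (@sqrt_continuous R).
  apply: (measurableT_comp (measurable_powR s)); apply: (measurableT_comp ms).
  apply: measurable_funD; first exact: measurable_cst.
  by apply: meas_dot; exact: measurable_id.
rewrite /Hnorm (_ : [set _ | _ in _] =
  [set L2norm (fun xi => (japanese xi `^ s)%:C * fh xi)]) ?ereal_inf1//.
apply/seteqP; split => [_ [gh fg <-]|_ ->]; last by exists fh.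
have [_ [mg _] _] := fg; have [_ [mh _] _] := ff.
exact: (L2norm_ae_mul mj mg mh (is_fourier_unique fg ff)).
Qed.

End L2.

Local Arguments sqint {R} f%_R.

(** * Fourier inversion for Lipschitz, compactly supported functions *)

Section Inversion.
Context {R : realType}.
Local Notation C := R[i].
Local Notation T1 := (measurableTypeR R).
Local Notation T3 := (T1 * T1 * T1)%type.
Implicit Types (x y xi : R3 R) (f g k w : R3 R -> C) (e : R).
Local Notation c0 := ((2 * pi) `^ (- (3 / 2)) : R).

(** [K] bounds both the size and the Lipschitz constant. The class is stable under convolution,
    conjugate reflection, bounded Lipschitz multipliers and quadratic phases. [K] and [r] carry
    qualitative information only; no estimate that must be uniform in [N] depends on them. *)
Definition good (K r : R) k := [/\ 0 <= K, 0 <= r, clip K k &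
  forall xi, nc (k xi) <= K * \1_(box r) xi].

Section Good.
Variables (K r : R) (k : R3 R -> C).
Hypothesis gk : good K r k.

Lemma good_cmeas : cmeas (k : T3 -> C).
Proof. by have [_ _ /clip_cmeas] := gk. Qed.

Lemma good_bound xi : nc (k xi) <= K.
Proof.
have [K0 _ _ /(_ xi)] := gk; rewrite indicE; case: (_ \in _); first by rewrite mulr1.
by rewrite mulr0 => /le_trans; exact.
Qed.

Lemma good_supp xi : ~ box r xi -> k xi = 0.
Proof.
move=> h; apply: normc_eq0; apply/eqP; rewrite eq_le normc_ge0 andbT.
by have [_ _ _ /(_ xi)] := gk; rewrite indicE memNset// mulr0.
Qed.

Lemma good_cintble : cintble (@leb3 R) k.
Proof.
have [_ _ _ kb] := gk.
apply: (@le_cintble _ T3 R (@leb3 R) _ (fun x : T3 => K * \1_(box r) x)) => //.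
  exact: good_cmeas.
by under eq_fun do rewrite EFinM; apply: integrableZl => //; exact: integrable_box.
Qed.

Lemma good_sqint : (sqint k <= (K ^+ 2 * (2 * r) ^+ 3)%:E)%E.
Proof. by have [_ r0 _ kb] := gk; apply: sqint_bound => //; exact: good_cmeas. Qed.

End Good.

Definition Finv k x : C := fourierL1 k (- x).

Lemma cmeas_Finv k : cintble (@leb3 R) k -> cmeas (Finv k : T3 -> C).
Proof.
move=> itk; apply: cmeas_comp (cmeas_fourierL1 itk) _.
by apply: meas3N; exact: measurable_id.
Qed.

Lemma sqint_Finv k : cintble (@leb3 R) k -> (sqint (Finv k) <= sqint k)%E.
Proof.
move=> itk; apply: le_trans (sqint_fourierL1 itk).
have [_ _ h] := @scaling_opp R.
have E := h _ (measurable_sqnc (cmeas_fourierL1 itk)) (fun x => ltac:(by rewrite lee_fin sqr_ge0)).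
rewrite mul1e in E; rewrite [leRHS]/sqint -E; exact: lexx.
Qed.

Lemma normc_Finv k x : cintble (@leb3 R) k ->
  nc (Finv k x) <= c0 * \int[@leb3 R]_xi nc (k xi).
Proof.
move=> itk; rewrite /Finv fourierL1E Normc.normcM normc_real gtr0_norm ?c0_gt0//.
by rewrite ler_wpM2l ?normc_FTu// ltW// c0_gt0.
Qed.

Section Approximation.
Variables (K r : R) (k : R3 R -> C).
Hypothesis gk : good K r k.
Let itk : cintble (@leb3 R) k := good_cintble gk.
Let mk : cmeas (k : T3 -> C) := good_cmeas gk.
Let K0 : 0 <= K. Proof. by case: gk. Qed.
Let r0 : 0 <= r. Proof. by case: gk. Qed.

(** [Finv k] is bounded but need not be integrable; multiplied by the Abel weight it is, which
    supplies the approximants that [is_fourier] asks for. *)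
Let damped e x : C := Finv k x * (abel e x)%:C.

(** [FTu_abel] for the reflected [k], followed by a dilation by [e] that moves the parameter from
    the kernel into the argument of [k]. *)
Let fourier_damped e xi : 0 < e ->
  fourierL1 (damped e) xi =
  (c0 ^+ 2)%:C * cint (@leb3 R) (fun z => k (xi - e *: z) * (poisson1 z)%:C).
Proof.
move=> e0; pose kb y := k (- y).
have itkb : cintble (@leb3 R) kb := (scaling_cint (@scaling_opp R) itk).1.
have kbE x : FTu kb x = FTu k (- x).
  rewrite /FTu -[RHS]mul1r -(scaling_cint (@scaling_opp R) (cintble_FTu (- x) itk)).2.
  by apply: eq_cint => y; rewrite dotNl dotNr opprK.
have mp z : poisson e (e *: z) = e ^- 3 * poisson1 z.
  by rewrite /poisson scalerA mulVf ?scale1r// gt_eqF.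
rewrite fourierL1E expr2 RCM -mulrA; congr (_ * _).
have := FTu_abel xi e0 itkb; set L := (X in X = _ -> _) => LE.
have itL : cintble (@leb3 R)
    (fun y => FTu kb y * (expi (- dot y xi) * (abel e y)%:C)).
  by apply: (FTu_mult itkb _).1; exact: (cint_abel xi e0).1.
have -> : FTu (damped e) xi = c0%:C * L.
  by rewrite -cintZ//; apply: eq_cint => y; rewrite kbE /damped /Finv fourierL1E; ring.
rewrite LE; congr (_ * _).
have itp : cintble (@leb3 R) (fun y => k (xi - y) * (poisson e y)%:C).
  apply: (@le_cintble _ T3 R (@leb3 R) _ (fun y : T3 => K * poisson e y)).
  - apply: cmeasM.
      by apply: cmeas_comp mk _; apply: meas3B; [exact: measurable_cst|exact: measurable_id].
    by apply: cmeas_real; exact: measurable_poisson.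
  - under eq_fun do rewrite EFinM; apply: integrableZl => //.
    exact: (integrable_poisson e0).1.
  - move=> y; have p0 := poisson_ge0 y (ltW e0).
    rewrite Normc.normcM normc_real ger0_norm// ler_wpM2r//.
    exact: good_bound gk _.
transitivity (cint (@leb3 R) (fun y => k (xi - y) * (poisson e y)%:C)).
  have := (scaling_cint (scaling_shift xi) itp).2; rewrite mul1r => <-.
  apply: eq_cint => y; rewrite /kb [y + xi]addrC opprD addrA subrr sub0r//.
have [_] := scaling_cint (scaling_affine 0 e0) itp.
move=> /(congr1 (fun c : C => (e ^+ 3)%:C * c)).
rewrite mulrA -RCM mulfV ?mul1r; last by rewrite expf_neq0// gt_eqF.
move=> <-; rewrite -cintZ; last exact: (scaling_cint (scaling_affine 0 e0) itp).1.
have e3 : (e ^+ 3)%:C * (e ^- 3)%:C = 1 :> C.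
  by rewrite -RCM mulfV// expf_neq0// gt_eqF.
apply: eq_cint => z; rewrite addr0 mp (RCM (e ^- 3)).
transitivity (((e ^+ 3)%:C * (e ^- 3)%:C) * (k (xi - e *: z) * (poisson1 z)%:C) : C).
  by ring.
by rewrite e3 mul1r.
Qed.

Let osc e xi : R := \int[@leb3 R]_z (nc (k (xi - e *: z) - k xi) * poisson1 z).

Let meas_osc e :
  measurable_fun setT (fun z : T3 * T3 => (nc (k ((z.1 : R3 R) - e *: (z.2 : R3 R)) - k z.1))).
Proof.
apply: measurable_normc; apply: cmeasB.
  apply: cmeas_comp mk _; apply: meas3B; first exact: measurable_fst.
  by apply: meas3Z; exact: measurable_snd.
by apply: cmeas_comp mk _; exact: measurable_fst.
Qed.

Let mpoisson1 : measurable_fun setT (poisson1 : T3 -> R).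
Proof. by have [/measurable_int/measurable_EFinP] := @integrable_poisson1 R. Qed.

Let osc_int e xi : (@leb3 R).-integrable setT
  (fun z => (nc (k (xi - e *: z) - k xi) * poisson1 z)%:E).
Proof.
have [ip _] := @integrable_poisson1 R.
apply: (le_integrable measurableT _ _ (integrableZl measurableT (2 * K) ip)).
  apply/measurable_EFinP; apply: measurable_funM => //.
  exact: measurableT_comp (meas_osc e) (@pair1_measurable _ _ T3 T3 xi).
move=> z _; rewrite -EFinM lee_fin !normrM ler_wpM2r// ger0_norm ?normc_ge0//.
rewrite -normrM ger0_norm ?mulr_ge0//; apply: le_trans (le_normcD _ _) _.
rewrite normcN; have := good_bound gk (xi - e *: z); have := good_bound gk xi; lra.
Qed.

(** The two bounds are multiplied in [sqint_damped_bound]: the squared error is then controlled by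
    the first power of the oscillation, and an L^1 modulus of continuity of [k] suffices. Both rest
    on [c0 ^ 2] times the Poisson mass being 1. *)
Let fourier_damped_bound e xi : 0 < e ->
  nc (fourierL1 (damped e) xi - k xi) <= c0 ^+ 2 * osc e xi /\
  nc (fourierL1 (damped e) xi - k xi) <= 2 * K.
Proof.
move=> e0; have [ip Ip] := @integrable_poisson1 R.
have c1 : (c0 ^+ 2) * (2 * pi) ^+ 3 = 1 := c0_sqr.
have it1 : cintble (@leb3 R) (fun z => k (xi - e *: z) * (poisson1 z)%:C).
  apply: (@le_cintble _ T3 R (@leb3 R) _ (fun z : T3 => K * poisson1 z)).
  - apply: cmeasM; last exact: cmeas_real.
    apply: cmeas_comp mk _; apply: meas3B; first exact: measurable_cst.
    by apply: meas3Z; exact: measurable_id.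
  - by under eq_fun do rewrite EFinM; exact: integrableZl.
  - move=> z; have p0 := poisson1_ge0 z.
    by rewrite Normc.normcM normc_real ger0_norm// ler_wpM2r// (good_bound gk).
have it2 : cintble (@leb3 R) (fun z => k xi * (poisson1 z)%:C).
  by apply: cintbleZ; exact: cintble_real.
have -> : fourierL1 (damped e) xi - k xi = (c0 ^+ 2)%:C *
    cint (@leb3 R) (fun z => (k (xi - e *: z) - k xi) * (poisson1 z)%:C).
  rewrite fourier_damped//.
  have kE : k xi = (c0 ^+ 2)%:C * cint (@leb3 R) (fun z => k xi * (poisson1 z)%:C).
    rewrite cintZ; last exact: cintble_real.
    by rewrite cint_real Ip mulrCA -RCM c1 mulr1.
  rewrite [X in _ - X]kE -mulrBr -cintB//; congr (_ * _); apply: eq_cint => z.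
  by rewrite mulrBl.
have itd : cintble (@leb3 R) (fun z => (k (xi - e *: z) - k xi) * (poisson1 z)%:C).
  by under eq_fun do rewrite mulrBl; exact: cintbleB.
rewrite Normc.normcM normc_real ger0_norm ?sqr_ge0//.
have le : nc (cint (@leb3 R) (fun z => (k (xi - e *: z) - k xi) * (poisson1 z)%:C)) <= osc e xi.
  apply: le_normc_cint_bound => // z.
  by rewrite Normc.normcM normc_real ger0_norm ?poisson1_ge0.
have h : c0 ^+ 2 * osc e xi <= 2 * K.
  have : osc e xi <= 2 * K * (2 * pi) ^+ 3.
    have i2 : (@leb3 R).-integrable setT (fun z => (2 * K * poisson1 z)%:E).
      by under eq_fun do rewrite EFinM; exact: integrableZl.
    rewrite -Ip -RintegralZl//; apply: (le_Rintegral measurableT (osc_int e xi) i2) => z _.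
    rewrite ler_wpM2r ?poisson1_ge0//; apply: le_trans (le_normcD _ _) _.
    by rewrite normcN; have := good_bound gk (xi - e *: z); have := good_bound gk xi; lra.
  move=> /(ler_wpM2l (sqr_ge0 c0)) /le_trans; apply.
  by rewrite mulrCA c1 mulr1.
split; first by rewrite ler_wpM2l ?sqr_ge0.
by apply: le_trans h; rewrite ler_wpM2l ?sqr_ge0.
Qed.

Let modulus (a : R3 R) : \bar R := (\int[@leb3 R]_xi (nc (k (xi - a) - k xi))%:E)%E.

(** A bound for every shift, needed as domination where [modulus_small] does not apply. *)
Let modulus_bound a : (modulus a <= (2 * K * (2 * r) ^+ 3)%:E)%E.
Proof.
have [_ _ _ kb] := gk.
have mka : cmeas (fun xi : T3 => k ((xi : R3 R) - a)).
  by apply: cmeas_comp mk _; apply: meas3B; [exact: measurable_id|exact: measurable_cst].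
have mnk := measurable_normc mk.
have I : (\int[@leb3 R]_xi (nc (k xi))%:E <= (K * (2 * r) ^+ 3)%:E)%E.
  rewrite -(Rintegral_box r0) -RintegralZl//; last exact: integrable_box.
  rewrite integrable_fineE; last first.
    by under eq_fun do rewrite EFinM; apply: integrableZl => //; exact: integrable_box.
  apply: ge0_le_integral => //.
  - by move=> x _; rewrite lee_fin normc_ge0.
  - exact/measurable_EFinP.
  - apply/measurable_EFinP; apply: measurable_funM; first exact: measurable_cst.
    exact: measurable_indic (measurable_box r).
  - by move=> x _; rewrite lee_fin.
have Ia : (\int[@leb3 R]_xi (nc (k (xi - a)))%:E = \int[@leb3 R]_xi (nc (k xi))%:E)%E.
  have [_ _ h] := scaling_shift (- a).
  have := h (fun xi => (nc (k xi))%:E); rewrite mul1e => -> //.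
    exact/measurable_EFinP.
  by move=> x; rewrite lee_fin normc_ge0.
apply: le_trans (_ : (\int[@leb3 R]_xi ((nc (k (xi - a)))%:E + (nc (k xi))%:E) <= _)%E).
  apply: ge0_le_integral => //.
  - by move=> x _; rewrite lee_fin normc_ge0.
  - by apply/measurable_EFinP; apply: measurable_normc; exact: cmeasB.
  - by apply: emeasurable_funD; apply/measurable_EFinP => //; exact: measurable_normc.
  - by move=> x _; rewrite -EFinD lee_fin; apply: le_trans (le_normcD _ _) _; rewrite normcN.
rewrite ge0_integralD//.
- rewrite Ia; apply: le_trans (leeD I I) _; rewrite -EFinD lee_fin; lra.
- by move=> x _; rewrite lee_fin normc_ge0.
- by apply/measurable_EFinP; exact: measurable_normc.
- by move=> x _; rewrite lee_fin normc_ge0.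
- exact/measurable_EFinP.
Qed.

(** For shifts of size at most 1 the difference is supported in the box enlarged by 1, where the
    Lipschitz bound of [k] applies. *)
Let modulus_small a : norm1 a <= 1 -> (modulus a <= (K * norm1 a * (2 * (r + 1)) ^+ 3)%:E)%E.
Proof.
move=> a1; have [_ _ kL kb] := gk.
have r1 : 0 <= r + 1 by rewrite addr_ge0.
rewrite -(Rintegral_box r1) -RintegralZl//; last exact: integrable_box.
rewrite integrable_fineE; last first.
  by under eq_fun do rewrite EFinM; apply: integrableZl => //; exact: integrable_box.
apply: ge0_le_integral => //.
- by move=> x _; rewrite lee_fin normc_ge0.
- apply/measurable_EFinP; apply: measurable_normc; apply: cmeasB => //.
  by apply: cmeas_comp mk _; apply: meas3B; [exact: measurable_id|exact: measurable_cst].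
- apply/measurable_EFinP; apply: measurable_funM; first exact: measurable_cst.
  exact: measurable_indic (measurable_box _).
move=> x _; rewrite lee_fin indicE; have [xb|xb] := boolP (x \in box (r + 1)).
  rewrite mulr1; apply: le_trans (kL _ _) _.
  by rewrite addrAC subrr add0r norm1N.
rewrite mulr0 !(good_supp gk) ?subrr ?Normc.normc0//.
  move=> [h1 h2 h3]; move/negP : xb; apply; rewrite inE.
  by split; lra.
move=> [] /=; move: a1 xb; rewrite /norm1 notin_setE /box /=.
move=> a1 xb h1 h2 h3; apply: xb.
have := ler_distD x.1.1 a.1.1 0; have := ler_normD (x.1.1 - a.1.1) a.1.1.
have := ler_normD (x.1.2 - a.1.2) a.1.2; have := ler_normD (x.2 - a.2) a.2.
rewrite !subrK; have := normr_ge0 a.1.1; have := normr_ge0 a.1.2; have := normr_ge0 a.2.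
by move=> *; split; lra.
Qed.

Let modulus_ge0 a : (0 <= modulus a)%E.
Proof. by apply: integral_ge0 => x _; rewrite lee_fin normc_ge0. Qed.

Let e_ (n : nat) : R := n.+1%:R^-1.
Let e_gt0 n : 0 < e_ n. Proof. by rewrite invr_gt0. Qed.

Let sqint_damped_bound e : 0 < e ->
  (sqint (fourierL1 (damped e) \- k) <=
   (2 * K * c0 ^+ 2)%:E * \int[@leb3 R]_z (modulus (e *: z) * (poisson1 z)%:E))%E.
Proof.
move=> e0; have c2 : 0 <= 2 * K * c0 ^+ 2 by rewrite mulr_ge0 ?sqr_ge0// mulr_ge0.
pose Q (z : T3 * T3) : \bar R :=
  (nc (k ((z.1 : R3 R) - e *: (z.2 : R3 R)) - k z.1) * poisson1 z.2)%:E.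
have mQ : measurable_fun setT Q.
  apply/measurable_EFinP; apply: measurable_funM; first exact: meas_osc.
  exact: measurableT_comp mpoisson1 measurable_snd.
have Q0 z : (0 <= Q z)%E by rewrite lee_fin mulr_ge0 ?normc_ge0 ?poisson1_ge0.
have mI : measurable_fun setT (fun x => \int[@leb3 R]_y Q (x, y))%E.
  exact: (measurable_fun_fubini_tonelli_F (m2 := @leb3s R)).
have -> : (\int[@leb3 R]_z (modulus (e *: z) * (poisson1 z)%:E) =
    \int[@leb3 R]_x \int[@leb3 R]_y Q (x, y))%E.
  rewrite (fubini_tonelli (m1 := @leb3s R) (m2 := @leb3s R) Q)//.
  apply: eq_integral => z _; rewrite /Q /=.
  under eq_integral do rewrite EFinM.
  rewrite ge0_integralZr//.
  - apply/measurable_EFinP.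
    exact: measurableT_comp (meas_osc e) (@pair2_measurable _ _ T3 T3 z).
  - by move=> x _; rewrite lee_fin normc_ge0.
  - by rewrite lee_fin poisson1_ge0.
rewrite -ge0_integralZl//; last by move=> x _; exact: integral_ge0.
apply: ge0_le_integral => //.
- by move=> x _; rewrite lee_fin sqr_ge0.
- apply: measurable_sqnc; apply: cmeasB => //.
  apply: cmeas_fourierL1.
  apply: (@le_cintble _ T3 R (@leb3 R) _
    (fun x : T3 => c0 * (\int[@leb3 R]_xi nc (k xi)) * abel e x)).
  + by apply: cmeasM; [exact: cmeas_Finv|apply: cmeas_real; exact: measurable_abel].
  + by under eq_fun do rewrite EFinM; apply: integrableZl => //; exact: integrable_abel.
  + move=> x; rewrite Normc.normcM normc_real ger0_norm ?abel_ge0//.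
    by rewrite ler_wpM2r ?abel_ge0// normc_Finv.
- exact: measurable_funeM.
move=> x _; have [h1 h2] := fourier_damped_bound x e0.
have -> : (\int[@leb3 R]_y Q (x, y) = (osc e x)%:E)%E by rewrite integrable_fineE.
rewrite -EFinM lee_fin.
have -> : 2 * K * c0 ^+ 2 * osc e x = (2 * K) * (c0 ^+ 2 * osc e x) by ring.
by rewrite expr2 (ler_pM _ _ h2 h1)// normc_ge0.
Qed.

(** [damped (1 / (n + 1))] tends to [Finv k] by dominated convergence. Its transform tends to [k]
    because the Poisson average of the L^1 modulus at scale [1 / (n + 1)] tends to 0, dominated by a
    multiple of [poisson1]. *)
Lemma is_fourier_Finv : is_fourier (Finv k) k.
Proof.
have sk : (sqint k < +oo)%E by apply: le_lt_trans (good_sqint gk) _; rewrite ltry.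
have sF : (sqint (Finv k) < +oo)%E := le_lt_trans (sqint_Finv itk) sk.
have mF := cmeas_Finv itk.
split; [exact: inL2_sqint|exact: inL2_sqint|].
have md e : cmeas (damped e : T3 -> C).
  by apply: cmeasM => //; apply: cmeas_real; exact: measurable_abel.
have a1 n x : 0 <= abel (e_ n) x <= 1 by rewrite abel_ge0 abel_le1// ltW.
exists (fun n => damped (e_ n)); split.
- move=> n; split.
    apply: (@le_cintble _ T3 R (@leb3 R) _
      (fun x : T3 => c0 * (\int[@leb3 R]_xi nc (k xi)) * abel (e_ n) x)) => //.
      by under eq_fun do rewrite EFinM; apply: integrableZl => //; exact: integrable_abel.
    move=> x; rewrite Normc.normcM normc_real ger0_norm ?abel_ge0//.
    by rewrite ler_wpM2r ?abel_ge0// normc_Finv.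
  split; first exact: md.
  apply: le_lt_trans (L2norm_lty sF); apply: le_L2norm => // x.
  rewrite Normc.normcM normc_real ger0_norm ?abel_ge0// ler_piMr ?normc_ge0//.
  by case/andP : (a1 n x).
- apply: L2norm_cvg0.
  have := @dominated_cvg _ T3 R (@leb3 R) setT measurableT
    (fun n x => (nc (damped (e_ n) x - Finv k x) ^+ 2)%:E) (fun=> 0%E)
    (fun x => (nc (Finv k x) ^+ 2)%:E).
  rewrite integral0; apply => //.
  + by move=> n; apply: measurable_sqnc; exact: cmeasB.
  + move=> x _; apply: cvg_EFin; first exact: nearW.
    have ac : abel (e_ n) x @[n --> \oo] --> (1 : R).
      have e_cvg : - (e_ n * norm1 x) @[n --> \oo] --> (0 : R).
        rewrite -oppr0; apply: cvgN; rewrite -(mul0r (norm1 x)); apply: cvgMl.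
        exact: cvg_harmonic.
      have := @continuous_cvg _ _ _ _ _ _ expR _ (@continuous_expR R 0) e_cvg.
      by rewrite expR0; apply.
    have E n : nc (damped (e_ n) x - Finv k x) ^+ 2 =
        (nc (Finv k x) * (1 - abel (e_ n) x)) ^+ 2.
      rewrite normcB /damped -[X in X - _]mulr1 -mulrBr Normc.normcM.
      by rewrite -[1]/((1 : R)%:C) -RCN -RCD normc_real ger0_norm// subr_ge0; case/andP : (a1 n x).
    have L : (nc (Finv k x) * (1 - abel (e_ n) x)) ^+ 2 @[n --> \oo] --> (0 : R).
      rewrite -[X in _ --> X](_ : (nc (Finv k x) * (1 - 1)) ^+ 2 = 0); last first.
        by rewrite subrr mulr0 expr0n.
      rewrite expr2; under eq_fun do rewrite expr2.
      by apply: cvgM; apply: cvgMr; apply: cvgB => //; exact: cvg_cst.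
    by apply: cvg_trans L; apply: near_eq_cvg; apply: nearW => n; rewrite -E.
  + apply/integrableP; split; first exact: measurable_sqnc.
    under eq_integral => x _ do rewrite gee0_abs ?lee_fin ?sqr_ge0//.
    exact: sF.
  + move=> n x _; rewrite gee0_abs ?lee_fin ?sqr_ge0//.
    rewrite ler_sqr ?nnegrE ?normc_ge0// normcB /damped -[X in X - _]mulr1 -mulrBr Normc.normcM.
    have /andP[h0 h1] := a1 n x.
    rewrite ler_piMr ?normc_ge0// -[1]/((1 : R)%:C) -RCN -RCD normc_real ger0_norm; lra.
- apply: L2norm_cvg0.
  have c2 : 0 <= 2 * K * c0 ^+ 2 by rewrite mulr_ge0 ?sqr_ge0// mulr_ge0.
  have [ip Ip] := @integrable_poisson1 R.
  have mm n : measurable_fun setT (fun z : T3 => modulus (e_ n *: (z : R3 R)) * (poisson1 z)%:E)%E.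
    apply: emeasurable_funM; last exact/measurable_EFinP.
    apply: (measurable_fun_fubini_tonelli_G (m1 := @leb3s R)
      (fun z : T3 * T3 => (nc (k ((z.1 : R3 R) - e_ n *: (z.2 : R3 R)) - k z.1))%:E)).
      by apply/measurable_EFinP; exact: meas_osc.
    by move=> z; rewrite lee_fin normc_ge0.
  have H := @dominated_cvg _ T3 R (@leb3 R) setT measurableT
    (fun n z => modulus (e_ n *: (z : R3 R)) * (poisson1 z)%:E)%E (fun=> 0%E)
    (fun z => (2 * K * (2 * r) ^+ 3 * poisson1 z)%:E).
  rewrite integral0 in H.
  have {}H : (\int[@leb3 R]_z (modulus (e_ n *: z) * (poisson1 z)%:E))%E @[n --> \oo] --> 0%E.
    apply: H => //.
    + move=> z _; rewrite -(mul0e (poisson1 z)%:E).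
      apply: cvgeZr => //.
      (* For fixed [z] the shift has size at most 1 once [n >= norm1 z], as [modulus_small]
         requires. *)
      have sq : \forall n \near \oo, (0 <= modulus (e_ n *: z) <=
          (K * (e_ n * norm1 z) * (2 * (r + 1)) ^+ 3)%:E)%E.
        near=> n; rewrite modulus_ge0/=.
        have ez : norm1 (e_ n *: z) = e_ n * norm1 z.
          by rewrite norm1Z ger0_norm// ltW.
        rewrite -ez; apply: modulus_small; rewrite ez /e_ mulrC ler_pdivrMr// mul1r.
        have : (norm1 z <= n%:R) by near: n; exact: nbhs_infty_ger.
        by move=> /le_trans; apply; rewrite ler_nat.
      apply: (squeeze_cvge sq (cvg_cst _)).
      apply: cvg_EFin; first exact: nearW.
      rewrite -[X in _ --> X](_ : K * (0 * norm1 z) * (2 * (r + 1)) ^+ 3 = 0); last first.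
        by rewrite mul0r mulr0 mul0r.
      by apply: cvgMl; apply: cvgMr; apply: cvgMl; exact: cvg_harmonic.
    + by under eq_fun do rewrite EFinM; exact: integrableZl.
    + move=> n z _; rewrite gee0_abs; last first.
        by rewrite mule_ge0 ?modulus_ge0// lee_fin poisson1_ge0.
      rewrite [leRHS]EFinM.
      apply: lee_pmul; [exact: modulus_ge0| |exact: modulus_bound|exact: lexx].
      by rewrite lee_fin poisson1_ge0.
  have {}H : ((2 * K * c0 ^+ 2)%:E *
      \int[@leb3 R]_z (modulus (e_ n *: z) * (poisson1 z)%:E))%E @[n --> \oo] --> 0%E.
    by rewrite -[X in _ --> X](mule0 (2 * K * c0 ^+ 2)%:E); apply: cvgeZl.
  have sq : \forall n \near \oo, (0 <= sqint (fourierL1 (damped (e_ n)) \- k)%R <=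
      (2 * K * c0 ^+ 2)%:E * \int[@leb3 R]_z (modulus (e_ n *: z) * (poisson1 z)%:E))%E.
    by apply: nearW => n; rewrite sqint_ge0 sqint_damped_bound.
  exact: (squeeze_cvge sq (cvg_cst _) H).
Unshelve. all: by end_near. Qed.

End Approximation.

End Inversion.

(** * Convolutions and the nonlinearity *)

Section Algebra.
Context {R : realType}.
Local Notation C := R[i].
Local Notation T1 := (measurableTypeR R).
Local Notation T3 := (T1 * T1 * T1)%type.
Implicit Types (x y xi eta : R3 R) (f g k a b u v : R3 R -> C).
Local Notation c0 := ((2 * pi) `^ (- (3 / 2)) : R).

Lemma expi_lip (s t : R) : nc (expi s - expi t) <= 2 * `|s - t|.
Proof.
apply: le_trans (normc_le_ReIm _) _; rewrite !cReE /=.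
have h1 := Rcos_lip s t; have := Rcos_lip (s - pi / 2) (t - pi / 2).
by rewrite !cosBpihalf (_ : s - _ - (t - _) = s - t); [lra|ring].
Qed.

Lemma good_le (K K' r r' : R) k : K <= K' -> r <= r' -> good K r k -> good K' r' k.
Proof.
move=> KK rr [K0 r0 kL kb]; split.
- exact: le_trans KK.
- exact: le_trans rr.
- by move=> x y; apply: le_trans (kL x y) _; rewrite ler_wpM2r// norm1_ge0.
- move=> x; apply: le_trans (kb x) _; apply: ler_pM => //.
  exact: indic_box_le.
Qed.

Lemma boxD (r s : R) x y : box r x -> box s y -> box (r + s) (x + y).
Proof.
move=> [a1 a2 a3] [b1 b2 b3]; split => /=.
- by have := ler_normD x.1.1 y.1.1; lra.
- by have := ler_normD x.1.2 y.1.2; lra.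
- by have := ler_normD x.2 y.2; lra.
Qed.

Lemma boxN (r : R) x : box r x -> box r (- x).
Proof. by move=> [a1 a2 a3]; split; rewrite /= normrN. Qed.

Lemma box_norm1 (r : R) x : box r x -> norm1 x <= 3 * r.
Proof. by move=> [a1 a2 a3]; rewrite /norm1; lra. Qed.

(** The factor [c0] is the one for which [Finv] turns [conv] into the pointwise product, see
    [FinvM]. *)
Definition conv a b xi : C :=
  c0%:C * cint (@leb3 R) (fun eta => a (xi - eta) * b eta).

Lemma cmeas_convk a b xi : cmeas (a : T3 -> C) -> cmeas (b : T3 -> C) ->
  cmeas (fun eta : T3 => a (xi - (eta : R3 R)) * b eta).
Proof.
move=> ma mb; apply: cmeasM => //; apply: cmeas_comp ma _.
by apply: meas3B; [exact: measurable_cst|exact: measurable_id].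
Qed.

Lemma conv_bound (A B r : R) u v xi : 0 <= r ->
  cmeas (u : T3 -> C) -> cmeas (v : T3 -> C) ->
  (forall x, nc (u x) <= A) -> (forall x, nc (v x) <= B * \1_(box r) x) ->
  cintble (@leb3 R) (fun eta => u (xi - eta) * v eta) /\
  nc (conv u v xi) <= c0 * (A * B * (2 * r) ^+ 3).
Proof.
move=> r0 mu mv uA vB.
have iB : (@leb3 R).-integrable setT (fun x => (A * B * \1_(box r) x)%:E).
  by under eq_fun do rewrite EFinM; apply: integrableZl => //; exact: integrable_box.
have le eta : nc (u (xi - eta) * v eta) <= A * B * \1_(box r) eta.
  by rewrite Normc.normcM -mulrA; apply: ler_pM; rewrite ?normc_ge0.
have it : cintble (@leb3 R) (fun eta => u (xi - eta) * v eta).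
  by apply: le_cintble iB _ => //; exact: cmeas_convk.
split => //; rewrite /conv Normc.normcM normc_real gtr0_norm ?c0_gt0//.
rewrite ler_wpM2l ?(ltW (@c0_gt0 R))//; apply: le_trans (le_normc_cint_bound it iB le) _.
by rewrite RintegralZl ?Rintegral_box//; exact: integrable_box.
Qed.

Lemma convBl a a' b xi : cintble (@leb3 R) (fun eta => a (xi - eta) * b eta) ->
  cintble (@leb3 R) (fun eta => a' (xi - eta) * b eta) ->
  conv a b xi - conv a' b xi = conv (fun x => a x - a' x) b xi.
Proof.
move=> i1 i2; rewrite /conv -mulrBr -cintB//; congr (_ * _).
by apply: eq_cint => eta; rewrite mulrBl.
Qed.

Lemma convBr a b b' xi : cintble (@leb3 R) (fun eta => a (xi - eta) * b eta) ->
  cintble (@leb3 R) (fun eta => a (xi - eta) * b' eta) ->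
  conv a b xi - conv a b' xi = conv a (fun x => b x - b' x) xi.
Proof.
move=> i1 i2; rewrite /conv -mulrBr -cintB//; congr (_ * _).
by apply: eq_cint => eta; rewrite mulrBr.
Qed.

Lemma good_conv (K L r s : R) a b : good K r a -> good L s b ->
  good (c0 * (K * L * (2 * s) ^+ 3)) (r + s) (conv a b).
Proof.
move=> ga gb; have [K0 r0 aL ab] := ga; have [L0 s0 bL bb] := gb.
have ma := good_cmeas ga; have mb := good_cmeas gb.
have c0' := ltW (@c0_gt0 R).
split.
- by rewrite !mulr_ge0// exprn_ge0// mulr_ge0.
- exact: addr_ge0.
(* Translating [a] makes both values convolutions at the same point [x], so their difference is a
   single convolution with [a - a']. *)
- move=> x y; pose a' z := a (z - x + y).
  have ma' : cmeas (a' : T3 -> C).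
    apply: cmeas_comp ma _; apply: meas3D; last exact: measurable_cst.
    by apply: meas3B; [exact: measurable_id|exact: measurable_cst].
  have aB z : nc (a z) <= K := good_bound ga z.
  have E : conv a b y = conv a' b x.
    rewrite /conv; congr (_ * _); apply: eq_cint => eta.
    by rewrite /a' (addrC x) addrK (addrC _ y).
  have [i1 _] := conv_bound x s0 ma mb aB bb.
  have [i2 _] := conv_bound x s0 ma' mb (fun z => aB _) bb.
  rewrite E convBl//.
  have uA z : nc (a z - a' z) <= K * norm1 (x - y).
    apply: le_trans (aL _ _) _; apply: ler_wpM2l => //.
    by rewrite /a' opprD opprB addrA (addrC z) subrK.
  have [_ h] := conv_bound x s0 (cmeasB ma ma') mb uA bb.
  by apply: le_trans h _; rewrite le_eqVlt; apply/orP; left; apply/eqP; ring.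
- move=> xi; rewrite indicE; have [|] := boolP (xi \in _) => xb.
    rewrite mulr1; apply: (conv_bound xi s0 ma mb _ bb).2 => z; exact: good_bound ga z.
  rewrite mulr0 /conv (eq_cint _ (g := fun=> 0)) ?cint0 ?mulr0 ?Normc.normc0//.
  move=> eta; have [eb|eb] := boolP (eta \in box s); last first.
    by rewrite (good_supp gb) ?mulr0//; move: eb; rewrite notin_setE.
  rewrite (good_supp ga) ?mul0r// => xe; move/negP : xb; apply.
  by rewrite inE -(subrK eta xi); apply: boxD => //; rewrite inE in eb.
Qed.

(** The transform of the complex conjugate of [Finv k], see [FinvJ]. *)
Definition reflJ k xi : C := (k (- xi))^*.

Lemma good_reflJ (K r : R) k : good K r k -> good K r (reflJ k).
Proof.
move=> [K0 r0 kL kb]; split => //.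
- move=> x y; rewrite /reflJ.
  have -> : (k (- x))^* - (k (- y))^* = (k (- x) - k (- y))^*.
    by apply: complex_eq; rewrite !cReE; ring.
  by rewrite normcJ; apply: le_trans (kL _ _) _; rewrite -norm1N !opprD !opprK.
- move=> x; rewrite /reflJ normcJ; apply: le_trans (kb _) _.
  rewrite ler_wpM2l// !indicE ler_nat leq_eqVlt; apply/orP; left; apply/eqP; congr nat_of_bool.
  apply/idP/idP; rewrite !inE => h; last exact: boxN.
  by rewrite -(opprK x); exact: boxN.
Qed.

Lemma good_mult (A L K r : R) (m : R3 R -> R) k : 0 <= A -> 0 <= L ->
  (forall x, `|m x| <= A) -> (forall x y, `|m x - m y| <= L * norm1 (x - y)) ->
  good K r k -> good ((A + L) * K) r (fun x => (m x)%:C * k x).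
Proof.
move=> A0 L0 mA mL gk; have [K0 r0 kL kb] := gk; split => //.
- by rewrite mulr_ge0// addr_ge0.
- move=> x y; have -> : (m x)%:C * k x - (m y)%:C * k y =
      (m x)%:C * (k x - k y) + (m x - m y)%:C * k y.
    by rewrite RCD RCN; ring.
  apply: le_trans (le_normcD _ _) _; rewrite !Normc.normcM !normc_real.
  rewrite 2!mulrDl; apply: lerD; rewrite -mulrA.
    by apply: ler_pM => //; exact: normc_ge0.
  rewrite (mulrC K) mulrA; apply: ler_pM => //; first exact: normc_ge0.
  exact: good_bound gk y.
- move=> x; rewrite Normc.normcM normc_real -mulrA; apply: ler_pM => //; first exact: normc_ge0.
  by apply: le_trans (mA x) _; rewrite lerDl.
Qed.

(** The phase [t |x|^2] is Lipschitz only on bounded sets. If one of the points lies outside the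
    box, [k] vanishes there and the phase drops out; inside, the constant 12 is the 2 of [expi_lip]
    times the 6 in [norm1 (x + y) <= 6 r]. *)
Lemma good_phase (K r t : R) k : good K r k ->
  good (K + 12 * `|t| * r * K) r (fun x => expi (t * dot x x) * k x).
Proof.
move=> gk; have [K0 r0 kL kb] := gk.
have B0 : 0 <= 12 * `|t| * r * K by rewrite !mulr_ge0.
split => //; first exact: addr_ge0.
- have half x y : ~ box r y -> nc (expi (t * dot x x) * k x - expi (t * dot y y) * k y) <=
      K * norm1 (x - y).
    move=> yb; rewrite (good_supp gk yb) mulr0 subr0 Normc.normcM normc_expi mul1r.
    by have := kL x y; rewrite (good_supp gk yb) subr0.
  move=> x y; have d0 := norm1_ge0 (x - y).
  have [xb|xb] := pselect (box r x); last first.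
    rewrite normcB norm1B; apply: le_trans (half _ _ xb) _.
    by rewrite ler_wpM2r ?norm1_ge0// lerDl.
  have [yb|yb] := pselect (box r y); last first.
    by apply: le_trans (half _ _ yb) _; rewrite ler_wpM2r// lerDl.
  have -> : expi (t * dot x x) * k x - expi (t * dot y y) * k y =
     expi (t * dot x x) * (k x - k y) + (expi (t * dot x x) - expi (t * dot y y)) * k y.
    by ring.
  apply: le_trans (le_normcD _ _) _; rewrite !Normc.normcM normc_expi mul1r mulrDl.
  apply: lerD => //.
  have h1 : nc (expi (t * dot x x) - expi (t * dot y y) : C) <= 12 * `|t| * r * norm1 (x - y).
    apply: le_trans (expi_lip _ _) _; rewrite -mulrBr normrM.
    have -> : dot x x - dot y y = dot (x - y) (x + y).
      by rewrite dotBl !dotDr (dotC y x); ring.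
    have := abs_dot (x - y) (x + y); have := norm1D x y.
    have := box_norm1 xb; have := box_norm1 yb => h2 h3 h4 h5.
    have h6 : norm1 (x + y) <= 6 * r by lra.
    have h7 : `|dot (x - y) (x + y)| <= norm1 (x - y) * (6 * r).
      by apply: le_trans h5 _; rewrite ler_wpM2l.
    have := ler_wpM2l (normr_ge0 t) h7; lra.
  have h2 := good_bound gk y.
  rewrite (_ : 12 * _ * _ * _ * _ = (12 * `|t| * r * norm1 (x - y)) * K); last by ring.
  by apply: ler_pM => //; exact: normc_ge0.
- move=> x; rewrite Normc.normcM normc_expi mul1r; apply: le_trans (kb x) _.
  by rewrite ler_wpM2r// lerDl.
Qed.

Definition unitI (t : R) := 0 <= t <= 1.

(** Time dependence is Lipschitz uniformly in frequency, which makes integrals over time uniform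
    limits of Riemann sums. *)
Definition gfam (K r : R) (k : R -> R3 R -> C) :=
  (forall t, unitI t -> good K r (k t)) /\
  (forall s t, unitI s -> unitI t -> forall xi, nc (k s xi - k t xi) <= K * `|s - t|).

Lemma gfam_cst (K r : R) k : good K r k -> gfam K r (fun=> k).
Proof.
move=> gk; split => // s t _ _ xi; rewrite subrr Normc.normc0 mulr_ge0//.
by case: gk.
Qed.

Lemma gfam_reflJ (K r : R) (k : R -> R3 R -> C) : gfam K r k -> gfam K r (fun t => reflJ (k t)).
Proof.
move=> [gk tk]; split; first by move=> t t1; exact: good_reflJ (gk t t1).
move=> s t s1 t1 xi; rewrite /reflJ.
have -> : (k s (- xi))^* - (k t (- xi))^* = (k s (- xi) - k t (- xi))^*.
  by apply: complex_eq; rewrite !cReE; ring.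
by rewrite normcJ; exact: tk.
Qed.

Lemma gfam_mult (A L K r : R) (m : R3 R -> R) (k : R -> R3 R -> C) : 0 <= A -> 0 <= L ->
  (forall x, `|m x| <= A) -> (forall x y, `|m x - m y| <= L * norm1 (x - y)) ->
  gfam K r k -> gfam ((A + L) * K) r (fun t x => (m x)%:C * k t x).
Proof.
move=> A0 L0 mA mL [gk tk]; split; first by move=> t t1; exact: good_mult A0 L0 mA mL (gk t t1).
move=> s t s1 t1 xi; rewrite -mulrBr Normc.normcM normc_real -mulrA.
apply: ler_pM => //; first exact: normc_ge0.
  by apply: le_trans (mA _) _; rewrite lerDl.
exact: tk.
Qed.

(** [12 r] is the Lipschitz constant in frequency, as in [good_phase] with [|c t| <= 1]; [18 r^2] is
    the one in time, twice the bound [(3 r)^2] for [dot xi xi] on the box. *)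
Lemma gfam_phase (c K r : R) (k : R -> R3 R -> C) : `|c| <= 1 -> gfam K r k ->
  gfam (K + (12 * r + 18 * r ^+ 2) * K) r (fun t x => expi (c * t * dot x x) * k t x).
Proof.
move=> c1 [gk tk].
have u0 : unitI 0 by rewrite /unitI lexx ler01.
have [K0 r0 _ _] := gk 0 u0.
split.
  move=> t t1; apply: good_le (good_phase (c * t) (gk t t1)) => //.
  rewrite lerD2l ler_wpM2r//; have : `|c * t| <= 1.
    by case/andP : t1 => t0 t1; rewrite normrM (ger0_norm t0) mulr_ile1.
  by move=> h; have := sqr_ge0 r; nra.
move=> s t s1 t1 xi.
have -> : expi (c * s * dot xi xi) * k s xi - expi (c * t * dot xi xi) * k t xi =
   expi (c * s * dot xi xi) * (k s xi - k t xi) +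
   (expi (c * s * dot xi xi) - expi (c * t * dot xi xi)) * k t xi by ring.
apply: le_trans (le_normcD _ _) _; rewrite !Normc.normcM normc_expi mul1r mulrDl.
apply: lerD; first exact: tk.
have [xb|xb] := pselect (box r xi); last first.
  by rewrite (good_supp (gk t t1) xb) Normc.normc0 mulr0 !mulr_ge0// addr_ge0// mulr_ge0// sqr_ge0.
have h1 : nc (expi (c * s * dot xi xi) - expi (c * t * dot xi xi) : C) <=
    18 * r ^+ 2 * `|s - t|.
  apply: le_trans (expi_lip _ _) _; rewrite -mulrBl -mulrBr !normrM.
  have n9 : `|dot xi xi| <= 9 * r ^+ 2.
    apply: le_trans (abs_dot _ _) _; have h := box_norm1 xb.
    have := norm1_ge0 xi; rewrite expr2; nra.
  have a1 : `|c| * `|s - t| <= `|s - t| by rewrite ler_piMl.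
  have := ler_pM (mulr_ge0 (normr_ge0 c) (normr_ge0 (s - t))) (normr_ge0 _) a1 n9.
  lra.
have h2 := good_bound (gk t t1) xi.
rewrite (_ : (12 * r + _) * K * _ =
  12 * r * K * `|s - t| + (18 * r ^+ 2 * `|s - t|) * K); last by ring.
apply: ler_wpDl; first by rewrite !mulr_ge0.
by apply: ler_pM => //; exact: normc_ge0.
Qed.

(** The factor 2 pays for moving the two arguments in time one after the other. *)
Lemma gfam_conv (K L r s : R) (a b : R -> R3 R -> C) : gfam K r a -> gfam L s b ->
  gfam (2 * (c0 * (K * L * (2 * s) ^+ 3))) (r + s) (fun t => conv (a t) (b t)).
Proof.
move=> [ga ta] [gb tb].
have u0 : unitI 0 by rewrite /unitI lexx ler01.
have [K0 r0 _ _] := ga 0 u0; have [L0 s0 _ _] := gb 0 u0.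
have c0' := ltW (@c0_gt0 R).
have B0 : 0 <= c0 * (K * L * (2 * s) ^+ 3).
  by rewrite !mulr_ge0// exprn_ge0// mulr_ge0.
split.
  move=> t t1; apply: good_le (good_conv (ga t t1) (gb t t1)) => //.
  by rewrite ler_peMl// ler1n.
move=> p t p1 t1 xi.
have map := good_cmeas (ga p p1); have mat := good_cmeas (ga t t1).
have mbp := good_cmeas (gb p p1); have mbt := good_cmeas (gb t t1).
have [_ _ _ bbp] := gb p p1; have [_ _ _ bbt] := gb t t1.
have aBp := good_bound (ga p p1); have aBt := good_bound (ga t t1).
have [i1 _] := conv_bound xi s0 map mbp aBp bbp.
have [i2 _] := conv_bound xi s0 mat mbp aBt bbp.
have [i3 _] := conv_bound xi s0 mat mbt aBt bbt.
have -> : conv (a p) (b p) xi - conv (a t) (b t) xi =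
  (conv (a p) (b p) xi - conv (a t) (b p) xi) + (conv (a t) (b p) xi - conv (a t) (b t) xi).
  by rewrite addrA subrK.
apply: le_trans (le_normcD _ _) _; rewrite convBl// convBr//.
have [_ h1] := conv_bound xi s0 (cmeasB map mat) mbp (ta p t p1 t1) bbp.
have bb : forall x, nc (b p x - b t x) <= (L * `|p - t|) * \1_(box s) x.
  move=> x; rewrite indicE; have [xb|xb] := boolP (x \in box s).
    by rewrite mulr1; exact: tb.
  have xb' : ~ box s x by move: xb; rewrite notin_setE.
  by rewrite (good_supp (gb p p1) xb') (good_supp (gb t t1) xb') subrr Normc.normc0 mulr0.
have [_ h2] := conv_bound xi s0 mat (cmeasB mbp mbt) aBt bb.
apply: le_trans (lerD h1 h2) _; rewrite le_eqVlt; apply/orP; left; apply/eqP; ring.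
Qed.

Lemma FinvE k x : Finv k x = c0%:C * cint (@leb3 R) (fun xi => expi (dot xi x) * k xi).
Proof.
rewrite /Finv fourierL1E; congr (_ * _); apply: eq_cint => xi.
by rewrite dotNr opprK.
Qed.

Lemma cintble_expi_dot k x : cintble (@leb3 R) k ->
  cintble (@leb3 R) (fun xi => expi (dot xi x) * k xi).
Proof.
move=> itk; apply: cintble_expi itk _.
by apply: meas_dot; [exact: measurable_id|exact: measurable_cst].
Qed.

Lemma FinvJ k x : cintble (@leb3 R) k -> (Finv k x)^* = Finv (reflJ k) x.
Proof.
move=> itk; have itx := cintble_expi_dot x itk.
have -> : (Finv k x)^* = c0%:C * (cint (@leb3 R) (fun xi => expi (dot xi x) * k xi))^*.
  by rewrite FinvE; apply: complex_eq; rewrite !cReE /=; ring.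
rewrite FinvE; congr (_ * _); etransitivity; first exact/esym/(cintJ itx).
have := (scaling_cint (@scaling_opp R) (cintbleJ itx)).2; rewrite mul1r => <-.
apply: eq_cint => xi; rewrite /reflJ dotNl.
by apply: complex_eq; rewrite !cReE /= ?cosN ?sinN; ring.
Qed.

(** Convolution theorem: Fubini, then the translation of [xi] by [eta] splits the phase into two
    factors. *)
Lemma FinvM (K L r s : R) a b x : good K r a -> good L s b ->
  Finv a x * Finv b x = Finv (conv a b) x.
Proof.
move=> ga gb; have [K0 r0 aL ab] := ga; have [L0 s0 bL bb] := gb.
have ma := good_cmeas ga; have mb := good_cmeas gb.
have ita := good_cintble ga; have itb := good_cintble gb.
pose F (z : T3 * T3) : C := expi (dot z.1 x) * (a ((z.1 : R3 R) - z.2) * b z.2).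
have mF : cmeas F.
  apply: cmeasM.
    by apply: cmeas_expi; apply: meas_dot; [exact: measurable_fst|exact: measurable_cst].
  apply: cmeasM; last by apply: cmeas_comp mb _; exact: measurable_snd.
  by apply: cmeas_comp ma _; apply: meas3B; [exact: measurable_fst|exact: measurable_snd].
have iK : (@leb3s R).-integrable setT (fun x => (K * \1_(box (r + s)) x)%:E).
  by under eq_fun do rewrite EFinM; apply: integrableZl => //; exact: integrable_box.
have iL : (@leb3s R).-integrable setT (fun x => (L * \1_(box s) x)%:E).
  by under eq_fun do rewrite EFinM; apply: integrableZl => //; exact: integrable_box.
have itF : cintble (@leb3s R \x @leb3s R)%E F.
  apply: (le_cintble_prod mF iK iL) => xi eta; rewrite /F /= !Normc.normcM normc_expi mul1r.
  have [eb|eb] := boolP (eta \in box s); last first.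
    rewrite (good_supp gb); last by move: eb; rewrite notin_setE.
    by rewrite Normc.normc0 mulr0 !mulr_ge0.
  apply: ler_pM; rewrite ?normc_ge0//.
  rewrite indicE; have [xb|xb] := boolP (xi \in _).
    by rewrite mulr1; exact: good_bound ga _.
  rewrite (good_supp ga) ?Normc.normc0 ?mulr0// => h; move/negP : xb; apply.
  by rewrite inE -(subrK eta xi); apply: boxD => //; rewrite inE in eb.
have E1 xi : expi (dot xi x) * conv a b xi =
    c0%:C * cint (@leb3s R) (fun eta => F (xi, eta)).
  have [i1 _] := conv_bound xi s0 ma mb (good_bound ga) bb.
  by rewrite /conv mulrCA; congr (_ * _); rewrite -(cintZ _ i1).
have E2 eta : cint (@leb3s R) (fun xi => F (xi, eta)) =
    expi (dot eta x) * b eta * cint (@leb3 R) (fun xi => expi (dot xi x) * a xi).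
  have itx := cintble_expi_dot x ita.
  have [isx] := scaling_cint (scaling_shift (- eta)) itx; rewrite mul1r => <-.
  rewrite -cintZ//; apply: eq_cint => xi; rewrite /F /=.
  have -> : dot xi x = dot eta x + dot (xi - eta) x by rewrite -dotDl addrC subrK.
  by rewrite expiD; ring.
have ex : cintble (@leb3 R) (fun eta => expi (dot eta x) * b eta) := cintble_expi_dot x itb.
rewrite !FinvE (eq_cint (@leb3 R) E1) cintZ; last exact: (cintble_fubini1 itF).
have -> : cint (@leb3 R) (fun xi => cint (@leb3s R) (fun eta => F (xi, eta))) =
    cint (@leb3s R) (fun eta => cint (@leb3s R) (fun xi => F (xi, eta))) := cint_fubini itF.
rewrite (eq_cint (@leb3s R) E2).
have -> : cint (@leb3s R) (fun eta => expi (dot eta x) * b eta *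
    cint (@leb3 R) (fun xi => expi (dot xi x) * a xi)) =
    cint (@leb3 R) (fun xi => expi (dot xi x) * a xi) *
    cint (@leb3 R) (fun eta => expi (dot eta x) * b eta).
  by rewrite -cintZ//; apply: eq_cint => eta; rewrite mulrC.
by ring.
Qed.

End Algebra.

(** * The symbol of the potential and the nonlinearity on the Fourier side *)

Section Potential.
Context {R : realType}.
Local Notation C := R[i].
Local Notation T1 := (measurableTypeR R).
Local Notation T3 := (T1 * T1 * T1)%type.
Implicit Types (x y xi eta : R3 R) (k : R3 R -> C).
Local Notation c0 := ((2 * pi) `^ (- (3 / 2)) : R).

Lemma japanese_ge1 x : 1 <= japanese x.
Proof.
by rewrite /japanese -[leLHS]sqrtr1 ler_wsqrtr// lerDl dot_ge0.
Qed.

Lemma measurable_japanese : measurable_fun setT (japanese : T3 -> R).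
Proof.
have ms : measurable_fun setT (@Num.sqrt R).
  exact: continuous_measurable_fun (@sqrt_continuous R).
apply: (measurableT_comp ms); apply: measurable_funD; first exact: measurable_cst.
by apply: meas_dot; exact: measurable_id.
Qed.

Lemma coord_le_japanese x :
  [/\ `|x.1.1| <= japanese x, `|x.1.2| <= japanese x & `|x.2| <= japanese x].
Proof.
have h (u : R) : u ^+ 2 <= dot x x -> `|u| <= japanese x.
  move=> ux; rewrite /japanese -sqrtr_sqr ler_wsqrtr//.
  by apply: le_trans ux _; rewrite lerDr.
have := sqr_ge0 x.1.1; have := sqr_ge0 x.1.2; have := sqr_ge0 x.2.
by move=> *; split; apply: h; rewrite /dot -!expr2; lra.
Qed.

Lemma norm1_le_japanese x : norm1 x <= 3 * japanese x.
Proof. by have [] := coord_le_japanese x; rewrite /norm1; lra. Qed.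

Variable V : R3 R -> R.
Hypothesis V_ge0 : forall x, 0 <= V x.
Hypothesis V_even : forall x, V (- x) = V x.
Hypothesis V_int : (@leb3 R).-integrable setT (fun x => (japanese x * V x)%:E).

(** Measurability is part of the integrability of [<x> V]; the weight, at least 1, is divided
    out. *)
Lemma measurable_V : measurable_fun setT (V : T3 -> R).
Proof.
have /measurable_EFinP m := measurable_int _ V_int.
have mj := measurableT_comp (measurable_powR (-1)) measurable_japanese.
have := measurable_funM mj m; rewrite (_ : _ \* _ = V)//.
apply/funext => x /=; have j1 := japanese_ge1 x.
by rewrite powR_inv1 ?mulrA ?mulVf ?mul1r//; [rewrite gt_eqF//|]; lra.
Qed.

Lemma integrable_V : (@leb3 R).-integrable setT (fun x => (V x)%:E).
Proof.
apply: (le_integrable measurableT _ _ V_int).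
  by apply/measurable_EFinP; exact: measurable_V.
move=> x _; have j1 := japanese_ge1 x; rewrite lee_fin normrM.
by rewrite ler_peMl// ger0_norm//; lra.
Qed.

Lemma integrable_normV : (@leb3 R).-integrable setT (fun x => (norm1 x * V x)%:E).
Proof.
apply: (le_integrable measurableT _ _ (integrableZl measurableT 3 V_int)).
  apply/measurable_EFinP; apply: measurable_funM; last exact: measurable_V.
  by apply: meas_norm1; exact: measurable_id.
move=> x _; rewrite -EFinM lee_fin mulrA !normrM ler_wpM2r//.
rewrite -normrM ger0_norm ?norm1_ge0//; apply: le_trans (norm1_le_japanese x) _.
exact: ler_norm.
Qed.

Definition Vmom : R := \int[@leb3 R]_y (norm1 y * V y).

Definition symbol xi : R := \int[@leb3 R]_y (V y * (1 - cos (dot y xi))).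

Lemma measurable_cos_dot xi : measurable_fun setT (fun y : T3 => cos (dot y xi)).
Proof.
have mc : measurable_fun setT (@cos R) by exact: continuous_measurable_fun (@continuous_cos R).
apply: (measurableT_comp mc).
by apply: meas_dot; [exact: measurable_id|exact: measurable_cst].
Qed.

Lemma integrable_symbol xi :
  (@leb3 R).-integrable setT (fun y => (V y * (1 - cos (dot y xi)))%:E).
Proof.
apply: (le_integrable measurableT _ _ (integrableZl measurableT 2 integrable_V)).
  apply/measurable_EFinP; apply: measurable_funM; first exact: measurable_V.
  apply: measurable_funB; first exact: measurable_cst.
  exact: measurable_cos_dot.
move=> y _; rewrite -EFinM lee_fin !normrM mulrC ler_wpM2r//.
have := cos_le1 (dot y xi); have := cos_geN1 (dot y xi).
by move=> *; rewrite !ger0_norm; lra.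
Qed.

Lemma symbol_ge0 xi : 0 <= symbol xi.
Proof.
by apply: Rintegral_ge0 => y _; rewrite mulr_ge0// subr_ge0 cos_le1.
Qed.

Lemma symbol_le xi : symbol xi <= 2 * b0 V.
Proof.
rewrite /b0 -RintegralZl//; last exact: integrable_V.
have i2 : (@leb3 R).-integrable setT (fun y => (2 * V y)%:E).
  by under eq_fun do rewrite EFinM; apply: integrableZl => //; exact: integrable_V.
apply: (le_Rintegral measurableT (integrable_symbol xi) i2) => y _; rewrite mulrC ler_wpM2r//.
by have := cos_geN1 (dot y xi); lra.
Qed.

Lemma b0_ge0 : 0 <= b0 V. Proof. by apply: Rintegral_ge0. Qed.

Lemma Vmom_ge0 : 0 <= Vmom.
Proof. by apply: Rintegral_ge0 => x _; rewrite mulr_ge0 ?norm1_ge0. Qed.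

(** The Lipschitz bound on cos produces a factor [norm1 y], paid for by the first moment of [V]. *)
Lemma symbol_lip xi eta : `|symbol xi - symbol eta| <= Vmom * norm1 (xi - eta).
Proof.
have i1 := integrable_symbol xi; have i2 := integrable_symbol eta.
rewrite /symbol -RintegralB//.
have id : (@leb3 R).-integrable setT (fun y => (V y * (1 - cos (dot y xi)) -
    V y * (1 - cos (dot y eta)))%:E).
  by under eq_fun do rewrite EFinB; exact: integrableB.
apply: le_trans (le_normr_Rintegral measurableT id) _.
rewrite /Vmom -RintegralZr//; last exact: integrable_normV.
have i3 : (@leb3 R).-integrable setT (fun y => (norm1 y * V y * norm1 (xi - eta))%:E).
  by under eq_fun do rewrite EFinM; apply: integrableZr => //; exact: integrable_normV.
apply: (le_Rintegral measurableT (integrable_norm id) i3) => y _.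
rewrite /= -mulrBr normrM (ger0_norm (V_ge0 y)).
rewrite [leRHS](_ : _ = V y * (norm1 y * norm1 (xi - eta))); last by ring.
apply: ler_wpM2l => //.
have -> : 1 - cos (dot y xi) - (1 - cos (dot y eta)) = cos (dot y eta) - cos (dot y xi).
  by ring.
apply: le_trans (Rcos_lip _ _) _; rewrite -dotBr.
by apply: le_trans (abs_dot _ _) _; rewrite norm1B.
Qed.

(** Evenness of [V] makes the integral equal to its conjugate, hence real. *)
Lemma cint_V xi : cint (@leb3 R) (fun y => expi (- dot y xi) * (V y)%:C) =
  (b0 V - symbol xi)%:C.
Proof.
have iV := integrable_V; have itV := cintble_real iV.
have it := cintble_FTu xi itV.
set I := cint _ _.
have IJ : I = I^*.
  rewrite -[LHS]mul1r -(scaling_cint (@scaling_opp R) it).2.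
  etransitivity; last exact: (cintJ it).
  apply: eq_cint => y; rewrite V_even dotNl opprK.
  by apply: complex_eq; rewrite !cReE /= ?cosN ?sinN; ring.
apply: complex_eq; last first.
  have := congr1 (@complex.Im R) IJ; rewrite ImJ => h.
  by rewrite /=; have : cIm I = 0; [lra|].
rewrite /I /cint /= /b0 /symbol -RintegralB//; last exact: integrable_symbol.
by apply: eq_Rintegral => y _; rewrite cosN; ring.
Qed.

Variables (beta N : R).
Hypothesis N_gt0 : 0 < N.
Let M := N `^ beta.
Let M_gt0 : 0 < M. Proof. exact: powR_gt0. Qed.
Let M3 : N `^ (3 * beta) = M ^+ 3.
Proof. by rewrite /M -powR_mulrn ?powR_ge0// -powRrM mulrC. Qed.

Let VM y := M ^+ 3 * V (M *: y).

Let integrable_VM : (@leb3 R).-integrable setT (fun y => (VM y)%:E).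
Proof.
have [i _] := scaling_integrable (scaling_affine 0 M_gt0) integrable_V.
under eq_fun do rewrite /VM EFinM; apply: integrableZl => //.
by have := i; under eq_fun do rewrite addr0.
Qed.

Let cint_VM xi : cint (@leb3 R) (fun y => expi (- dot y xi) * (VM y)%:C) =
  (b0 V - symbol (M^-1 *: xi))%:C.
Proof.
have it := cintble_FTu (M^-1 *: xi) (cintble_real integrable_V).
have [iS] := scaling_cint (scaling_affine 0 M_gt0) it.
rewrite cint_V => E.
have -> : (b0 V - symbol (M^-1 *: xi))%:C =
   (M ^+ 3)%:C * ((M ^- 3)%:C * (b0 V - symbol (M^-1 *: xi))%:C) :> C.
  by rewrite mulrA -RCM mulfV ?mul1r// expf_neq0// gt_eqF.
rewrite -E -cintZ//; apply: eq_cint => y.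
have -> : dot (M *: y + 0) (M^-1 *: xi) = dot y xi.
  by rewrite addr0 dotZl dotZr mulrA mulfV ?gt_eqF// mul1r.
by rewrite addr0 /VM RCM; ring.
Qed.

Definition multN xi : R := - symbol (M^-1 *: xi).

Lemma multN_bound xi : `|multN xi| <= 2 * b0 V.
Proof. by rewrite normrN ger0_norm ?symbol_ge0// symbol_le. Qed.

Lemma multN_lip xi eta : `|multN xi - multN eta| <= Vmom * M^-1 * norm1 (xi - eta).
Proof.
rewrite /multN -opprD normrN; apply: le_trans (symbol_lip _ _) _.
by rewrite -scalerBr norm1Z ger0_norm ?mulrA// invr_ge0 ltW.
Qed.

(** With [g] written as a Fourier integral, Fubini produces the transform [b0 V - symbol (xi / M)]
    of the rescaled potential. The Dirac mass cancels [b0 V] and leaves [multN]. *)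
Lemma WN_conv_Finv (K r : R) k (g : R3 R -> R) x : good K r k ->
  (forall y, (g y)%:C = Finv k y) ->
  (WN_conv beta V N g x)%:C = Finv (fun xi => (multN xi)%:C * k xi) x.
Proof.
move=> gk gE; have itk := good_cintble gk; have mk := good_cmeas gk.
have itV := cintble_real integrable_VM.
have [itVx _] := scaling_cint (scaling_refl x) itV.
have iVx := cintble_normc itVx.
pose F (z : T3 * T3) : C := (VM (x - z.1))%:C * (expi (dot z.2 z.1) * k z.2).
have mVx : cmeas (fun y : T3 => (VM (x - y))%:C : C) := cintble_meas itVx.
have itF : cintble (@leb3s R \x @leb3s R)%E F.
  have n1 : (@leb3s R).-integrable setT (fun y => (nc ((VM (x - y))%:C : C))%:E) := iVx.
  have n2 : (@leb3s R).-integrable setT (fun y => (nc (k y))%:E) := cintble_normc itk.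
  apply: (le_cintble_prod _ n1 n2).
    apply: cmeasM.
      have [mr mi] := mVx.
      split; [exact: measurableT_comp mr measurable_fst|].
      exact: measurableT_comp mi measurable_fst.
    apply: cmeasM; last by apply: cmeas_comp mk _; exact: measurable_snd.
    by apply: cmeas_expi; apply: meas_dot; [exact: measurable_snd|exact: measurable_fst].
  by move=> y xi; rewrite /F /= !Normc.normcM normc_expi mul1r.
have E1 y : cint (@leb3s R) (fun xi => F (y, xi)) =
    (VM (x - y))%:C * cint (@leb3 R) (fun xi => expi (dot xi y) * k xi).
  by rewrite -cintZ//; exact: cintble_expi_dot.
have E2 xi : cint (@leb3s R) (fun y => F (y, xi)) =
    (expi (dot xi x) * k xi) * (b0 V - symbol (M^-1 *: xi))%:C.
  have itx := cintble_FTu xi itV.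
  rewrite -cint_VM -cintZ//.
  have itz := cintbleZ (expi (dot xi x) * k xi) itx.
  have [_] := scaling_cint (scaling_refl x) itz; rewrite mul1r => <-.
  apply: eq_cint => y; rewrite [LHS]/F [(y, xi).1]/= [(y, xi).2]/=.
  have -> : - dot (x - y) xi = dot xi y + - dot xi x.
    by rewrite dotBl (dotC x) (dotC y) opprB.
  have e1 := expiNM (dot xi x); rewrite expiD.
  rewrite [RHS](_ : _ = (expi (- dot xi x) * expi (dot xi x)) *
    ((VM (x - y))%:C * (expi (dot xi y) * k xi))); last by ring.
  by rewrite e1 mul1r.
have I1 : (\int[@leb3 R]_y (N `^ (3 * beta) * V (N `^ beta *: (x - y)) * g y))%:C =
    cint (@leb3 R) (fun y => (VM (x - y))%:C * Finv k y).
  rewrite -cint_real; apply: eq_cint => y.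
  by rewrite -gE -RCM M3.
have I2 : cint (@leb3 R) (fun y => (VM (x - y))%:C * Finv k y) =
    c0%:C * cint (@leb3 R) (fun xi => (expi (dot xi x) * k xi) * (b0 V - symbol (M^-1 *: xi))%:C).
  have cF : cint (@leb3s R) (fun y => cint (@leb3s R) (fun xi => F (y, xi))) =
     cint (@leb3s R) (fun xi => cint (@leb3s R) (fun y => F (y, xi))) := cint_fubini itF.
  rewrite (eq_cint (@leb3s R) E1) (eq_cint (@leb3s R) E2) in cF.
  rewrite -[in RHS]cF.
  rewrite -[RHS](cintZ (mu := @leb3s R)).
    by apply: eq_cint => y; rewrite FinvE mulrCA.
  have := cintble_fubini1 itF; under eq_fun do rewrite E1.
  exact.
have itm : cintble (@leb3 R) (fun xi => (multN xi)%:C * k xi).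
  have gm := @good_mult _ (2 * b0 V) (Vmom * M^-1) K r multN k _ _ multN_bound multN_lip gk.
  apply: good_cintble (gm _ _).
    by rewrite mulr_ge0// b0_ge0.
  by rewrite mulr_ge0 ?Vmom_ge0// invr_ge0 ltW.
rewrite /WN_conv RCD RCN RCM I1 I2 gE !FinvE.
rewrite mulrCA -mulrBr; congr (_ * _).
have itx := cintble_expi_dot x itk; have itmx := cintble_expi_dot x itm.
rewrite -(cintZ (b0 V)%:C itx).
have E3 xi : (expi (dot xi x) * k xi) * (b0 V - symbol (M^-1 *: xi))%:C =
   (b0 V)%:C * (expi (dot xi x) * k xi) + expi (dot xi x) * ((multN xi)%:C * k xi).
  by rewrite /multN RCD; ring.
rewrite (eq_cint (@leb3 R) E3) cintD//; last exact: cintbleZ.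
by rewrite addrAC subrr add0r.
Qed.

(** Here [conv k (reflJ k)] is the transform of [|Finv k|^2], [multN] the action of [W_N], and the
    outer convolution the product with [Finv k]. *)
Definition trilinear k : R3 R -> C :=
  conv (fun xi => (multN xi)%:C * conv k (reflJ k) xi) k.

Lemma nonlinearity_Finv (K r : R) k : good K r k ->
  nonlinearity beta V N (Finv k) = Finv (trilinear k).
Proof.
move=> gk; have gJ := good_reflJ gk; have gc := good_conv gk gJ.
have gm := @good_mult _ (2 * b0 V) (Vmom * M^-1) _ _ multN _ _ _ multN_bound multN_lip gc.
apply/funext => x; rewrite /nonlinearity.
rewrite (WN_conv_Finv x gc) ?(FinvM x (gm _ _) gk)//.
- by rewrite mulr_ge0// b0_ge0.
- by rewrite mulr_ge0 ?Vmom_ge0// invr_ge0 ltW.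
move=> y; rewrite -(FinvM y gk gJ) -FinvJ; last exact: good_cintble gk.
by rewrite mulJc_normc.
Qed.

Lemma gfam_trilinear (K r : R) (k : R -> R3 R -> C) : gfam K r k ->
  exists L s, gfam L s (fun t => trilinear (k t)).
Proof.
move=> gk; have gc := gfam_conv gk (gfam_reflJ gk).
have gm := @gfam_mult _ (2 * b0 V) (Vmom * M^-1) _ _ multN _ _ _ multN_bound multN_lip gc.
have a0 : 0 <= 2 * b0 V by rewrite mulr_ge0// b0_ge0.
have l0 : 0 <= Vmom * M^-1 by rewrite mulr_ge0 ?Vmom_ge0// invr_ge0 ltW.
by eexists; eexists; exact: gfam_conv (gm a0 l0) gk.
Qed.

End Potential.

(** * A frequency at which the symbol is positive *)

Section SymbolPositive.
Context {R : realType}.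
Local Notation T1 := (measurableTypeR R).
Variable V : R3 R -> R.
Hypothesis V_ge0 : forall x, 0 <= V x.
Hypothesis V_int : (@leb3 R).-integrable setT (fun x => (japanese x * V x)%:E).

(* Wherever V > 0, some frequency makes cos (dot y .) nonpositive near y. *)
Lemma symbol_gt0 : continuous V -> (exists x, V x != 0) ->
  exists s : R, 0 < s /\ 0 < symbol V (s, 0, 0).
Proof.
move=> cV [x0 Vx0]; have V0 : 0 < V x0 by rewrite lt0r Vx0 V_ge0.
have v2 : 0 < V x0 / 2 by rewrite divr_gt0.
have /cvgrPdist_lt/(_ _ v2) := cV x0.
move=> /nbhs_ballP[e /= e0 He].
(* The first coordinate of [x0] may be 0, where no multiple of it reaches [pi]; it is moved slightly
   so as to be nonzero, staying in the ball. *)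
have [p [p0 pe]] : exists p : R, p != 0 /\ `|p - x0.1.1| < e.
  have [x00|x00] := eqVneq x0.1.1 0.
    exists (e / 2); rewrite x00 subr0 ger0_norm; last by lra.
    by split; [rewrite gt_eqF; lra|lra].
  by exists x0.1.1; rewrite subrr normr0.
have p_gt0 : 0 < `|p| by rewrite normr_gt0.
(* With [s = pi / |p|] below, [s p] is [pi] or [- pi]. The bound [|p| / 2] keeps [s y.1.1] within
   [pi / 2] of it, where cos is nonpositive; the other bound keeps the box around [c] inside the
   ball where [V] exceeds [V x0 / 2]. *)
pose d := Num.min (`|p| / 2) ((e - `|p - x0.1.1|) / 2).
have d0 : 0 < d by rewrite lt_min !divr_gt0// subr_gt0.
have dp : d <= `|p| / 2 by rewrite ge_min lexx.
have de : d <= (e - `|p - x0.1.1|) / 2 by rewrite ge_min lexx orbT.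
pose s := pi / `|p|.
have s0 : 0 < s by rewrite divr_gt0// pi_gt0.
exists s; split => //.
pose c : R3 R := (p, x0.1.2, x0.2).
have VB y : box d (y - c) -> V x0 / 2 <= V y.
  move=> [/= h1 h2 h3].
  have hb : ball x0 e y.
    split; [split|]; rewrite /ball /= distrC.
    - have := ler_normD (y.1.1 - p) (p - x0.1.1); rewrite addrA subrK; lra.
    - have := normr_ge0 (p - x0.1.1); lra.
    - have := normr_ge0 (p - x0.1.1); lra.
  have := He y hb; rewrite /= => h; have := ler_norm (V x0 - V y); lra.
have cosB y : box d (y - c) -> cos (dot y (s, 0, 0)) <= 0.
  move=> [/= h1 h2 h3]; rewrite /dot /= !mulr0 !addr0.
  have -> : y.1.1 * s = s * p + s * (y.1.1 - p) by ring.
  have cp : cos (s * p) = -1.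
    rewrite -cos_norm normrM (gtr0_norm s0) /s mulfVK ?cospi//.
    by rewrite gt_eqF.
  have sp : sin (s * p) = 0 by apply: cos1sin0; rewrite cp normrN normr1.
  rewrite cosD cp sp mul0r subr0 mulN1r oppr_le0.
  apply: cos_ge0_pihalf; rewrite -ler_norml normrM (gtr0_norm s0) /s.
  rewrite mulrAC ler_pdivrMr//.
  have := pi_gt0 R => pi0.
  have : `|y.1.1 - p| <= `|p| / 2 by exact: le_trans h1 dp.
  by move=> /(ler_wpM2l (ltW pi0)); lra.
have ib := integrable_box d.
have [ibs Ibs] := scaling_integrable (scaling_shift (- c)) (@integrable_box R d).
have low : \int[@leb3 R]_y (V x0 / 2 * \1_(box d) (y - c)) <= symbol V (s, 0, 0).
  have i1 : (@leb3 R).-integrable setT (fun y => (V x0 / 2 * \1_(box d) (y - c))%:E).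
    by under eq_fun do rewrite EFinM; exact: integrableZl.
  have i2 := integrable_symbol V_int (s, 0, 0).
  apply: (le_Rintegral measurableT i1 i2) => y _.
  rewrite indicE; have [yb|yb] := boolP (_ \in _).
    rewrite inE in yb; have := VB y yb; have := cosB y yb => h1 h2.
    rewrite mulr1; have : V y * 1 <= V y * (1 - cos (dot y (s, 0, 0))).
      by rewrite ler_wpM2l//; lra.
    lra.
  by rewrite mulr0 mulr_ge0// subr_ge0 cos_le1.
apply: lt_le_trans low; rewrite RintegralZl// Ibs mul1r Rintegral_box; last exact: ltW.
by rewrite mulr_gt0// exprn_gt0// mulr_gt0.
Qed.

End SymbolPositive.

(** * The Duhamel integral *)

Section FiniteSums.
Context d (T : measurableType d) {R : realType}.
Local Notation C := R[i].
Variable mu : {measure set T -> \bar R}.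

Lemma cintble_sum n (f : 'I_n -> T -> C) : (forall i, cintble mu (f i)) ->
  cintble mu (fun x => \sum_(i < n) f i x) /\
  cint mu (fun x => \sum_(i < n) f i x) = \sum_(i < n) cint mu (f i).
Proof.
elim: n f => [|n ih] f itf.
  under eq_fun do rewrite big_ord0; rewrite big_ord0 cint0; split => //.
  by split; exact: integrable0.
under eq_fun do rewrite big_ord_recr; rewrite big_ord_recr /=.
have [i1 e1] := ih (fun i => f (widen_ord (leqnSn n) i)) (fun i => itf _).
by split; [exact: cintbleD|rewrite cintD// e1].
Qed.

End FiniteSums.

(** * Riemann sums in time *)

Section TimeIntegral.
Context {R : realType}.
Local Notation C := R[i].
Local Notation leb := (@lebesgue_measure R).
Local Notation T1 := (measurableTypeR R).
Implicit Types (s t : R) (xi : R3 R).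

Lemma lip1_measurable (f : R -> R) (L : R) :
  (forall s t, `|f s - f t| <= L * `|s - t|) -> measurable_fun setT (f : T1 -> R).
Proof.
move=> fL; have fL' s t : `|f s - f t| <= (`|L| + 1) * `|s - t|.
  apply: le_trans (fL s t) _; rewrite ler_wpM2r//.
  by have := ler_norm L; lra.
apply: (@continuous_measurable_fun R f) => s; apply/cvgrPdist_le => e e0.
have L0 : 0 < `|L| + 1 by rewrite ltr_pwDr.
near=> t; apply: le_trans (fL' s t) _.
rewrite -ler_pdivlMl// mulrC; near: t.
by apply: cvgr_dist_le; [exact: cvg_id|rewrite divr_gt0].
Unshelve. all: by end_near. Qed.

(** Extends a family given on [[0, 1]] to all times with the same Lipschitz constant, so that
    measurability can be checked on the whole line. *)
Definition clamp t : R := Num.min (Num.max t 0) 1.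

Lemma unitI_clamp t : unitI (clamp t).
Proof. by rewrite /unitI /clamp le_min ge_min !le_max !lexx ler01 !orbT. Qed.

Lemma clamp_id t : unitI t -> clamp t = t.
Proof. by rewrite /clamp => /andP[t0 t1]; rewrite max_l// min_l. Qed.

Lemma clamp_cases s : [\/ s <= 0 /\ clamp s = 0, 0 <= s <= 1 /\ clamp s = s |
  1 <= s /\ clamp s = 1].
Proof.
rewrite /clamp; have [s0|/ltW s0] := leP s 0; first by constructor 1; rewrite min_l.
have [s1|/ltW s1] := leP s 1; first by constructor 2; rewrite s0.
by constructor 3.
Qed.

Lemma clamp_lip s t : `|clamp s - clamp t| <= `|s - t|.
Proof.
wlog st : s t / s <= t.
  move=> h; have [|/ltW] := leP s t; first exact: h.
  by rewrite distrC (distrC s); exact: h.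
rewrite distrC (distrC s) (ger0_norm (_ : 0 <= t - s)) ?subr_ge0//.
case: (clamp_cases s) => -[h1 ->]; case: (clamp_cases t) => -[h2 ->];
  rewrite ler_norml; apply/andP; split; lra.
Qed.

Definition cell t (n i : nat) : set T1 :=
  [set s | 0 <= s <= t /\ i%:R <= s * n.+1%:R < i.+1%:R].

Lemma measurable_cell t n i : measurable (cell t n i).
Proof.
rewrite (_ : cell t n i = `[0, t] `&` `[i%:R / n.+1%:R, i.+1%:R / n.+1%:R[).
  by apply: measurableI; exact: measurable_itv.
apply/seteqP; split => s /=; rewrite !in_itv /= ler_pdivrMr ?ltr_pdivlMr//.
Qed.

Lemma cell_sub t n i : cell t n i `<=` `[0, t].
Proof. by move=> s [h _]; rewrite /= in_itv. Qed.

Lemma leb_itv0 t : 0 <= t -> leb `[0, t]%classic = t%:E.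
Proof.
move=> t0; rewrite lebesgue_measure_itv /= lte_fin; case: ltgtP t0 => // [t0|<-] _ //=.
by rewrite oppr0 adde0.
Qed.

Lemma leb_cell t n i : (leb (cell t n i) < +oo)%E.
Proof.
apply: (@le_lt_trans _ _ (leb `[0, t])).
  by apply: le_measure; rewrite ?inE; [exact: measurable_cell|exact: measurable_itv|
    exact: cell_sub].
by rewrite lebesgue_measure_itv; case: ifP => // _; rewrite ltry.
Qed.

Definition grid t n : nat := Num.truncn (t * n.+1%:R).

Lemma sum_cell (G : nat -> C) t s n : unitI t -> 0 <= s <= t ->
  \sum_(i < n.+2) (\1_(cell t n i) s)%:C * G i = G (grid s n).
Proof.
move=> /andP[t0 t1] st; have /andP[s0 s1] := st.
have sn0 : 0 <= s * n.+1%:R by rewrite mulr_ge0.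
have gn : (grid s n < n.+2)%N.
  rewrite ltnS /grid truncn_le_nat; apply: (@le_lt_trans _ _ n.+1%:R).
    by rewrite ler_piMl//; lra.
  by rewrite ltr_nat.
have E i : (\1_(cell t n i) s : R) = (grid s n == i)%:R.
  rewrite indicE /grid (truncn_eq _ sn0); congr (nat_of_bool _)%:R.
  apply/idP/idP; first by rewrite inE => -[].
  by move=> h; rewrite inE; split.
rewrite (bigD1 (Ordinal gn))//= E eqxx mul1r big1 ?addr0// => i ig.
rewrite E; have -> : (grid s n == i) = false.
  by apply/negbTE; apply: contra ig => /eqP h; apply/eqP/val_inj; rewrite /= h.
by rewrite mul0r.
Qed.

Lemma grid_near s n : unitI s ->
  unitI ((grid s n)%:R / n.+1%:R : R) /\ (grid s n)%:R / n.+1%:R <= s /\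
  `|s - (grid s n)%:R / n.+1%:R| <= n.+1%:R^-1.
Proof.
move=> /andP[s0 s1]; have sn0 : 0 <= s * n.+1%:R by rewrite mulr_ge0.
have /andP[h1 h2] := truncn_itv sn0; rewrite -/(grid s n) in h1 h2.
have n0 : (0 : R) < n.+1%:R by [].
have g1 : (grid s n)%:R / n.+1%:R <= s by rewrite ler_pdivrMr.
split; first by rewrite /unitI divr_ge0//=; exact: le_trans s1.
split => //; rewrite ger0_norm ?subr_ge0//.
rewrite lerBlDl -[X in _ + X]mul1r -mulrDl ler_pdivlMr//.
by rewrite natr1 ltW.
Qed.

Variables (K r : R) (H : R -> R3 R -> C).
Hypothesis gH : gfam K r H.

Lemma gfam_diff s t xi : unitI s -> unitI t ->
  nc (H s xi - H t xi) <= K * `|s - t| * \1_(box r) xi.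
Proof.
move=> us ut; have [gk tk] := gH; rewrite indicE; have [xb|xb] := boolP (_ \in _).
  by rewrite mulr1; exact: tk.
have nb : ~ box r xi by move: xb; rewrite notin_setE.
by rewrite (good_supp (gk s us) nb) (good_supp (gk t ut) nb) subrr Normc.normc0 mulr0.
Qed.

Let K0 : 0 <= K.
Proof. by have u0 : unitI (0 : R); [rewrite /unitI lexx ler01|have [] := gH.1 0 u0]. Qed.
Let r0 : 0 <= r.
Proof. by have u0 : unitI (0 : R); [rewrite /unitI lexx ler01|have [] := gH.1 0 u0]. Qed.

Definition tslice t xi s : C := (\1_`[0, t]%classic s)%:C * H (clamp s) xi.

Definition tint t xi : C := cint leb (tslice t xi).

Lemma integrable_itv0 t : leb.-integrable setT (fun s : T1 => (\1_`[0, t]%classic s : R)%:E).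
Proof.
have mi : measurable (`[0, t]%classic : set T1) by exact: measurable_itv.
apply/integrableP; split; first by apply/measurable_EFinP; exact: measurable_indic.
under eq_integral => s _ do rewrite gee0_abs ?lee_fin//.
rewrite integral_indic// setIT; have [t0|t0] := leP 0 t.
  by apply: le_lt_trans (ltry t); rewrite -(leb_itv0 t0).
rewrite (_ : [set` _] = set0) ?measure0 ?ltry//.
by apply/seteqP; split => s //=; rewrite in_itv /= => /andP[? ?]; lra.
Qed.

Lemma Rintegral_itv0 t : 0 <= t -> \int[leb]_s \1_`[0, t]%classic (s : T1) = t.
Proof.
move=> t0; rewrite /Rintegral integral_indic ?setIT//.
by have /(congr1 fine) := leb_itv0 t0.
Qed.

Lemma cmeas_clamp xi : cmeas (fun s : T1 => H (clamp s) xi).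
Proof.
have h s t : nc (H (clamp s) xi - H (clamp t) xi) <= K * `|s - t|.
  apply: le_trans (gH.2 _ _ (unitI_clamp s) (unitI_clamp t) xi) _.
  by rewrite ler_wpM2l ?clamp_lip.
split; apply: (@lip1_measurable _ K) => s t; apply: le_trans (h s t).
  by rewrite -ReN -ReD Re_le_normc.
by rewrite -ImN -ImD Im_le_normc.
Qed.

Lemma cintble_tslice t xi : cintble leb (tslice t xi).
Proof.
apply: (@le_cintble _ T1 R leb _ (fun s => K * \1_`[0, t]%classic s)).
- apply: cmeasM; last exact: cmeas_clamp.
  by apply: cmeas_real; apply: measurable_indic; exact: measurable_itv.
- by under eq_fun do rewrite EFinM; apply: integrableZl => //; exact: integrable_itv0.
- move=> s; rewrite /tslice Normc.normcM normc_real ger0_norm// mulrC ler_wpM2r//.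
  exact: good_bound (gH.1 _ (unitI_clamp s)) _.
Qed.

Lemma tint_bound t xi : 0 <= t -> nc (tint t xi) <= t * K * \1_(box r) xi.
Proof.
move=> t0; have i0 := integrable_itv0 t.
have iK : leb.-integrable setT (fun s : T1 => (K * \1_(box r) xi * \1_`[0, t]%classic s)%:E).
  by under eq_fun do rewrite EFinM; exact: integrableZl.
apply: le_trans (le_normc_cint_bound (cintble_tslice t xi) iK _) _.
  move=> s; rewrite /tslice Normc.normcM normc_real ger0_norm// mulrC ler_wpM2r//.
  by have [_ _ _] := gH.1 _ (unitI_clamp s); exact.
rewrite RintegralZl// Rintegral_itv0//.
by rewrite [leLHS](_ : _ = t * K * \1_(box r) xi)//; ring.
Qed.

Lemma good_tint t : 0 <= t -> good (t * K) r (tint t).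
Proof.
move=> t0; split => //; [exact: mulr_ge0| |by move=> xi; exact: tint_bound].
move=> x y; have ix := cintble_tslice t x; have iy := cintble_tslice t y.
rewrite /tint -cintB//; have i0 := integrable_itv0 t.
have iK : leb.-integrable setT (fun s : T1 => (K * norm1 (x - y) * \1_`[0, t]%classic s)%:E).
  by under eq_fun do rewrite EFinM; exact: integrableZl.
apply: le_trans (le_normc_cint_bound (cintbleB ix iy) iK _) _.
  move=> s; rewrite /tslice -mulrBr Normc.normcM normc_real ger0_norm// mulrC ler_wpM2r//.
  by have [_ _ + _] := gH.1 _ (unitI_clamp s); exact.
rewrite RintegralZl// Rintegral_itv0//.
by rewrite [leLHS](_ : _ = t * K * norm1 (x - y))//; ring.
Qed.

Definition rsum t n xi : C :=
  \sum_(i < n.+2) (fine (leb (cell t n i)))%:C * H (i%:R / n.+1%:R) xi.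

Lemma integrable_cell t n i : leb.-integrable setT (fun s : T1 => (\1_(cell t n i) s : R)%:E).
Proof.
have mi := measurable_cell t n i.
apply/integrableP; split; first by apply/measurable_EFinP; exact: measurable_indic.
under eq_integral => s _ do rewrite gee0_abs ?lee_fin//.
by rewrite integral_indic// setIT leb_cell.
Qed.

Lemma cint_cell t n i (c : C) :
  cintble leb (fun s : T1 => (\1_(cell t n i) s)%:C * c) /\
  cint leb (fun s : T1 => (\1_(cell t n i) s)%:C * c) = (fine (leb (cell t n i)))%:C * c.
Proof.
have it := cintble_real (integrable_cell t n i).
under eq_fun do rewrite mulrC; split; first exact: cintbleZ.
rewrite cintZ// cint_real mulrC; congr (_%:C * _).
by rewrite /Rintegral integral_indic ?setIT//; exact: measurable_cell.
Qed.

(** Every time is within [1 / (n + 1)] of its grid point, so the integrands differ by [K / (n + 1)]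
    on the box; the interval has length at most 1. *)
Lemma tint_rsum t n xi : unitI t ->
  nc (tint t xi - rsum t n xi) <= K / n.+1%:R * \1_(box r) xi.
Proof.
move=> ut; have /andP[t0 t1] := ut; have i0 := integrable_itv0 t.
pose Y (s : T1) := \sum_(i < n.+2) (\1_(cell t n i) s)%:C * H (i%:R / n.+1%:R) xi.
have [iY EY] := cintble_sum (fun i : 'I_n.+2 => (cint_cell t n i (H (i%:R / n.+1%:R) xi)).1).
have EY' : cint leb Y = rsum t n xi.
  by rewrite EY; apply: eq_bigr => i _; rewrite (cint_cell _ _ _ _).2.
rewrite -EY' /tint -cintB//; last exact: cintble_tslice.
have iK : leb.-integrable setT
    (fun s : T1 => (K / n.+1%:R * \1_(box r) xi * \1_`[0, t]%classic s)%:E).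
  by under eq_fun do rewrite EFinM; exact: integrableZl.
apply: le_trans (le_normc_cint_bound (cintbleB (cintble_tslice t xi) iY) iK _) _.
  move=> s; rewrite /tslice indicE; have [sin|sin] := boolP (s \in _).
    have st : 0 <= s <= t by move: sin; rewrite inE /= in_itv.
    have us : unitI s by move: st => /andP[? ?]; apply/andP; split => //; exact: le_trans t1.
    rewrite (sum_cell (fun i => H (i%:R / n.+1%:R) xi))// mul1r mulr1 clamp_id//.
    have [ug [_ gn]] := grid_near n us.
    by apply: le_trans (gfam_diff xi us ug) _; rewrite ler_wpM2r// ler_wpM2l.
  rewrite mul0r mulr0 sub0r normcN /Y big1 ?Normc.normc0// => i _.
  rewrite indicE memNset ?mul0r//.
  by move=> /cell_sub h; move: sin; rewrite notin_setE.
rewrite RintegralZl// Rintegral_itv0// ler_piMr//.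
by rewrite mulr_ge0// divr_ge0.
Qed.

End TimeIntegral.

(** * Bochner integrals of inverse transforms *)

Section BochnerFinv.
Context {R : realType}.
Local Notation C := R[i].
Local Notation leb := (@lebesgue_measure R).
Local Notation T1 := (measurableTypeR R).
Local Notation T3 := (T1 * T1 * T1)%type.
Implicit Types (s t : R) (x xi : R3 R) (a b k : R3 R -> C).

(** The L^2 norm of the indicator of [box r]. *)
Definition sqbox r : R := ((2 * r) ^+ 3) `^ 2^-1.

Lemma L2norm_box (f : R3 R -> C) (D r : R) : cmeas (f : T3 -> C) -> 0 <= D -> 0 <= r ->
  (forall x, nc (f x) <= D * \1_(box r) x) -> (L2norm f <= (D * sqbox r)%:E)%E.
Proof.
move=> mf D0 r0 fD; rewrite L2normE.
have -> : (D * sqbox r)%:E = ((D ^+ 2 * (2 * r) ^+ 3)%:E `^ 2^-1)%E.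
  rewrite poweR_EFin powRM ?sqr_ge0 ?exprn_ge0 ?mulr_ge0//.
  by rewrite -powR_mulrn// -powRrM mulfV// powRr1.
apply: gt0_ler_poweR; rewrite ?in_itv/= ?leey ?sqint_ge0//.
  by rewrite lee_fin mulr_ge0 ?sqr_ge0 ?exprn_ge0 ?mulr_ge0.
exact: sqint_bound.
Qed.

Lemma FinvZ (c : C) k x : cintble (@leb3 R) k ->
  Finv (fun xi => c * k xi) x = c * Finv k x.
Proof.
move=> ik; have ix := cintble_expi_dot x ik; rewrite !FinvE mulrCA -(cintZ c ix).
by congr (_ * _); apply: eq_cint => xi; rewrite mulrCA.
Qed.

Lemma FinvB a b x : cintble (@leb3 R) a -> cintble (@leb3 R) b ->
  Finv (fun xi => a xi - b xi) x = Finv a x - Finv b x.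
Proof.
move=> ia ib; have iax := cintble_expi_dot x ia; have ibx := cintble_expi_dot x ib.
rewrite !FinvE -mulrBr -cintB//.
by congr (_ * _); apply: eq_cint => xi; rewrite mulrBr.
Qed.

Lemma Finv_sum n (a : 'I_n -> R3 R -> C) x : (forall i, cintble (@leb3 R) (a i)) ->
  Finv (fun xi => \sum_(i < n) a i xi) x = \sum_(i < n) Finv (a i) x.
Proof.
move=> ia; have iax i := cintble_expi_dot x (ia i).
rewrite FinvE; under eq_bigr do rewrite FinvE; rewrite -mulr_sumr.
by rewrite -(cintble_sum iax).2; congr (_ * _); apply: eq_cint => xi; rewrite mulr_sumr.
Qed.

Lemma L2norm_FinvB a b (D r : R) : cintble (@leb3 R) a -> cintble (@leb3 R) b ->
  0 <= D -> 0 <= r -> (forall xi, nc (a xi - b xi) <= D * \1_(box r) xi) ->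
  (L2norm (Finv a \- Finv b) <= (D * sqbox r)%:E)%E.
Proof.
move=> ia ib D0 r0 abD.
have -> : Finv a \- Finv b = Finv (fun xi => a xi - b xi).
  by apply/funext => x; rewrite FinvB.
have iab := cintbleB ia ib.
apply: le_trans (L2norm_sqint_le (sqint_Finv iab)) _.
by apply: L2norm_box => //; exact: cintble_meas iab.
Qed.

Variables (K r : R) (H : R -> R3 R -> C).
Hypothesis gH : gfam K r H.

Let u0 : unitI (0 : R). Proof. by rewrite /unitI lexx ler01. Qed.
Let K0 : 0 <= K. Proof. by have [] := gH.1 0 u0. Qed.
Let r0 : 0 <= r. Proof. by have [] := gH.1 0 u0. Qed.
Let itH s : unitI s -> cintble (@leb3 R) (H s).
Proof. by move=> us; exact: good_cintble (gH.1 s us). Qed.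
Let mFH s : unitI s -> cmeas (Finv (H s) : T3 -> C).
Proof. by move=> us; exact: cmeas_Finv (itH us). Qed.

Lemma L2norm_gfam s t : unitI s -> unitI t ->
  (L2norm (Finv (H s) \- Finv (H t)) <= (K * `|s - t| * sqbox r)%:E)%E.
Proof.
move=> us ut; apply: L2norm_FinvB; rewrite ?mulr_ge0//; try exact: itH.
by move=> xi; have := gfam_diff gH xi us ut.
Qed.

Lemma fin_L2norm_gfam s t : unitI s -> unitI t ->
  L2norm (Finv (H s) \- Finv (H t)) \is a fin_num.
Proof.
move=> us ut; rewrite ge0_fin_numE ?L2norm_ge0//.
by apply: le_lt_trans (L2norm_gfam us ut) _; rewrite ltry.
Qed.

(** By the triangle inequality the function is Lipschitz in [s]. *)
Lemma measurable_L2norm_gfam t : unitI t ->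
  measurable_fun setT (fun s : T1 => L2norm (Finv (H (clamp s)) \- Finv (H t))).
Proof.
move=> ut.
pose g s := fine (L2norm (Finv (H (clamp s)) \- Finv (H t))).
have gE s : L2norm (Finv (H (clamp s)) \- Finv (H t)) = (g s)%:E.
  by rewrite /g fineK// fin_L2norm_gfam//; exact: unitI_clamp.
under eq_fun do rewrite gE; apply/measurable_EFinP.
have h s s' : g s - g s' <= K * sqbox r * `|s - s'|.
  have us := unitI_clamp s; have us' := unitI_clamp s'.
  rewrite lerBlDr -lee_fin EFinD -!gE.
  apply: le_trans (L2norm_triB (mFH us) (mFH ut) (mFH us')) _.
  rewrite leeD2r//; apply: le_trans (L2norm_gfam us us') _.
  by rewrite lee_fin mulrAC ler_wpM2l ?mulr_ge0 ?powR_ge0 ?clamp_lip.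
apply: (@lip1_measurable _ _ (K * sqbox r)) => s s'.
by rewrite ler_norml (h s s') lerNl opprB (distrC s) (h s' s).
Qed.

Lemma unitI_grid (n i : nat) : (i < n.+2)%N -> unitI (i%:R / n.+1%:R : R).
Proof.
by move=> iN; rewrite /unitI divr_ge0//= ler_pdivrMr// mul1r ler_nat.
Qed.

Lemma cintble_rsum t n : cintble (@leb3 R) (rsum H t n).
Proof.
have i1 (i : 'I_n.+2) : cintble (@leb3 R) (fun xi =>
    (fine (leb (cell t n i)))%:C * H (i%:R / n.+1%:R) xi).
  by apply: cintbleZ; apply: itH; exact: unitI_grid.
exact: (cintble_sum i1).1.
Qed.

Lemma Finv_rsum t n x : Finv (rsum H t n) x =
  \sum_(i < n.+2) (fine (leb (cell t n i)))%:C * Finv (H (i%:R / n.+1%:R)) x.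
Proof.
have it (i : 'I_n.+2) := itH (unitI_grid (ltn_ord i)).
rewrite (Finv_sum (a := fun i xi => (fine (leb (cell t n i)))%:C * H (i%:R / n.+1%:R) xi)).
  by apply: eq_bigr => i _; rewrite FinvZ.
by move=> i; exact: cintbleZ.
Qed.

Lemma cvg_divn (c : R) : ((c / n.+1%:R)%:E @[n --> \oo] --> 0%E).
Proof.
apply: cvg_EFin; first exact: nearW.
have := cvgM (cvg_cst c) (@cvg_harmonic R).
by rewrite mulr0; exact.
Qed.

(** The simple functions take the value of the family at the grid point of each cell. Both errors
    are [O(1/n)]: that of the integrand by Lipschitz dependence on time, that of the integral by
    [tint_rsum], each carried over by the contraction. *)
Lemma is_bochner_Finv t : unitI t ->
  is_bochner `[0, t] (fun s => Finv (H s)) (Finv (tint H t)).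
Proof.
move=> ut; have /andP[t0 t1] := ut; have gT := good_tint gH t0.
split; first by have [] := is_fourier_Finv gT.
(* The L^2 clause of [is_bochner] concerns every [i], including grid points beyond 1, hence the
   clamped time. *)
pose u (n i : nat) := Finv (H (clamp (i%:R / n.+1%:R))).
exists (fun n => n.+2), (cell t), u => step int_step.
have uI s : 0 <= s <= t -> unitI s.
  by move=> /andP[s0 st]; rewrite /unitI s0 (le_trans st).
have stepE n s : 0 <= s <= t -> step n s = u n (grid s n).
  by move=> st; apply/funext => x; rewrite /step (sum_cell (fun i => u n i x)).
have stepE' n s : 0 <= s <= t -> step n s = Finv (H ((grid s n)%:R / n.+1%:R)).
  move=> st; have [h _] := grid_near n (uI s st).
  by rewrite stepE// /u clamp_id.
(* On each cell the step function is constant in time, so measurability is checked cell by cell. *)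
have mstep n : measurable_fun (`[0, t]%classic : set T1)
    (fun s => L2norm (Finv (H s) \- step n s)).
  have -> : (`[0, t]%classic : set T1) = \bigcup_i cell t n i.
    apply/seteqP; split => s /=.
      rewrite in_itv /= => st; exists (grid s n) => //; split => //.
      by apply: truncn_itv; rewrite mulr_ge0//; case/andP: st.
    by case=> i _ /cell_sub.
  apply/measurable_fun_bigcup => [i|i]; first exact: measurable_cell.
  apply: (eq_measurable_fun (fun s : T1 => L2norm (Finv (H (clamp s)) \- u n i))).
    move=> s; rewrite inE => -[st si]; rewrite (stepE _ _ st) (clamp_id (uI _ st)).
    by rewrite /grid (truncn_def si).
  apply: measurable_funTS; apply: measurable_L2norm_gfam; exact: unitI_clamp.
split => //.
- move=> n i; split; [exact: measurable_cell|exact: cell_sub|exact: leb_cell|].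
  by have [] := is_fourier_Finv (gH.1 _ (unitI_clamp (i%:R / n.+1%:R))).
- have sq : \forall n \near \oo,
    (0 <= \int[leb]_(s in (`[0%R, t]%classic : set T1)) L2norm (Finv (H s) \- step n s)%R <=
      ((K * sqbox r * t) / n.+1%:R)%:E)%E.
    apply: nearW => n; apply/andP; split.
      by apply: integral_ge0 => s _; exact: L2norm_ge0.
    apply: (@le_trans _ _ (\int[leb]_(s in (`[0%R, t]%classic : set T1))
        (K * n.+1%:R^-1 * sqbox r)%:E)%E).
      apply: ge0_le_integral => //.
      - by move=> s _; exact: L2norm_ge0.
      - move=> s; rewrite /= in_itv /= => st.
        have us := uI s st; have [ug [_ gn]] := grid_near n us.
        rewrite stepE'//; apply: le_trans (L2norm_gfam us ug) _.
        by rewrite lee_fin ler_wpM2r ?powR_ge0// ler_wpM2l.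
    rewrite integral_cst//.
    have e : lebesgue_measure (`[0%R, t]%classic : set T1) = t%:E := leb_itv0 t0.
    rewrite [X in (_ * X)%E]e -EFinM lee_fin.
    by rewrite [leLHS](_ : _ = K * sqbox r * t / n.+1%:R)//; ring.
  exact: (squeeze_cvge sq (cvg_cst 0%E) (cvg_divn _)).
- have sq : \forall n \near \oo, (0 <= L2norm (Finv (tint H t) \- int_step n) <=
      ((K * sqbox r) / n.+1%:R)%:E)%E.
    apply: nearW => n; rewrite L2norm_ge0/=.
    have -> : int_step n = Finv (rsum H t n).
      apply/funext => x; rewrite Finv_rsum; apply: eq_bigr => i _.
      by rewrite /u clamp_id//; exact: unitI_grid.
    rewrite mulrAC; apply: L2norm_FinvB => //.
    - exact: good_cintble gT.
    - exact: cintble_rsum.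
    - by rewrite divr_ge0.
    - by move=> xi; exact: tint_rsum.
  exact: (squeeze_cvge sq (cvg_cst 0%E) (cvg_divn _)).
Qed.

End BochnerFinv.

(** * The free evolution and the Duhamel term as explicit inverse transforms *)

Section Duhamel.
Context {R : realType}.
Local Notation C := R[i].
Local Notation T1 := (measurableTypeR R).
Implicit Types (s t : R) (x xi : R3 R).

Lemma gfam_cphase (c K r : R) (H : R -> R3 R -> C) : gfam K r H ->
  gfam (K + 12 * `|c| * r * K) r (fun s xi => expi (c * dot xi xi) * H s xi).
Proof.
move=> [gk tk]; split; first by move=> s us; exact: good_phase (gk s us).
move=> s t us ut xi; rewrite -mulrBr Normc.normcM normc_expi mul1r.
apply: le_trans (tk s t us ut xi) _; rewrite ler_wpM2r// lerDl.
by have [K0 r0 _ _] := gk s us; rewrite !mulr_ge0.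
Qed.

Variable V : R3 R -> R.
Hypothesis V_ge0 : forall x, 0 <= V x.
Hypothesis V_even : forall x, V (- x) = V x.
Hypothesis V_int : (@leb3 R).-integrable setT (fun x => (japanese x * V x)%:E).
Variables (beta N : R).
Hypothesis N_gt0 : 0 < N.
Variables (K r : R) (fh : R3 R -> C).
Hypothesis gf : good K r fh.

Definition evol t xi : C := expi (- (t * dot xi xi)) * fh xi.

Lemma good_evol t : exists L, good L r (evol t).
Proof.
have := good_phase (- t) gf; set L := (X in good X) => h; exists L.
by move: h; congr good; apply/funext => xi; rewrite mulNr.
Qed.

Lemma gfam_evol : exists L, gfam L r evol.
Proof.
have n1 : `|-1 : R| <= 1 by rewrite normrN normr1.
have := gfam_phase n1 (gfam_cst gf); set L := (X in gfam X) => h; exists L.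
by move: h; congr gfam; apply/funext => t; apply/funext => xi; rewrite mulN1r mulNr.
Qed.

Lemma is_schrodinger_evol t : is_schrodinger t (Finv fh) (Finv (evol t)).
Proof.
exists fh; split; first exact: is_fourier_Finv gf.
by have [L gL] := good_evol t; exact: is_fourier_Finv gL.
Qed.

(* The Fourier transform of the Duhamel integrand, with the phase
   e^{-it|xi|^2} removed. *)
Definition profile s xi : C :=
  expi (s * dot xi xi) * trilinear V beta N (evol s) xi.

Lemma gfam_profile : exists L s, gfam L s profile.
Proof.
have [L gL] := gfam_evol.
have [L' [s gE]] := gfam_trilinear V_ge0 V_int beta N_gt0 gL.
have n1 : `|1 : R| <= 1 by rewrite normr1.
have := gfam_phase n1 gE; set L'' := (X in gfam X) => h; exists L'', s.
by move: h; congr gfam; apply/funext => t; apply/funext => xi; rewrite mul1r.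
Qed.

Definition duhamel_hat t xi : C := expi (- (t * dot xi xi)) * tint profile t xi.

Lemma good_duhamel_hat t : 0 <= t -> exists L s, good L s (duhamel_hat t).
Proof.
move=> t0; have [L [s gE]] := gfam_profile.
have := good_phase (- t) (good_tint gE t0); set L' := (X in good X) => h; exists L', s.
by move: h; congr good; apply/funext => xi; rewrite mulNr.
Qed.

(** The multiplier of the propagator over [t - t'] splits: the factor in [t] leaves the time
    integral and the factor in [t'] is the phase contained in [profile]. *)
Lemma is_duhamel_Finv t : unitI t ->
  is_duhamel (fun t' => nonlinearity beta V N (Finv (evol t'))) t (Finv (duhamel_hat t)).
Proof.
move=> ut; have /andP[t0 t1] := ut; have [L [s gE]] := gfam_profile.
have gP := gfam_cphase (- t) gE.
exists (fun t' => Finv (fun xi => expi (- t * dot xi xi) * profile t' xi)); split.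
  move=> t'; rewrite in_itv /= => /andP[t'0 t't].
  have ut' : unitI t' by rewrite /unitI t'0 (le_trans t't).
  have [L0 g0] := good_evol t'.
  have [L1 ge] := gfam_evol.
  have [L2 [s2 gt]] := gfam_trilinear V_ge0 V_int beta N_gt0 ge.
  exists (trilinear V beta N (evol t')); split.
    rewrite (nonlinearity_Finv V_ge0 V_even V_int beta N_gt0 g0).
    exact: is_fourier_Finv (gt.1 t' ut').
  have := is_fourier_Finv (gP.1 t' ut'); congr is_fourier.
  apply/funext => xi; rewrite /profile mulrA -expiD; congr (expi _ * _).
  by ring.
have -> : duhamel_hat t = tint (fun s xi => expi (- t * dot xi xi) * profile s xi) t.
  apply/funext => xi; rewrite /duhamel_hat /tint -mulNr -cintZ; last exact: (cintble_tslice gE).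
  by apply: eq_cint => u; rewrite /tslice mulrCA.
exact: (is_bochner_Finv gP ut).
Qed.

End Duhamel.

(** * The lower bound *)

Section L2Duality.
Context {R : realType}.
Local Notation C := R[i].
Local Notation leb := (@lebesgue_measure R).
Local Notation T1 := (measurableTypeR R).
Local Notation T3 := (T1 * T1 * T1)%type.
Implicit Types (x xi : R3 R) (f : R3 R -> C).

Lemma cauchy_schwarz (w : R3 R -> R) f : measurable_fun setT (w : T3 -> R) ->
  cmeas (f : T3 -> C) -> cintble (@leb3 R) (fun x => (w x)%:C * f x) ->
  ((nc (cint (@leb3 R) (fun x => (w x)%:C * f x)))%:E <=
    L2norm (fun x => (w x)%:C) * L2norm f)%E.
Proof.
move=> mw mf it; have mwC := cmeas_real mw.
have h2 : (2^-1 + 2^-1 = 1 :> R) by lra.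
have := @hoelder _ _ _ (@leb3 R) (fun x => nc (w x)%:C) (fun x => nc (f x)) 2 2
  (measurable_normc mwC) (measurable_normc mf) _ _ h2.
move=> /(_ _ _) H; apply: le_trans (H _ _) => //.
rewrite Lnorm1; apply: (@le_trans _ _ (\int[@leb3 R]_x nc ((w x)%:C * f x))%:E).
  by rewrite lee_fin le_normc_cint.
rewrite integrable_fineE; last exact: cintble_normc.
rewrite le_eqVlt; apply/orP; left; apply/eqP; apply: eq_integral => x _.
by rewrite /= Normc.normcM ger0_norm// mulr_ge0 ?normc_ge0.
Qed.

Lemma L2normZ (c : R) f : 0 <= c -> cmeas (f : T3 -> C) ->
  L2norm (fun x => c%:C * f x) = (c%:E * L2norm f)%E.
Proof.
move=> c0 mf; rewrite !L2normE sqintZ// poweRM ?sqint_ge0 ?lee_fin ?sqr_ge0//.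
by rewrite poweR_EFin -powR_mulrn// -powRrM mulfV// powRr1.
Qed.

Lemma L2norm_shift f b : cmeas (f : T3 -> C) ->
  L2norm (fun x => f (x + b)) = L2norm f.
Proof.
move=> mf; rewrite !L2normE; congr (_ `^ _)%E.
have [_ _ h] := scaling_shift b.
have := h (fun x => (nc (f x) ^+ 2)%:E) (measurable_sqnc mf) _.
by rewrite mul1e; apply => x; rewrite lee_fin sqr_ge0.
Qed.

(** If [B] exceeded the norm, [[a, b]] would lie in the null set where [|g|] exceeds its essential
    supremum, but it has measure [b - a > 0]. *)
Lemma Lnorm_oo_ge (g : R -> \bar R) (a b : R) (B : \bar R) : 0 <= a -> a < b -> b <= 1 ->
  (0 <= B)%E -> (forall t, a <= t <= b -> (B <= g t)%E) ->
  (B <= Lnorm leb +oo (g \_ `[0%R, 1%R]%classic)%R)%E.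
Proof.
move=> a0 ab b1 B0 gB.
have lab : leb (`[a, b]%classic : set T1) = (b - a)%:E.
  by rewrite lebesgue_measure_itv /= lte_fin ab -EFinB.
have mab : measurable (`[a, b]%classic : set T1) by exact: measurable_itv.
have T0 : (0 < leb [set: T1])%E.
  apply: (@lt_le_trans _ _ (leb (`[a, b]%classic : set T1))).
    by rewrite lab lte_fin subr_gt0.
  by apply: le_measure => //; rewrite inE.
rewrite unlock T0 leNgt; apply/negP => /= sB.
have := ess_sup_ge leb (abse \o (g \_ `[0%R, 1%R]%classic)%R).
move=> /negligibleS H.
have /H : (`[a, b]%classic : set T1) `<=` ~` [set t : T1 |
    (`|(g \_ `[0%R, 1%R]%classic)%R t| <= ess_sup leb (abse \o (g \_ `[0%R, 1%R]%classic)%R))%E].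
  move=> t /=; rewrite in_itv /= => /andP[ta tb]; apply/negP; rewrite -ltNge.
  apply: (lt_le_trans sB); rewrite patchE mem_set /=; last first.
    by rewrite in_itv /=; lra.
  apply: le_trans (gB t _) _; first by rewrite ta tb.
  exact: lee_abs.
move=> /negligibleP; rewrite -/(measurable _) => /(_ mab) l0.
by move: lab; rewrite l0 => -[/eqP]; rewrite eq_sym subr_eq0 gt_eqF.
Qed.

End L2Duality.

(** * The bump and the two-bump datum *)

Section Bump.
Context {R : realType}.
Local Notation C := R[i].
Local Notation T1 := (measurableTypeR R).
Local Notation T3 := (T1 * T1 * T1)%type.
Implicit Types (x xi c : R3 R).

(** A tent: Lipschitz with compact support is all that [good] asks for, and the constants are
    explicit. *)
Definition bump x : R := Num.max 0 (1 - norm1 x).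

Lemma bump_ge0 x : 0 <= bump x. Proof. by rewrite le_max lexx. Qed.

Lemma bump_le1 x : bump x <= 1.
Proof. by rewrite ge_max ler01/= gerBl norm1_ge0. Qed.

Lemma bump_lip x y : `|bump x - bump y| <= norm1 (x - y).
Proof.
have h u v : bump u - bump v <= norm1 (u - v).
  have := norm1D (v - u) u; rewrite subrK norm1B => h1.
  have h2 : 1 - norm1 v <= bump v by rewrite le_max lexx orbT.
  rewrite {1}/bump; case: (leP 0 (1 - norm1 u)) => _; first by lra.
  by rewrite sub0r; have := bump_ge0 v; have := norm1_ge0 (u - v); lra.
by rewrite ler_norml (h x y) andbT; have := h y x; rewrite norm1B; lra.
Qed.

Lemma bump_supp x : bump x != 0 -> norm1 x <= 1 /\ box 1 x.
Proof.
move=> b0; have n1 : norm1 x <= 1.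
  rewrite leNgt; apply/negP => n1; move/eqP: b0; apply.
  by rewrite /bump max_l// subr_le0 ltW.
split => //; have := n1; rewrite /norm1.
have := normr_ge0 x.1.1; have := normr_ge0 x.1.2; have := normr_ge0 x.2.
by move=> *; split; lra.
Qed.

Lemma bump_box x : bump x <= \1_(box 1) x.
Proof.
have [->|/bump_supp[_ h]] := eqVneq (bump x) 0; first by rewrite indicE ler0n.
by rewrite indicE mem_set// bump_le1.
Qed.

Lemma bump_half x : box (1 / 6) x -> 1 / 2 <= bump x.
Proof.
move=> /box_norm1 h; rewrite le_max; apply/orP; right; lra.
Qed.

Lemma measurable_bump c : measurable_fun setT (fun x : T3 => bump ((x : R3 R) - c)).
Proof.
apply: (@lip_measurable _ _ 1) => x y; rewrite mul1r.
by apply: le_trans (bump_lip _ _) _; rewrite opprB addrA subrK.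
Qed.

Lemma good_real (u : R3 R -> R) (K r : R) : 0 <= K -> 0 <= r ->
  (forall x y, `|u x - u y| <= K * norm1 (x - y)) ->
  (forall x, `|u x| <= K * \1_(box r) x) -> good K r (fun x => (u x)%:C).
Proof.
move=> K0 r0 uL ub; split => // [x y|x]; last by rewrite normc_real.
by rewrite -RCN -RCD normc_real.
Qed.

Definition twobump (kappa delta : R) c x : R := kappa * (bump x + delta * bump (x - c)).

Lemma twobump_ge0 (kappa delta : R) c x : 0 <= kappa -> 0 <= delta ->
  0 <= twobump kappa delta c x.
Proof. by move=> k0 d0; rewrite mulr_ge0 ?addr_ge0 ?mulr_ge0 ?bump_ge0. Qed.

Lemma good_twobump (kappa delta : R) c : 0 <= kappa -> 0 <= delta ->
  good (kappa * (1 + delta)) (norm1 c + 1) (fun x => (twobump kappa delta c x)%:C).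
Proof.
move=> k0 d0; have c0 := norm1_ge0 c.
apply: good_real; [by rewrite mulr_ge0 ?addr_ge0|by rewrite addr_ge0| move=> x y|move=> x].
  rewrite /twobump -mulrBr normrM (ger0_norm k0) -mulrA ler_wpM2l//.
  rewrite [X in `|X|](_ : _ = (bump x - bump y) + delta * (bump (x - c) - bump (y - c)));
    last by ring.
  apply: le_trans (ler_normD _ _) _; rewrite mulrDl mul1r lerD ?bump_lip//.
  rewrite normrM (ger0_norm d0) ler_wpM2l//; apply: le_trans (bump_lip _ _) _.
  by rewrite opprB addrA subrK.
rewrite ger0_norm ?twobump_ge0// /twobump -mulrA ler_wpM2l//.
have b1 : bump x <= \1_(box (norm1 c + 1)) x.
  by apply: le_trans (bump_box x) _; apply: indic_box_le; lra.
rewrite mulrDl mul1r lerD// ler_wpM2l//.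
have [->|/bump_supp[n1 _]] := eqVneq (bump (x - c)) 0; first by rewrite indicE ler0n.
rewrite indicE mem_set ?bump_le1//.
have := norm1D (x - c) c; rewrite subrK {1}/norm1 => h.
have := normr_ge0 x.1.1; have := normr_ge0 x.1.2; have := normr_ge0 x.2.
by move=> *; split; lra.
Qed.

End Bump.

(** * Lower bound for the profile near the high frequency *)

Section Positivity.
Context {R : realType}.
Local Notation C := R[i].
Local Notation T1 := (measurableTypeR R).
Local Notation T3 := (T1 * T1 * T1)%type.
Implicit Types (x y z w xi : R3 R).
Local Notation c0 := ((2 * pi) `^ (- (3 / 2)) : R).
(* The sum of three points of box a lies in box (1 / 6), where the bump is at
   least 1 / 2. *)
Local Notation a := (1 / 18 : R).

Lemma R3_eq x y : x.1.1 = y.1.1 -> x.1.2 = y.1.2 -> x.2 = y.2 -> x = y.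
Proof. by case: x y => [[? ?] ?] [[? ?] ?] /= -> -> ->. Qed.

Lemma norm1B_le x y z : norm1 (x - z) <= norm1 (x - y) + norm1 (y - z).
Proof. by have := norm1D (x - y) (y - z); rewrite addrA subrK. Qed.

Lemma ReZ (u : R) (v : C) : cRe (u%:C * v) = u * cRe v.
Proof. by rewrite ReM /= mul0r subr0. Qed.

Section Phase.
Variables (kappa delta : R) (c : R3 R).
Hypothesis c_ge6 : 6 <= norm1 c.
Local Notation g := (twobump kappa delta c).
Local Notation c1 := (norm1 c).

Lemma twobump_supp x : g x != 0 -> norm1 x <= 1 \/ norm1 (x - c) <= 1.
Proof.
rewrite /twobump => g0; have [b0|/bump_supp[? _]] := eqVneq (bump x) 0; last by left.
have [b1|/bump_supp[? _]] := eqVneq (bump (x - c)) 0; last by right.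
by move: g0; rewrite b0 b1 mulr0 addr0 mulr0 eqxx.
Qed.

(* On the support of the integrand, z and -w lie near 0 or near c, and so does
   xi - z - w; since xi is near c, at most one of z and -w is near c. *)
Lemma phase_bound xi z w : bump (xi - c) != 0 -> g z != 0 -> g (xi - z - w) != 0 ->
  g (- w) != 0 -> `|2 * dot (xi - z) (z + w)| <= 10 * c1.
Proof.
move=> /bump_supp[nxi _] /twobump_supp nz /twobump_supp ny /twobump_supp nw.
rewrite normrM (ger0_norm (ler0n _ _)); have c6 := c_ge6.
(* The two cases below give [4 c1 + 8] and [8 c1 + 8], both at most [10 c1] since [c1 >= 6]. *)
have bd (A B : R) : norm1 (xi - z) <= A -> norm1 (z + w) <= B -> 2 * (A * B) <= 10 * c1 ->
    2 * `|dot (xi - z) (z + w)| <= 10 * c1.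
  move=> hA hB; apply: le_trans; rewrite ler_wpM2l//; apply: le_trans (abs_dot _ _) _.
  by rewrite ler_pM ?norm1_ge0.
have e0 x : norm1 x = norm1 (x - 0) by rewrite subr0.
case: nz => nz.
  case: nw => nw.
    apply: (bd (c1 + 2) 2); last by lra.
      have := norm1D (xi - c) (c - z); rewrite addrA subrK => h.
      have := norm1D c (- z); rewrite norm1N; lra.
    have := norm1D z w; rewrite -(norm1N w); lra.
  (* [z] near 0 and [- w] near [c] would put [xi - z - w] within 3 of [2 c], outside both bumps. *)
  exfalso; have h1 : norm1 ((xi - z - w) - (c + c)) <= 3.
    have -> : (xi - z - w) - (c + c) = (xi - c) + (- z + (- w - c)).
      by apply: R3_eq => /=; ring.
    have := norm1D (xi - c) (- z + (- w - c)); have := norm1D (- z) (- w - c).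
    rewrite norm1N; lra.
  have n2 : norm1 (c + c) = 2 * c1 by rewrite -mulr2n -scaler_nat norm1Z ger0_norm//.
  case: ny => ny.
    have := norm1D ((c + c) - (xi - z - w)) (xi - z - w); rewrite subrK (norm1B (c + c)) n2; lra.
  have := norm1D ((c + c) - (xi - z - w)) (xi - z - w - c).
  have -> : ((c + c) - (xi - z - w)) + (xi - z - w - c) = c by apply: R3_eq => /=; ring.
  rewrite (norm1B (c + c)); lra.
(* With [z] near [c], the factor [xi - z] is bounded by 2, and either position of [- w] is
   allowed. *)
apply: (bd 2 (2 * (c1 + 1))); last by lra.
  by have := norm1B_le xi c z; rewrite (norm1B c z); lra.
have hz : norm1 z <= c1 + 1 by have := norm1D (z - c) c; rewrite subrK; lra.
have hw : norm1 w <= c1 + 1.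
  rewrite -norm1N; case: nw => nw; first by lra.
  by have := norm1D (- w - c) c; rewrite subrK; lra.
by have := norm1D z w; lra.
Qed.

End Phase.

Variable V : R3 R -> R.
Hypothesis V_ge0 : forall x, 0 <= V x.
Hypothesis V_int : (@leb3 R).-integrable setT (fun x => (japanese x * V x)%:E).
Variables (beta N M sg kappa delta : R) (c : R3 R).
Hypothesis N_gt0 : 0 < N.
Hypothesis ME : N `^ beta = M.
Hypothesis cE : c = (M * sg, 0, 0).
Hypothesis c_ge6 : 6 <= norm1 c.
Hypothesis kappa_gt0 : 0 < kappa.
Hypothesis delta_ge0 : 0 <= delta.
Hypothesis symbol_M : 2 * Vmom V <= symbol V (sg, 0, 0) * M.
Hypothesis symbol_s : 0 <= symbol V (sg, 0, 0).
Let M_gt0 : 0 < M. Proof. by rewrite -ME powR_gt0. Qed.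
Local Notation g := (twobump kappa delta c).
Let g_ge0 x : 0 <= g x. Proof. by apply: twobump_ge0 => //; exact: ltW. Qed.

Variable t : R.
Hypothesis t_ge0 : 0 <= t.
Hypothesis t_small : 20 * norm1 c * t <= 1.

Let ggg xi z w := g z * g (xi - z - w) * g (- w).

Let ggg_ge0 xi z w : 0 <= ggg xi z w.
Proof. by apply: mulr_ge0 => //; apply: mulr_ge0. Qed.

(** On the support, [phase_bound] and [20 * norm1 c * t <= 1] bound the phase by 1/2, and
    [|1 - cos u| <= |u|] gives a cosine of at least 1/2. Off the support both sides vanish. *)
Let cos_ggg xi z w : bump (xi - c) != 0 ->
  ggg xi z w / 2 <= ggg xi z w * cos (t * (2 * dot (xi - z) (z + w))).
Proof.
move=> bx; have [->|] := eqVneq (ggg xi z w) 0; first by rewrite !mul0r.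
move=> n0.
have gz : g z != 0 by apply: contraNneq n0 => h; rewrite /ggg h !mul0r.
have gy : g (xi - z - w) != 0 by apply: contraNneq n0 => h; rewrite /ggg h mulr0 mul0r.
have gw : g (- w) != 0 by apply: contraNneq n0 => h; rewrite /ggg h mulr0.
rewrite ler_wpM2l//.
have h := phase_bound c_ge6 bx gz gy gw.
have := Rcos_lip 0 (t * (2 * dot (xi - z) (z + w))).
rewrite cos0 sub0r normrN normrM (ger0_norm t_ge0).
have : t * `|2 * dot (xi - z) (z + w)| <= 1 / 2.
  by apply: le_trans (ler_wpM2l t_ge0 h) _; have := t_small; lra.
by move=> h1 h2; have := ler_norm (1 - cos (t * (2 * dot (xi - z) (z + w)))); lra.
Qed.

(** Half the heights of the three bumps involved: [kappa / 2] for the two low ones and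
    [kappa * delta / 2] for the high one. *)
Let A := kappa ^+ 3 * delta / 8.

Let A_ge0 : 0 <= A.
Proof. by rewrite /A !mulr_ge0// ?exprn_ge0 ?invr_ge0 ?ltW. Qed.

Let ggg_box xi z w :
  A * \1_(box a) (xi - c) * \1_(box a) z * \1_(box a) w <= ggg xi z w.
Proof.
rewrite !indicE; have [xb|_] := boolP (xi - c \in _); last by rewrite !(mulr0, mul0r).
have [zb|_] := boolP (z \in _); last by rewrite !(mulr0, mul0r).
have [wb|_] := boolP (w \in _); last by rewrite mulr0.
rewrite !inE in xb zb wb; rewrite !mulr1.
have small x : box a x -> box (1 / 6) x by apply: box_le; lra.
have k2 : 0 <= kappa / 2 by rewrite divr_ge0// ltW.
have near0 x : box (1 / 6) x -> kappa / 2 <= g x.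
  move=> /bump_half bx; rewrite /twobump ler_pM2l//.
  by have := mulr_ge0 delta_ge0 (bump_ge0 (x - c)); lra.
have nearc x : box (1 / 6) (x - c) -> kappa * delta / 2 <= g x.
  move=> /bump_half bx; rewrite /twobump -mulrA ler_pM2l//.
  by have := ler_wpM2l delta_ge0 bx; have := bump_ge0 x; lra.
have -> : A = kappa / 2 * (kappa * delta / 2) * (kappa / 2) by rewrite /A; field.
have kd : 0 <= kappa * delta / 2 by rewrite divr_ge0// mulr_ge0// ltW.
rewrite /ggg; apply: ler_pM => //; first exact: mulr_ge0.
  apply: ler_pM => //; first exact: near0 (small _ zb).
  apply: nearc.
  have -> : xi - z - w - c = (xi - c) + (- z + - w) by apply: R3_eq => /=; ring.
  have := boxD xb (boxD (boxN zb) (boxN wb)).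
  by rewrite (_ : a + (a + a) = 1 / 6)//; lra.
by apply: near0; exact: small (boxN wb).
Qed.

Local Notation k := (evol (fun x => (g x)%:C) t).

Let gk : good (kappa * (1 + delta)) (norm1 c + 1) (fun x => (g x)%:C).
Proof. by apply: good_twobump => //; exact: ltW. Qed.

(** The conjugate in [reflJ] reverses the phase of the factor at [- w], so the four quadratic phases
    combine into a product of two differences. *)
Let integrand xi z w : expi (t * dot xi xi) * k z * (k (xi - z - w) * reflJ k w) =
  (ggg xi z w)%:C * expi (t * (2 * dot (xi - z) (z + w))).
Proof.
rewrite /reflJ /evol.
have -> : (expi (- (t * dot (- w) (- w))) * (g (- w))%:C)^* =
    expi (t * dot (- w) (- w)) * (g (- w))%:C.
  by rewrite expiN; apply: complex_eq; rewrite !cReE /=; ring.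
have -> : t * (2 * dot (xi - z) (z + w)) = (t * dot xi xi + - (t * dot z z)) +
    (- (t * dot (xi - z - w) (xi - z - w)) + t * dot (- w) (- w)).
  by rewrite /dot /=; ring.
by rewrite !expiD /ggg !RCM; ring.
Qed.

Let inner xi z := expi (t * dot xi xi) * k z *
  cint (@leb3 R) (fun w => k (xi - z - w) * reflJ k w).

Let inner_ge xi z : bump (xi - c) != 0 ->
  A / 2 * (2 * a) ^+ 3 * \1_(box a) (xi - c) * \1_(box a) z <= cRe (inner xi z).
Proof.
move=> bx; have [L gL] := good_evol gk t.
have [_ rL _ _] := gL; have gJ := good_reflJ gL; have [_ _ _ Jb] := gJ.
have [it _] := conv_bound (xi - z) rL (good_cmeas gL) (good_cmeas gJ) (good_bound gL) Jb.
have itF := cintbleZ (expi (t * dot xi xi) * k z) it.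
rewrite /inner -cintZ//.
have iB : (@leb3 R).-integrable setT
    (fun w => (A / 2 * \1_(box a) (xi - c) * \1_(box a) z * \1_(box a) w)%:E).
  by under eq_fun do rewrite EFinM; apply: integrableZl => //; exact: integrable_box.
have -> : A / 2 * (2 * a) ^+ 3 * \1_(box a) (xi - c) * \1_(box a) z =
    \int[@leb3 R]_w (A / 2 * \1_(box a) (xi - c) * \1_(box a) z * \1_(box a) w).
  rewrite RintegralZl//; last exact: integrable_box.
  by rewrite Rintegral_box//; ring.
apply: (le_Rintegral measurableT iB itF.1) => w _.
rewrite integrand; apply: le_trans (_ : ggg xi z w / 2 <= _).
  by have := ggg_box xi z w; lra.
by rewrite ReM /= mul0r subr0; exact: cos_ggg.
Qed.

(** [xi - z] is within 1 of [c], so after division by [M] the argument moves by at most [1 / M]; by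
    [symbol_M] the Lipschitz error is at most half of the symbol at [(sg, 0, 0)]. *)
Let symbol_near xi z : box a (xi - c) -> box a z ->
  symbol V (sg, 0, 0) / 2 <= symbol V (M^-1 *: (xi - z)).
Proof.
move=> xb zb; have := symbol_lip V_ge0 V_int (sg, 0, 0) (M^-1 *: (xi - z)).
have -> : (sg, 0, 0) - M^-1 *: (xi - z) = - (M^-1 *: ((xi - c) + - z)) :> R3 R.
  have sE : M^-1 * (M * sg) = sg by rewrite mulrA mulVf ?mul1r// gt_eqF.
  have cs : M^-1 *: c = (sg, 0, 0).
    by rewrite cE; apply: R3_eq; rewrite /= /GRing.scale /= ?mulr0 ?sE.
  rewrite -cs -scalerBr -scalerN; congr (_ *: _).
  by apply: R3_eq => /=; ring.
have Mi : 0 <= M^-1 by rewrite invr_ge0 ltW.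
rewrite norm1N norm1Z (ger0_norm Mi) => h.
have n1 : norm1 ((xi - c) + - z) <= 1.
  by have := norm1D (xi - c) (- z); have := box_norm1 xb; have := box_norm1 (boxN zb); lra.
have h2 : Vmom V * (M^-1 * norm1 ((xi - c) + - z)) <= symbol V (sg, 0, 0) / 2.
  apply: (@le_trans _ _ (Vmom V * M^-1)).
    by rewrite ler_wpM2l ?Vmom_ge0// ler_piMr.
  by rewrite ler_pdivrMr//; have := symbol_M; lra.
by have := ler_norm (symbol V (sg, 0, 0) - symbol V (M^-1 *: (xi - z))); lra.
Qed.

(** One [c0] for each of the two convolutions, half the symbol, [A / 2] with the 2 due to the
    cosine, and the volumes of the boxes of [w] and [z]. *)
Let B := c0 ^+ 2 * (symbol V (sg, 0, 0) / 2) * (A / 2 * (2 * a) ^+ 3) * (2 * a) ^+ 3.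

(** The minus sign is that of [multN]. Every remaining contribution to the real part is nonnegative,
    so restricting [z] and [w] to small boxes loses nothing but size. *)
Let profile_ge xi : bump (xi - c) != 0 ->
  B * \1_(box a) (xi - c) <= - cRe (profile V beta N (fun x => (g x)%:C) t xi).
Proof.
move=> bx; have [L gL] := good_evol gk t.
have gJ := good_reflJ gL; have gc := good_conv gL gJ.
have mlip := multN_lip V_ge0 V_int beta N_gt0; rewrite ME in mlip.
have gm := @good_mult _ (2 * b0 V) (Vmom V * M^-1) _ _ (multN V beta N) _ _ _
  (multN_bound V_ge0 V_int beta N) mlip gc.
have {}gm := gm _ _; have {}gm := gm ltac:(by rewrite mulr_ge0// b0_ge0)
  ltac:(by rewrite mulr_ge0 ?Vmom_ge0// invr_ge0 ltW).
have [_ rL _ kb] := gL.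
have [it _] := conv_bound xi rL (good_cmeas gm) (good_cmeas gL) (good_bound gm) kb.
have itF := cintbleZ (- expi (t * dot xi xi)) it.
have E z : - expi (t * dot xi xi) *
    ((multN V beta N (xi - z))%:C * conv k (reflJ k) (xi - z) * k z) =
    (c0 * symbol V (M^-1 *: (xi - z)))%:C * inner xi z.
  by rewrite /inner /conv /multN ME RCN RCM; ring.
have -> : - cRe (profile V beta N (fun x => (g x)%:C) t xi) =
    c0 * \int[@leb3 R]_z (c0 * symbol V (M^-1 *: (xi - z)) * cRe (inner xi z)).
  rewrite /profile /trilinear {1}/conv.
  set I := cint _ _.
  have -> : expi (t * dot xi xi) * (c0%:C * I) = - (c0%:C * (- expi (t * dot xi xi) * I)).
    by ring.
  rewrite ReN opprK /I -cintZ// (eq_cint (@leb3 R) E) ReM /= mul0r subr0; congr (_ * _).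
  by apply: eq_Rintegral => z _; rewrite /= mul0r subr0.
have iR : (@leb3 R).-integrable setT
    (fun z => (c0 * symbol V (M^-1 *: (xi - z)) * cRe (inner xi z))%:E).
  move: itF.1; congr (integrable _ _ _); apply/funext => z.
  by rewrite E ReM /= mul0r subr0.
pose D := c0 * (symbol V (sg, 0, 0) / 2) * (A / 2 * (2 * a) ^+ 3) * \1_(box a) (xi - c).
have iB : (@leb3 R).-integrable setT (fun z => (D * \1_(box a) z)%:E).
  by under eq_fun do rewrite EFinM; apply: integrableZl => //; exact: integrable_box.
have -> : B * \1_(box a) (xi - c) = c0 * \int[@leb3 R]_z (D * \1_(box a) z).
  rewrite RintegralZl//; last exact: integrable_box.
  by rewrite Rintegral_box// /B /D; ring.
rewrite ler_pM2l ?c0_gt0//.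
apply: (le_Rintegral measurableT iB iR) => z _.
have := inner_ge z bx; rewrite /D !indicE.
have c00 := @c0_gt0 R; have ss := symbol_s; have AA := A_ge0.
have i0 : 0 <= A / 2 * (2 * a) ^+ 3 by apply: mulr_ge0; [exact: divr_ge0|apply: exprn_ge0; lra].
have [xb|_] := boolP (xi - c \in _); have [zb|_] := boolP (z \in _);
  rewrite ?mulr1 ?mulr0 ?mul0r => h;
  try by rewrite !mulr_ge0 ?symbol_ge0// ltW.
rewrite !inE in xb zb; apply: ler_pM => //; rewrite ?mulr_ge0//; try lra.
by rewrite ler_pM2l//; exact: symbol_near.
Qed.

(** The new factors are the value 1/2 of the bump on the small box around [c] and the volume of that
    box. *)
Lemma pairing_ge (L r : R) : good L r (profile V beta N (fun x => (g x)%:C) t) ->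
  B / 2 * (2 * a) ^+ 3 <= - cRe (cint (@leb3 R)
    (fun xi => (bump (xi - c))%:C * profile V beta N (fun x => (g x)%:C) t xi)).
Proof.
have a_le : a <= 1 / 6 by lra.
move=> gP; set P := profile _ _ _ _ _ in gP *.
have it : cintble (@leb3 R) (fun xi => (bump (xi - c))%:C * P xi).
  apply: (@le_cintble _ T3 R (@leb3 R) _ (fun xi : T3 => nc (P xi))).
  - apply: cmeasM (good_cmeas gP); apply: cmeas_real; exact: measurable_bump.
  - exact: cintble_normc (good_cintble gP).
  - move=> xi; rewrite Normc.normcM normc_real ger0_norm ?bump_ge0//.
    by rewrite ler_piMl ?normc_ge0 ?bump_le1.
have itN := cintbleN it.
rewrite -ReN -cintN//.
have B0 : 0 <= B.
  have c00 := @c0_gt0 R; have ss := symbol_s; have AA := A_ge0.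
  have a3 : 0 <= (2 * a) ^+ 3 by apply: exprn_ge0; lra.
  have AA2 : 0 <= A / 2 by exact: divr_ge0.
  have s2 : 0 <= symbol V (sg, 0, 0) / 2 by exact: divr_ge0.
  exact: mulr_ge0 (mulr_ge0 (mulr_ge0 (sqr_ge0 c0) s2) (mulr_ge0 AA2 a3)) a3.
have [ibs Ibs] := scaling_integrable (scaling_shift (- c)) (@integrable_box R a).
have iB : (@leb3 R).-integrable setT (fun xi => (B / 2 * \1_(box a) (xi - c))%:E).
  by under eq_fun do rewrite EFinM; exact: integrableZl.
have -> : B / 2 * (2 * a) ^+ 3 = \int[@leb3 R]_xi (B / 2 * \1_(box a) (xi - c)).
  by rewrite RintegralZl// Ibs mul1r Rintegral_box//; lra.
apply: (le_Rintegral measurableT iB itN.1) => xi _.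
rewrite ReN ReZ -mulrN.
have [b0|bx] := eqVneq (bump (xi - c)) 0.
  rewrite b0 mul0r indicE memNset ?mulr0// => h.
  by have := bump_half (box_le a_le h); rewrite b0; lra.
have h := profile_ge bx; rewrite -/P in h.
apply: (@le_trans _ _ (bump (xi - c) * (B * \1_(box a) (xi - c)))); last first.
  by rewrite ler_wpM2l ?bump_ge0.
rewrite indicE; have [xb|_] := boolP (xi - c \in _); last by rewrite !mulr0.
rewrite !mulr1 mulrC ler_wpM2r//.
by rewrite inE in xb; have := bump_half (box_le a_le xb); lra.
Qed.

End Positivity.

(** * From the profile to the time integral and to the weighted L^2 norm *)

Section TimePairing.
Context {R : realType}.
Local Notation C := R[i].
Local Notation leb := (@lebesgue_measure R).
Local Notation T1 := (measurableTypeR R).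
Local Notation T3 := (T1 * T1 * T1)%type.
Implicit Types (x y xi c : R3 R) (t T : R).

Lemma sum_leb_cell T n : unitI T -> \sum_(i < n.+2) fine (leb (cell T n i)) = T.
Proof.
move=> uT; have /andP[T_ge0 T_le1] := uT.
have h (i : 'I_n.+2) := cint_cell T n i (1 : C).
have [it E] := cintble_sum (fun i => (h i).1).
have E2 : cint leb (fun s : T1 => \sum_(i < n.+2) (\1_(cell T n i) s)%:C * 1) = T%:C :> C.
  rewrite -[in RHS](Rintegral_itv0 T_ge0) -cint_real; apply: eq_cint => s.
  rewrite indicE; have [sT|sT] := boolP (s \in _).
    by rewrite (@sum_cell _ (fun=> 1))//; move: sT; rewrite inE /= in_itv.
  rewrite big1// => i _; rewrite indicE memNset ?mul0r// => /cell_sub h1.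
  by move: sT; rewrite notin_setE.
have : (\sum_(i < n.+2) fine (leb (cell T n i)))%:C = T%:C :> C.
  rewrite rmorph_sum -E2 E; apply: eq_bigr => i _.
  by have [_ ->] := h i; rewrite mulr1.
by move=> /(congr1 (@complex.Re R)).
Qed.

Section Pairing.
Variables (w : R3 R -> R).
Hypothesis mw : measurable_fun setT (w : T3 -> R).
Hypothesis w01 : forall x, 0 <= w x <= 1.

Lemma cintble_weight (f : R3 R -> C) : cintble (@leb3 R) f ->
  cintble (@leb3 R) (fun xi => (w xi)%:C * f xi).
Proof.
move=> itf; apply: (@le_cintble _ T3 R (@leb3 R) _ (fun xi : T3 => nc (f xi))).
- by apply: cmeasM (cintble_meas itf); exact: cmeas_real.
- exact: cintble_normc.
- move=> xi; have /andP[w0 w1] := w01 xi.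
  by rewrite Normc.normcM normc_real ger0_norm// ler_piMl ?normc_ge0.
Qed.

(** A Riemann sum inherits the bound because the cells have total measure [T]; the difference from
    the integral is at most [D / (n + 1)], and [n] is arbitrary. *)
Lemma tint_pairing (K r B T : R) (E : R -> R3 R -> C) : gfam K r E -> unitI T ->
  (forall t, 0 <= t <= T ->
    B <= - cRe (cint (@leb3 R) (fun xi => (w xi)%:C * E t xi))) ->
  B * T <= - cRe (cint (@leb3 R) (fun xi => (w xi)%:C * tint E T xi)).
Proof.
move=> gE uT EB; have /andP[T_ge0 T_le1] := uT.
have u0 : unitI (0 : R) by rewrite /unitI lexx ler01.
have [K0 r0 _ _] := gE.1 0 u0.
have itE t : unitI t -> cintble (@leb3 R) (E t).
  by move=> ut; exact: good_cintble (gE.1 t ut).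
have itT := good_cintble (good_tint gE T_ge0).
set X := cint _ _; pose D := K * (2 * r) ^+ 3.
have D0 : 0 <= D by rewrite /D mulr_ge0// exprn_ge0// mulr_ge0.
have h n : B * T <= - cRe X + D / n.+1%:R.
  have itn := cintble_rsum gE T n.
  have wT := cintble_weight itT; have wn := cintble_weight itn.
  pose Y := cint (@leb3 R) (fun xi => (w xi)%:C * rsum E T n xi).
  have XY : nc (X - Y) <= D / n.+1%:R.
    rewrite /X /Y -cintB//.
    have iB : (@leb3 R).-integrable setT (fun xi => (K / n.+1%:R * \1_(box r) xi)%:E).
      by under eq_fun do rewrite EFinM; apply: integrableZl => //; exact: integrable_box.
    have -> : D / n.+1%:R = \int[@leb3 R]_xi (K / n.+1%:R * \1_(box r) xi).
      by rewrite RintegralZl ?Rintegral_box// /D; [ring|exact: integrable_box].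
    apply: le_normc_cint_bound; [exact: cintbleB|exact: iB|move=> xi].
    rewrite -mulrBr Normc.normcM normc_real; have /andP[w0 w1] := w01 xi.
    rewrite ger0_norm//; apply: le_trans (tint_rsum gE n xi uT).
    by rewrite ler_piMl ?normc_ge0.
  have YE : - cRe Y = \sum_(i < n.+2) fine (leb (cell T n i)) *
      - cRe (cint (@leb3 R) (fun xi => (w xi)%:C * E (i%:R / n.+1%:R) xi)).
    have itw (i : 'I_n.+2) := cintbleZ (fine (leb (cell T n i)))%:C
      (cintble_weight (itE _ (unitI_grid (ltn_ord i)))).
    have [_ S] := cintble_sum itw.
    have -> : Y = \sum_(i < n.+2) (fine (leb (cell T n i)))%:C *
        cint (@leb3 R) (fun xi => (w xi)%:C * E (i%:R / n.+1%:R) xi).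
      rewrite /Y; transitivity (\sum_(i < n.+2) cint (@leb3 R) (fun xi =>
          (fine (leb (cell T n i)))%:C * ((w xi)%:C * E (i%:R / n.+1%:R) xi))).
        rewrite -S; apply: eq_cint => xi; rewrite /rsum mulr_sumr.
        by apply: eq_bigr => i _; rewrite mulrCA.
      apply: eq_bigr => i _; rewrite cintZ//; apply: cintble_weight; apply: itE.
      exact: unitI_grid.
    elim/big_ind2 : _ => [|u v u' v' <- <-|i _]; first by rewrite /= oppr0.
      by rewrite ReD opprD.
    by rewrite ReZ mulrN.
  have YB : B * T <= - cRe Y.
    rewrite YE -[X in B * X](sum_leb_cell n uT) mulr_sumr; apply: ler_sum => i _.
    (* The grid point of a nonempty cell lies below some [s <= T], so the hypothesis covers it; grid
       points beyond [T] belong to empty cells of weight 0. *)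
    have [->|/set0P[s [st si]]] := eqVneq (cell T n i) set0.
      by rewrite measure0 mulr0 mul0r.
    rewrite mulrC ler_wpM2l ?fine_ge0//; apply: EB.
    rewrite divr_ge0//= ler_pdivrMr//; case/andP: si => si _.
    by apply: le_trans si _; rewrite ler_wpM2r//; case/andP: st.
  have := Re_le_normc (X - Y); rewrite ReD ReN ler_norml => /andP[_].
  move: XY YB; move: (cRe X) (cRe Y) (nc _) (D / _) (B * T) => x y z d e; lra.
rewrite leNgt; apply/negP => XB; set d := B * T - - cRe X.
have d0 : 0 < d by rewrite subr_gt0.
have h2 := h (Num.truncn (D / d)); have := truncnS_gt (D / d).
rewrite ltr_pdivrMr// => h1.
have h3 : D / (Num.truncn (D / d)).+1%:R < d by rewrite ltr_pdivrMr// mulrC.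
by move: h2 h3; rewrite /d; move: (D / _) => e; lra.
Qed.

End Pairing.

Lemma japanese_le x : japanese x <= 1 + norm1 x.
Proof.
have n0 := norm1_ge0 x.
have n1 : 0 <= 1 + norm1 x by lra.
rewrite -(ger0_norm n1) -sqrtr_sqr ler_wsqrtr//.
have := abs_dot x x; have := ler_norm (dot x x); rewrite sqrrD expr1n expr2.
by move=> *; lra.
Qed.

Lemma sqbox_gt0 : 0 < sqbox (1 : R).
Proof. by rewrite powR_gt0// exprn_gt0// mulr_gt0. Qed.

(** On the support, [xi] is within 1 of [c], so [japanese xi >= |c.1.1| - 1 >= |c.1.1| / 2]. This is
    the factor [M] gained from the [H^1] weight. *)
Lemma L2norm_bump_japanese c : 2 <= `|c.1.1| ->
  (L2norm (fun xi => (bump (xi - c)%R / japanese xi)%:C) <= (2 / `|c.1.1| * sqbox 1)%:E)%E.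
Proof.
move=> c2; pose v (x : R3 R) := (bump x / japanese (x + c))%:C : C.
have mv : cmeas (v : T3 -> C).
  apply: cmeas_real; apply: measurable_funM.
    have := measurable_bump (0 : R3 R); under eq_fun do rewrite subr0; exact.
  have mj : measurable_fun setT (fun x : T3 => japanese ((x : R3 R) + c)).
    apply: (measurableT_comp measurable_japanese).
    by apply: meas3D; [exact: measurable_id|exact: measurable_cst].
  have := measurableT_comp (measurable_powR (-1)) mj.
  apply: eq_measurable_fun => x _ /=.
  by rewrite powR_inv1//; have := japanese_ge1 ((x : R3 R) + c); lra.
have -> : (fun xi : R3 R => (bump (xi - c) / japanese xi)%:C) = (fun xi => v (xi + - c)).
  by apply/funext => xi; rewrite /v subrK.
rewrite L2norm_shift//.
have c0 : 0 < `|c.1.1| by lra.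
apply: L2norm_box => // x.
have j1 := japanese_ge1 (x + c).
rewrite normc_real ger0_norm; last by rewrite divr_ge0 ?bump_ge0//; lra.
have [->|/bump_supp[_ bx]] := eqVneq (bump x) 0.
  by rewrite mul0r mulr_ge0 ?divr_ge0.
rewrite indicE mem_set// mulr1.
have jc : `|c.1.1| / 2 <= japanese (x + c).
  have [+ _ _] := coord_le_japanese (x + c); rewrite /= => h.
  have := ler_normD (x.1.1 + c.1.1) (- x.1.1); rewrite addrAC subrr add0r normrN.
  by case: bx => b1 _ _; lra.
apply: (@le_trans _ _ (1 / japanese (x + c))).
  by rewrite ler_wpM2r ?bump_le1// invr_ge0; lra.
rewrite ler_pdivrMr; last by lra.
by rewrite mulrAC ler_pdivlMr//; lra.
Qed.

(** Cauchy-Schwarz, with the weight [japanese] moved from the bump onto [f]; the phase relating [f]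
    to [P] does not affect the modulus. *)
Lemma L2norm_pairing_ge (c : R3 R) (B T : R) (P f : R3 R -> C) (K r K' r' : R) :
  2 <= `|c.1.1| -> good K r P -> good K' r' f ->
  (forall xi, f xi = expi (- (T * dot xi xi)) * P xi) ->
  B <= - cRe (cint (@leb3 R) (fun xi => (bump (xi - c))%:C * P xi)) ->
  ((B * `|c.1.1| / (2 * sqbox 1))%:E <=
    L2norm (fun xi => (japanese xi)%:C * f xi)%R)%E.
Proof.
move=> c2 gP gf fE BP.
have c0 : 0 < `|c.1.1| by lra.
have s0 := sqbox_gt0.
have b01 x : 0 <= bump (x - c) <= 1 by rewrite bump_ge0 bump_le1.
have mb := measurable_bump c.
have mj := cmeas_real (@measurable_japanese R).
have mf := cmeasM mj (good_cmeas gf).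
have me : cmeas (fun xi : T3 => expi (T * dot xi xi) : C).
  apply: cmeas_expi; apply: measurable_funM; first exact: measurable_cst.
  by apply: meas_dot; exact: measurable_id.
pose k (xi : R3 R) : C := expi (T * dot xi xi) * ((japanese xi)%:C * f xi).
have mk : cmeas (k : T3 -> C) by exact: cmeasM.
pose wt (xi : R3 R) := bump (xi - c) / japanese xi.
have E xi : (bump (xi - c))%:C * P xi = (wt xi)%:C * k xi.
  have j1 := japanese_ge1 xi; have j0 : japanese xi != 0 by rewrite gt_eqF//; lra.
  rewrite /wt /k fE [RHS](_ : _ = (bump (xi - c) / japanese xi)%:C * (japanese xi)%:C *
    (expi (- (T * dot xi xi)) * expi (T * dot xi xi)) * P xi); last by ring.
  by rewrite expiNM mulr1 -RCM divfK.
have mwt : measurable_fun setT (wt : T3 -> R).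
  apply: measurable_funM => //.
  have := measurableT_comp (measurable_powR (-1)) (@measurable_japanese R).
  apply: eq_measurable_fun => x _ /=.
  by rewrite powR_inv1//; have := japanese_ge1 x; lra.
have it := cintble_weight mb b01 (good_cintble gP).
have itk : cintble (@leb3 R) (fun xi => (wt xi)%:C * k xi).
  by move: it; congr cintble; apply/funext => xi; exact: E.
have {}BP : B <= - cRe (cint (@leb3 R) (fun xi => (wt xi)%:C * k xi)).
  by move: BP; congr (_ <= - cRe _); exact: eq_cint.
have := cauchy_schwarz mwt mk itk => CS.
have BE : (B%:E <= (2 / `|c.1.1| * sqbox 1)%:E * L2norm (fun xi => (japanese xi)%:C * f xi)%R)%E.
  apply: (@le_trans _ _ (nc (cint (@leb3 R) (fun xi => (wt xi)%:C * k xi)))%:E).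
    rewrite lee_fin; apply: le_trans BP _; apply: le_trans (Re_le_normc _).
    by rewrite -normrN ler_norm.
  apply: le_trans CS _; apply: lee_pmul; rewrite ?L2norm_ge0//.
    exact: L2norm_bump_japanese.
  apply: le_L2norm => // xi.
  by rewrite /k Normc.normcM normc_expi mul1r.
have p0 : 0 < 2 / `|c.1.1| * sqbox 1 by rewrite mulr_gt0// divr_gt0.
move: BE; rewrite -lee_pdivrMl// -EFinM; congr (_ <= _)%E; congr (_%:E).
by field; rewrite !gt_eqF.
Qed.

End TimePairing.

(** * Normalisation of the datum, uniformly in [N] *)

Section Normalization.
Context {R : realType}.
Local Notation C := R[i].
Local Notation T1 := (measurableTypeR R).
Local Notation T3 := (T1 * T1 * T1)%type.
Implicit Types (x y xi : R3 R).
Variables (q M sg : R) (c : R3 R).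
Hypothesis q_ge0 : 0 <= q.
Hypothesis M_ge1 : 1 <= M.
Hypothesis sg_gt0 : 0 < sg.
Hypothesis cE : c = (M * sg, 0, 0).
Local Notation g := (twobump 1 (M `^ (- q)) c).
Local Notation weighted := (fun xi => (japanese xi `^ q)%:C * (g xi)%:C : C).

(** On the low bump [japanese <= 2]; on the high one [japanese <= 2 + M sg <= M (sg + 2)], and the
    power [M^q] is cancelled by the height [M^-q]. The bound is free of [M]. *)
Definition Hq_bound : R := (2 `^ q + (sg + 2) `^ q) * sqbox 1.

Let norm1c : norm1 c = M * sg.
Proof.
rewrite cE /norm1 /= normr0 !addr0 ger0_norm// mulr_ge0 ?(ltW sg_gt0)//.
exact: le_trans M_ge1.
Qed.

Lemma measurable_japanese_powR : measurable_fun setT (fun xi : T3 => japanese xi `^ q : R).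
Proof. exact: (measurableT_comp (measurable_powR q) measurable_japanese). Qed.

Let gg : good (1 * (1 + M `^ (- q))) (norm1 c + 1) (fun x => (g x)%:C).
Proof. by apply: good_twobump => //; exact: powR_ge0. Qed.

Lemma cmeas_weighted : cmeas (weighted : T3 -> C).
Proof. apply: cmeasM (good_cmeas gg); apply: cmeas_real; exact: measurable_japanese_powR. Qed.

Lemma L2norm_weighted_le : (L2norm weighted <= Hq_bound%:E)%E.
Proof.
have M0 : 0 < M by apply: lt_le_trans M_ge1.
have j0 (x : R3 R) : 0 <= japanese x by have := japanese_ge1 x; lra.
pose u x : C := (2 `^ q)%:C * (\1_(box 1) x)%:C.
pose v x : C := ((sg + 2) `^ q)%:C * (\1_(box 1) x)%:C.
have mb : cmeas (fun x : T3 => (\1_(box 1) x)%:C : C).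
  by apply: cmeas_real; apply: measurable_indic; exact: measurable_box.
have mu : cmeas (u : T3 -> C) by apply: cmeasM => //; exact: cmeas_cst.
have mv : cmeas (v : T3 -> C) by apply: cmeasM => //; exact: cmeas_cst.
have mvc : cmeas (fun x : T3 => v ((x : R3 R) + - c)).
  apply: cmeas_comp mv _; apply: meas3D; [exact: measurable_id|exact: measurable_cst].
have ub (x : R3 R) (d : R) : 0 <= d -> nc (d%:C * (\1_(box 1) x)%:C : C) <= d * \1_(box 1) x.
  by move=> d0; rewrite -RCM normc_real ger0_norm ?mulr_ge0.
rewrite /Hq_bound mulrDl EFinD.
apply: (@le_trans _ _ (L2norm u + L2norm (fun x => v (x + - c)%R)%R)%E); last first.
  have p1 := powR_ge0 2 q; have p2 := powR_ge0 (sg + 2) q.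
  by rewrite L2norm_shift//; apply: leeD; apply: L2norm_box => // x; exact: ub.
apply: le_trans (L2normD mu mvc); apply: le_L2norm; [exact: cmeas_weighted|exact: cmeasD|].
move=> x; have -> : (u \+ (fun x => v (x + - c)%R)) x =
    (2 `^ q * \1_(box 1) x + (sg + 2) `^ q * \1_(box 1) (x - c))%:C :> C.
  by rewrite /u /v /= RCD !RCM.
have g0 : 0 <= g x by apply: twobump_ge0 => //; exact: powR_ge0.
rewrite -RCM !normc_real; apply: le_trans (ler_norm _).
rewrite (ger0_norm (mulr_ge0 (powR_ge0 _ _) g0)) /twobump mul1r mulrDr; apply: lerD.
  have [->|bx] := eqVneq (bump x) 0; first by rewrite mulr0 mulr_ge0 ?powR_ge0.
  apply: ler_pM; rewrite ?powR_ge0 ?bump_ge0 ?bump_box//.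
  have [n1 _] := bump_supp bx; apply: ge0_ler_powR; rewrite ?nnegrE//.
  by have := japanese_le x; lra.
have [->|bx] := eqVneq (bump (x - c)) 0; first by rewrite !mulr0 mulr_ge0 ?powR_ge0.
rewrite mulrA; apply: ler_pM; rewrite ?mulr_ge0 ?powR_ge0 ?bump_ge0 ?bump_box//.
have [n1 _] := bump_supp bx.
rewrite powRN.
rewrite ler_pdivrMr ?powR_gt0// -powRM; [|by have := sg_gt0; lra|exact: ltW].
apply: ge0_ler_powR; rewrite ?nnegrE//.
  by rewrite mulr_ge0 ?(ltW M0)//; have := sg_gt0; lra.
have := japanese_le x; have := norm1D (x - c) c; rewrite subrK norm1c.
by have := M_ge1; lra.
Qed.

Lemma L2norm_weighted_gt0 : (0 < L2norm weighted)%E.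
Proof.
rewrite L2normE poweR_gt0//.
have iB : (@leb3 R).-integrable setT (fun xi => (1 / 4 * \1_(box (1 / 6)) xi)%:E).
  by under eq_fun do rewrite EFinM; apply: integrableZl => //; exact: integrable_box.
apply: (@lt_le_trans _ _ (\int[@leb3 R]_xi (1 / 4 * \1_(box (1 / 6)) xi)%:E)%E).
  rewrite -integrable_fineE// lte_fin RintegralZl//; last exact: integrable_box.
  by rewrite Rintegral_box// mulr_gt0// exprn_gt0// mulr_gt0.
apply: ge0_le_integral => //.
- exact: measurable_int iB.
- exact: measurable_sqnc cmeas_weighted.
move=> x _; rewrite lee_fin indicE; have [xb|_] := boolP (x \in _); last first.
  by rewrite mulr0 sqr_ge0.
rewrite inE in xb; rewrite mulr1.
have h : 1 / 2 <= nc (weighted x).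
  have g0 : 0 <= g x by apply: twobump_ge0 => //; exact: powR_ge0.
  rewrite -RCM normc_real (ger0_norm (mulr_ge0 (powR_ge0 _ _) g0)).
  have j1 : 1 <= japanese x `^ q.
    rewrite (_ : 1 = 1 `^ q); last by rewrite powR1.
    apply: ge0_ler_powR; rewrite ?nnegrE//.
      by have := japanese_ge1 x; lra.
    exact: japanese_ge1.
  have g2 : 1 / 2 <= g x.
    have := bump_half xb; rewrite /twobump mul1r.
    by have := mulr_ge0 (powR_ge0 M (- q)) (bump_ge0 (x - c)); lra.
  by rewrite -[leLHS]mul1r; apply: ler_pM.
rewrite (_ : 1 / 4 = (1 / 2) ^+ 2); last by field.
by rewrite ler_sqr ?nnegrE ?normc_ge0.
Qed.

(** [kappa] is the inverse of the norm of the unnormalised datum. Its lower bound does not involve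
    [M], which keeps the final constant independent of [N]. *)
Lemma normalized_twobump : exists2 kappa : R, 0 < kappa /\ Hq_bound^-1 <= kappa &
  Hnorm q (Finv (fun xi => (twobump kappa (M `^ (- q)) c xi)%:C)) = 1%E.
Proof.
have U0 := L2norm_weighted_gt0; have UL := L2norm_weighted_le.
have [u uE] : exists u : R, L2norm weighted = u%:E.
  exists (fine (L2norm weighted)); rewrite fineK// ge0_fin_numE ?L2norm_ge0//.
  by apply: le_lt_trans UL _; rewrite ltry.
rewrite uE lte_fin in U0; rewrite uE lee_fin in UL.
exists u^-1.
  split; first by rewrite invr_gt0.
  by rewrite lef_pV2// posrE (lt_le_trans U0).
have u0 : 0 <= u^-1 by rewrite invr_ge0 ltW.
have gk := good_twobump c u0 (powR_ge0 M (- q)).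
rewrite (Hnorm_fourier _ (is_fourier_Finv gk)).
have -> : (fun xi => (japanese xi `^ q)%:C * (twobump u^-1 (M `^ (- q)) c xi)%:C) =
    (fun xi => (u^-1)%:C * weighted xi).
  apply/funext => xi; rewrite /twobump mul1r RCM.
  by ring.
by rewrite (L2normZ u0 cmeas_weighted) uE -EFinM mulVf// gt_eqF.
Qed.

End Normalization.

(** [tau = 1 / (20 x)], the longest time that the phase condition allows. The whole interval from
    [tau / 2] to [tau] is used later, since an essential supremum only sees sets of positive
    measure. *)
Lemma time_scale (R : realType) (x : R) : 6 <= x -> exists tau : R,
  [/\ 0 < tau, tau <= 1, 20 * x * tau <= 1 & 1 / 40 <= tau / 2 * x].
Proof.
move=> x6; have x0 : x != 0 by rewrite gt_eqF//; lra.
exists (1 / (20 * x)); split.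
- by rewrite divr_gt0//; lra.
- by rewrite ler_pdivrMr; lra.
- by rewrite mul1r mulfV// mulf_neq0.
- by rewrite le_eqVlt; apply/orP; left; apply/eqP; field.
Qed.

Theorem lemma3p10 (R : realType) (beta : R) (V : R3 R -> R)
    (beta_gt0 : 0 < beta)
    (V_ge0 : forall x, 0 <= V x)
    (V_smooth : smooth V)
    (V_even : forall x, V (- x) = V x)
    (V_neq0 : exists x, V x != 0)
    (V_int : leb3.-integrable setT (fun x => (japanese x * V x)%:E))
    (q : R) (q_ge1 : 1 <= q) :
  exists c N0 : R, 0 < c /\
    forall N : R, N0 <= N ->
      exists f : R3 R -> R[i],
        Hnorm q f = 1%E /\
        exists phi F : R -> R3 R -> R[i],
          [/\ forall t, is_schrodinger t f (phi t),
              forall t, t \in `[0, 1] ->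
                is_duhamel (fun t' => nonlinearity beta V N (phi t')) t (F t) &
              ((c * N `^ (- (q * beta)))%:E <= LooHnorm 1 F)%E].
Proof.
have [sg [sg0 S0]] := symbol_gt0 V_ge0 V_int (V_smooth 0%N).1 V_neq0.
set S := symbol V (sg, 0, 0) in S0.
have q0 : 0 <= q by lra.
(* Beyond this threshold [M >= 1], the bumps are at distance [M sg >= 6], and [symbol_M] holds. *)
pose M0 := 1 + 6 / sg + 2 * Vmom V / S.
have m0 := Vmom_ge0 V_ge0.
have M0a : 0 <= 6 / sg by rewrite divr_ge0// ltW.
have M0b : 0 <= 2 * Vmom V / S by rewrite divr_ge0 ?mulr_ge0// ltW.
have M01 : 1 <= M0 by rewrite /M0; lra.
pose e : R := (2 * (1 / 18)) ^+ 3.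
have e0 : 0 < e by rewrite exprn_gt0// mulr_gt0.
have c00 := @c0_gt0 R; have sq0 := @sqbox_gt0 R.
have Lam0 : 0 < Hq_bound q sg.
  by rewrite mulr_gt0// addr_gt0// powR_gt0//; lra.
pose c0 : R := (2 * pi) `^ (- (3 / 2)).
(* The constant of [pairing_ge] without [kappa ^ 3 * delta]; the 1/16 is the 1/8 in [A] times the
   1/2 of the cosine. *)
pose G : R := c0 ^+ 2 * (S / 2) * (1 / 16 * e) * e / 2 * e.
have G0 : 0 < G.
  have c20 : 0 < c0 ^+ 2 by rewrite exprn_gt0.
  by rewrite /G; do !apply: mulr_gt0 => //; rewrite ?invr_gt0.
(* The cube of [Hq_bound^-1] bounds [kappa ^ 3] from below, and 80 collects the 40 of [time_scale]
   and the 2 of [L2norm_pairing_ge]. *)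
pose cst := G * (Hq_bound q sg)^-1 ^+ 3 / (80 * sqbox 1).
have cst0 : 0 < cst.
  have i3 : 0 < (Hq_bound q sg)^-1 ^+ 3 by rewrite exprn_gt0// invr_gt0.
  by rewrite /cst; apply: divr_gt0; apply: mulr_gt0.
exists cst, (M0 `^ beta^-1); split => //.
move=> N NN.
have N_gt0 : 0 < N by apply: lt_le_trans NN; rewrite powR_gt0//; lra.
pose M := N `^ beta.
have MM0 : M0 <= M.
  have -> : M0 = (M0 `^ beta^-1) `^ beta.
    by rewrite -powRrM mulVf ?powRr1 ?gt_eqF//; lra.
  by apply: ge0_ler_powR; rewrite ?nnegrE ?powR_ge0 ?(ltW beta_gt0) ?(ltW N_gt0).
have M_ge1 : 1 <= M by exact: le_trans MM0.
have M_gt0 : 0 < M by lra.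
have Msg : 6 <= M * sg.
  by rewrite -ler_pdivrMr//; apply: le_trans MM0; rewrite /M0; lra.
have Msg0 : 0 <= M * sg by exact: le_trans (ler0n _ 6) Msg.
have symM : 2 * Vmom V <= S * M.
  by rewrite (mulrC S) -ler_pdivrMr//; apply: le_trans MM0; rewrite /M0; lra.
pose c : R3 R := (M * sg, 0, 0).
have nc1 : norm1 c = M * sg.
  by rewrite /norm1 /c /= normr0 !addr0 ger0_norm.
have c11 : `|c.1.1| = M * sg by rewrite /c /= ger0_norm.
have [kappa [k0 kL] Hq] := @normalized_twobump R q M sg c q0 M_ge1 sg0 erefl.
set delta := M `^ (- q) in Hq.
have d0 : 0 <= delta by exact: powR_ge0.
pose fh (x : R3 R) : R[i] := (twobump kappa delta c x)%:C.
have gf := good_twobump c (ltW k0) d0; rewrite -/fh in gf.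
exists (Finv fh); split => //.
exists (fun t => Finv (evol fh t)), (fun t => Finv (duhamel_hat V beta N fh t)); split.
- by move=> t; exact: is_schrodinger_evol gf t.
- move=> t; rewrite in_itv /= => ut.
  exact: (is_duhamel_Finv V_ge0 V_even V_int beta N_gt0 gf ut).
have [tau [tau0 tau1 tau_small tau_large]] := time_scale Msg.
have tau2 : 0 < tau / 2 by rewrite divr_gt0.
apply: (@Lnorm_oo_ge R _ (tau / 2) tau) => //; first exact: ltW.
  by rewrite ltr_pdivrMr// ltr_pMr// ltr1n.
  by rewrite lee_fin mulr_ge0 ?powR_ge0// ltW.
move=> T /andP[T1 T2].
have T0 : 0 < T by exact: lt_le_trans T1.
have T_le1 : T <= 1 by exact: le_trans tau1.
have uT : unitI T by rewrite /unitI (ltW T0).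
have [L [r gD]] := good_duhamel_hat V_ge0 V_int beta N_gt0 gf (ltW T0).
have [L' [r' gP]] := gfam_profile V_ge0 V_int beta N_gt0 gf.
rewrite (Hnorm_fourier _ (is_fourier_Finv gD)).
pose B := c0 ^+ 2 * (S / 2) * (kappa ^+ 3 * delta / 8 / 2 * e) * e / 2 * e.
have BE : B = G * kappa ^+ 3 * delta by rewrite /B /G; field.
have c6 : 6 <= norm1 c by rewrite nc1.
(* [tint] integrates over all earlier times, and these satisfy the phase condition because
   [T <= tau]. *)
have pair t : 0 <= t <= T -> B <= - cRe (cint (@leb3 R) (fun xi =>
    (bump (xi - c))%:C * profile V beta N fh t xi)).
  move=> /andP[t0 tT]; have ut : unitI t by rewrite /unitI t0 (le_trans tT).
  apply: (pairing_ge V_ge0 V_int N_gt0 erefl erefl c6 k0 d0 symM (ltW S0) t0 _ (gP.1 t ut)).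
  rewrite nc1; apply: le_trans tau_small.
  by apply: ler_wpM2l; [exact: mulr_ge0|exact: le_trans tT T2].
have b01 (x : R3 R) : 0 <= bump (x - c) <= 1 by rewrite bump_ge0 bump_le1.
have TP := tint_pairing (measurable_bump c) b01 gP uT pair.
have c2 : 2 <= `|c.1.1| by rewrite c11; apply: le_trans Msg; rewrite ler_nat.
have low := @L2norm_pairing_ge R c _ T _ _ _ _ _ _ c2 (good_tint gP (ltW T0)) gD (fun=> erefl) TP.
have -> : (fun xi => (japanese xi `^ 1)%:C * duhamel_hat V beta N fh T xi) =
   (fun xi => (japanese xi)%:C * duhamel_hat V beta N fh T xi).
  by apply/funext => xi; rewrite powRr1// (le_trans ler01 (japanese_ge1 xi)).
apply: le_trans low; rewrite lee_fin c11.
have -> : N `^ (- (q * beta)) = delta.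
  by rewrite /delta /M -powRrM mulrN (mulrC beta).
have B0 : 0 <= B.
  by rewrite BE; exact: mulr_ge0 (mulr_ge0 (ltW G0) (exprn_ge0 3 (ltW k0))) d0.
have k3 : (Hq_bound q sg)^-1 ^+ 3 <= kappa ^+ 3.
  by apply: lerXn2r; rewrite ?nnegrE ?invr_ge0 ?(ltW Lam0) ?(ltW k0).
have h1 : G * (Hq_bound q sg)^-1 ^+ 3 * delta <= B.
  by rewrite BE ler_wpM2r// ler_pM2l.
have h2 : 1 / 40 <= T * (M * sg).
  by apply: le_trans tau_large _; rewrite ler_wpM2r.
have -> : cst * delta = G * (Hq_bound q sg)^-1 ^+ 3 * delta * (1 / 40) / (2 * sqbox 1).
  by rewrite /cst; field; rewrite !gt_eqF.
rewrite ler_wpM2r ?invr_ge0 ?mulr_ge0 ?(ltW sq0)// -(mulrA B).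
have i0 : 0 <= (Hq_bound q sg)^-1 by rewrite invr_ge0 ltW.
by apply: ler_pM => //; exact: mulr_ge0 (mulr_ge0 (ltW G0) (exprn_ge0 3 i0)) d0.
Qed.
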